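(* Let $(H,\alpha)$ be a monoidal Hom-Hopf algebra over a commutative ring $k$. Then the category ${}^{H}_{H}\widetilde{\mathcal{H}}(\mathcal{M}_k)^{H}_{H}$ of bicovariant $(H,\alpha)$-Hom-bimodules (with tensor product $\otimes_H$ and prebraiding $c_{M,N}(m\otimes_H n)=m_{(-1)}P_R(n_{[0]})\otimes_H P_L(m_{(0)})n_{[1]}$) and the category $\widetilde{\mathcal{H}}(\mathcal{YD})^{H}_{H}$ of right-right $(H,\alpha)$-Hom-Yetter-Drinfeld modules (with tensor product $\otimes_k$ and prebraiding $c_{V,W}(v\otimes w)=\nu(w_{(0)})\otimes\mu^{-1}(v)\lhd w_{(1)}$ for $(V,\mu),(W,\nu)$) are equivalent as prebraided monoidal categories. The tensor equivalence between them is braided whenever $(H,\alpha)$ has a bijective antipode.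
   Context: Conventions: $k$ is a commutative ring, $\otimes=\otimes_k$, Sweedler notation without summation signs. $\widetilde{\mathcal{H}}(\mathcal{M}_k)$ is the category of pairs $(M,\mu)$, $M$ a $k$-module, $\mu$ a $k$-linear automorphism of $M$; morphisms $f:(M,\mu)\to(N,\nu)$ are $k$-linear maps with $\nu f=f\mu$. It is monoidal with $(M,\mu)\otimes(N,\nu)=(M\otimes N,\mu\otimes\nu)$, unit $(k,id)$, associativity constraint $\tilde a((m\otimes n)\otimes p)=\mu(m)\otimes(n\otimes\pi^{-1}(p))$ (for $(P,\pi)\ni p$), unit constraints $x\otimes m\mapsto x\mu(m)$ and $m\otimes x\mapsto x\mu(m)$. A monoidal Hom-bialgebra $(H,\alpha)$ is an object of $\widetilde{\mathcal{H}}(\mathcal{M}_k)$ with a $k$-bilinear product, an element $1_H$, and $k$-linear maps $\Delta(h)=h_1\otimes h_2$, $\varepsilon:H\to k$ such that $\alpha(ab)=\alpha(a)\alpha(b)$, $\alpha(1_H)=1_H$, $\alpha(a)(bc)=(ab)\alpha(c)$, $a1_H=1_Ha=\alpha(a)$; $\Delta(\alpha(c))=\alpha(c_1)\otimes\alpha(c_2)$, $\varepsilon\alpha=\varepsilon$, $\alpha^{-1}(c_1)\otimes\Delta(c_2)=c_{11}\otimes(c_{12}\otimes\alpha^{-1}(c_2))$, $c_1\varepsilon(c_2)=\alpha^{-1}(c)=\varepsilon(c_1)c_2$; and $\Delta(ab)=\Delta(a)\Delta(b)$, $\Delta(1_H)=1_H\otimes1_H$, $\varepsilon(ab)=\varepsilon(a)\varepsilon(b)$,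 $\varepsilon(1_H)=1$. It is a monoidal Hom-Hopf algebra if there is a $k$-linear $S:H\to H$ (antipode) with $S\alpha=\alpha S$ and $S(h_1)h_2=\varepsilon(h)1_H=h_1S(h_2)$. All actions and coactions below are morphisms in $\widetilde{\mathcal{H}}(\mathcal{M}_k)$ (so $\mu(hm)=\alpha(h)\mu(m)$, etc.). Left Hom-module $(M,\mu)$: $\alpha(g)(hm)=(gh)\mu(m)$, $1_Hm=\mu(m)$. Right Hom-module: $(mg)\alpha(h)=\mu(m)(gh)$, $m1_H=\mu(m)$. Hom-bimodule: both, with $(gm)\alpha(h)=\alpha(g)(mh)$. Left Hom-comodule, $\rho(m)=m_{(-1)}\otimes m_{(0)}$: $\Delta(m_{(-1)})\otimes\mu^{-1}(m_{(0)})=(\alpha^{-1}(m_{(-1)})\otimes m_{(0)(-1)})\otimes m_{(0)(0)}$, $\varepsilon(m_{(-1)})m_{(0)}=\mu^{-1}(m)$. Right Hom-comodule, $\sigma(m)=m_{[0]}\otimes m_{[1]}$: $\mu^{-1}(m_{[0]})\otimes\Delta(m_{[1]})=m_{[0][0]}\otimes(m_{[0][1]}\otimes\alpha^{-1}(m_{[1]}))$, $m_{[0]}\varepsilon(m_{[1]})=\mu^{-1}(m)$. A bicovariant $(H,\alpha)$-Hom-bimodule is a Hom-bimodule $(M,\mu)$ with a left Hom-coaction $\rho$ and a right Hom-coaction $\sigma$ such that $\rho((hm)\alpha(g))=\Delta(\alpha(h))(\rho(m)\Delta(g))$, $\sigma((hm)\alpha(g))=\Delta(\alpha(h))(\sigma(m)\Delta(g))$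 (componentwise actions) and $m_{(-1)}\otimes(m_{(0)[0]}\otimes m_{(0)[1]})=\alpha(m_{[0](-1)})\otimes(m_{[0](0)}\otimes\alpha^{-1}(m_{[1]}))$. Morphisms are morphisms in $\widetilde{\mathcal{H}}(\mathcal{M}_k)$ that are $H$-linear and $H$-colinear on both sides. $P_L(m)=S(m_{(-1)})m_{(0)}$, $P_R(m)=m_{[0]}S(m_{[1]})$. Monoidal structure on bicovariant bimodules: $M\otimes_HN$ is the coequalizer of the two maps $(M\otimes H)\otimes N\to M\otimes N$, i.e. the quotient of $M\otimes N$ by the relations $mh\otimes n=\mu(m)\otimes h\nu^{-1}(n)$, with automorphism $\mu\otimes_H\nu$ and $h(m\otimes_Hn)=\alpha^{-1}(h)m\otimes_H\nu(n)$, $(m\otimes_Hn)h=\mu(m)\otimes_Hn\alpha^{-1}(h)$, $\rho(m\otimes_Hn)=m_{(-1)}n_{(-1)}\otimes(m_{(0)}\otimes_Hn_{(0)})$, $\sigma(m\otimes_Hn)=(m_{[0]}\otimes_Hn_{[0]})\otimes m_{[1]}n_{[1]}$; unit object $(H,\alpha)$ with product and coproduct as structure maps; associator $(m\otimes_Hn)\otimes_Hp\mapsto\mu(m)\otimes_H(n\otimes_H\pi^{-1}(p))$; unit constraints $h\otimes_Hm\mapsto hm$, $m\otimes_Hh\mapsto mh$. A right-right $(H,\alpha)$-Hom-Yetter-Drinfeld module $(N,\nu)$ is a right Hom-module ($n\otimes h\mapsto n\lhd h$) and right Hom-comodule ($n\mapsto n_{(0)}\otimes n_{(1)}$) with $n_{(0)}\lhd\alpha^{-1}(h_1)\otimes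 n_{(1)}\alpha^{-1}(h_2)=(n\lhd h_2)_{(0)}\otimes\alpha^{-1}(h_1(n\lhd h_2)_{(1)})$ for all $h,n$; morphisms are right $H$-linear and right $H$-colinear morphisms of $\widetilde{\mathcal{H}}(\mathcal{M}_k)$. Its monoidal structure: $\otimes_k$ with $(m\otimes n)\lhd h=m\lhd h_1\otimes n\lhd h_2$, coaction $m\otimes n\mapsto(m_{(0)}\otimes n_{(0)})\otimes m_{(1)}n_{(1)}$, unit $k$ with trivial structures $x\lhd h=\varepsilon(h)x$, $x\mapsto x\otimes1_H$, and the constraints of $\widetilde{\mathcal{H}}(\mathcal{M}_k)$. A prebraided monoidal category has a natural family $c$ satisfying the hexagon axioms but not required to be invertible; it is braided if $c$ is invertible. *)

(* Defs.v *)
From HB Require Import structures.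
From mathcomp Require Import all_boot all_algebra.
From mathcomp Require Import boolp.

Set Implicit Arguments.
Unset Strict Implicit.
Unset Printing Implicit Defensive.

Import GRing.Theory.

Local Open Scope ring_scope.
Local Open Scope quotient_scope.

Definition bilin (k : comPzRingType) (M N P : lmodType k) (f : M -> N -> P) :=
  (forall n, linear (fun m => f m n)) /\ (forall m, linear (f m)).

Definition mklin (k : comPzRingType) (U V : lmodType k) (f : U -> V) (fL : linear f) :
    {linear U -> V} :=
  HB.pack f (GRing.isLinear.Build k U V _ f fL).

Section BilinTheory.
Variables (k : comPzRingType) (M N P : lmodType k) (f : M -> N -> P).
Hypothesis fB : bilin f.

Lemma bilin0l n : f 0 n = 0.
Proof. by have := fB.1 n (-1) 0 0; rewrite scaler0 addr0 scaleN1r addNr. Qed.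
Lemma bilin0r m : f m 0 = 0.
Proof. by have := fB.2 m (-1) 0 0; rewrite scaler0 addr0 scaleN1r addNr. Qed.
Lemma bilinDl m m' n : f (m + m') n = f m n + f m' n.
Proof. by have := fB.1 n 1 m m'; rewrite !scale1r. Qed.
Lemma bilinDr m n n' : f m (n + n') = f m n + f m n'.
Proof. by have := fB.2 m 1 n n'; rewrite !scale1r. Qed.
Lemma bilinZl a m n : f (a *: m) n = a *: f m n.
Proof. by have := fB.1 n a m 0; rewrite !addr0 bilin0l addr0. Qed.
Lemma bilinZr a m n : f m (a *: n) = a *: f m n.
Proof. by have := fB.2 m a n 0; rewrite !addr0 bilin0r addr0. Qed.

End BilinTheory.

Section QuotientModule.
Variables (k : comPzRingType) (V : lmodType k) (R : V -> Prop).

Inductive lspan : V -> Prop :=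
| lspan_gen v of R v : lspan v
| lspan_0 : lspan 0
| lspan_D u v of lspan u & lspan v : lspan (u + v)
| lspan_Z a v of lspan v : lspan (a *: v).

Lemma lspanN v : lspan v -> lspan (- v).
Proof. by move=> sv; rewrite -scaleN1r; apply: lspan_Z. Qed.

Definition qrel : rel V := fun x y => `[< lspan (x - y) >].

Lemma qrel_equiv : equiv_class_of qrel.
Proof.
split=> [x|x y|y x z].
- by apply/asboolP; rewrite subrr; apply: lspan_0.
- by apply/asboolP/asboolP => /lspanN; rewrite opprB.
- move=> /asboolP sxy /asboolP syz; apply/asboolP.
  by have := lspan_D sxy syz; rewrite addrA subrK.
Qed.

Canonical qrel_canonical := EquivRelPack qrel_equiv.

Definition qmod := {eq_quot qrel}.
HB.instance Definition _ := Choice.on qmod.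
HB.instance Definition _ := EqQuotient.on qmod.

Lemma eq_qmodP (x y : V) : (\pi_qmod x = \pi_qmod y) <-> lspan (x - y).
Proof. by split=> [/eqmodP/asboolP|sxy]; last by apply/eqmodP/asboolP. Qed.

Definition qadd : qmod -> qmod -> qmod :=
  locked (fun x y => \pi_qmod (repr x + repr y)).
Definition qopp : qmod -> qmod := locked (fun x => \pi_qmod (- repr x)).
Definition qscale : k -> qmod -> qmod :=
  locked (fun a x => \pi_qmod (a *: repr x)).

Lemma lspan_repr (x : V) : lspan (repr (\pi_qmod x) - x).
Proof. by apply/eq_qmodP; rewrite reprK. Qed.

Lemma qaddE (x y : V) : qadd (\pi_qmod x) (\pi_qmod y) = \pi_qmod (x + y).
Proof.
rewrite /qadd -lock.
apply/eq_qmodP; rewrite opprD addrACA.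
by apply: lspan_D; apply: lspan_repr.
Qed.

Lemma qoppE (x : V) : qopp (\pi_qmod x) = \pi_qmod (- x).
Proof.
rewrite /qopp -lock. by apply/eq_qmodP; rewrite -opprD; apply/lspanN/lspan_repr. Qed.

Lemma qscaleE a (x : V) : qscale a (\pi_qmod x) = \pi_qmod (a *: x).
Proof.
rewrite /qscale -lock. by apply/eq_qmodP; rewrite -scalerBr; apply/lspan_Z/lspan_repr. Qed.

Lemma qaddA : associative qadd.
Proof. by move=> x y z; elim/quotW: x => x; elim/quotW: y => y; elim/quotW: z => z; rewrite !qaddE addrA. Qed.
Lemma qaddC : commutative qadd.
Proof. by move=> x y; elim/quotW: x => x; elim/quotW: y => y; rewrite !qaddE addrC. Qed.
Lemma qadd0 : left_id (\pi_qmod 0) qadd.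
Proof. by move=> x; elim/quotW: x => x; rewrite qaddE add0r. Qed.
Lemma qaddN : left_inverse (\pi_qmod 0) qopp qadd.
Proof. by move=> x; elim/quotW: x => x; rewrite qoppE qaddE addNr. Qed.

HB.instance Definition _ := GRing.isZmodule.Build qmod qaddA qaddC qadd0 qaddN.

Lemma qpiD (x y : V) : \pi_qmod x + \pi_qmod y = \pi_qmod (x + y).
Proof. exact: qaddE. Qed.

Lemma qscaleA a b v : qscale a (qscale b v) = qscale (a * b) v.
Proof. by elim/quotW: v => x; rewrite !qscaleE scalerA. Qed.
Lemma qscale1 : left_id 1 qscale.
Proof. by move=> x; elim/quotW: x => x; rewrite qscaleE scale1r. Qed.
Lemma qscaleDr : right_distributive qscale +%R.
Proof.
move=> a; move=> x y; elim/quotW: x => x; elim/quotW: y => y.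
by rewrite qpiD !qscaleE qpiD scalerDr.
Qed.
Lemma qscaleDl v : {morph qscale^~ v : a b / a + b}.
Proof. by move=> a b; elim/quotW: v => x; rewrite !qscaleE qpiD scalerDl. Qed.

HB.instance Definition _ :=
  GRing.Zmodule_isLmodule.Build k qmod qscaleA qscale1 qscaleDr qscaleDl.

Lemma qpiZ a (x : V) : a *: \pi_qmod x = \pi_qmod (a *: x).
Proof. exact: qscaleE. Qed.

Definition qpi (x : V) : qmod := \pi_qmod x.

Lemma qpi_linear : linear qpi.
Proof. by move=> a x y; rewrite /qpi qpiZ qpiD. Qed.
HB.instance Definition _ := GRing.isLinear.Build k V qmod _ qpi qpi_linear.

Definition qlift (P : lmodType k) (f : V -> P) (x : qmod) : P := f (repr x).

Lemma qliftE (P : lmodType k) (f : {linear V -> P}) (v : V) :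
  (forall r, R r -> f r = 0) -> qlift f (qpi v) = f v.
Proof.
move=> fR; apply/eqP; rewrite -subr_eq0 -linearB; apply/eqP.
elim: (lspan_repr v) => [r /fR //||x y _ fx _ fy|a x _ fx].
- exact: linear0.
- by rewrite linearD fx fy addr0.
- by rewrite linearZ_LR fx scaler0.
Qed.

Lemma qlift_linear (P : lmodType k) (f : {linear V -> P}) :
  (forall r, R r -> f r = 0) -> linear (qlift f).
Proof.
move=> fR a; move=> x y; elim/quotW: x => x; elim/quotW: y => y.
by rewrite -![\pi_qmod _]/(qpi _) -linearP !qliftE // linearP.
Qed.

End QuotientModule.

Section Tensor.
Variables (k : comPzRingType) (M N : lmodType k).

(* Finite lists of pairs, read as sums of pure tensors, modulo the
   congruence generated by commutativity and k-bilinearity. *)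
Inductive teq : seq (M * N) -> seq (M * N) -> Prop :=
| teq_refl s : teq s s
| teq_sym s t of teq s t : teq t s
| teq_trans t s u of teq s t & teq t u : teq s u
| teq_cat s s' t t' of teq s s' & teq t t' : teq (s ++ t) (s' ++ t')
| teq_catC s t : teq (s ++ t) (t ++ s)
| teq_0 n : teq [:: (0, n)] [::]
| teq_Dl m m' n : teq [:: (m + m', n)] [:: (m, n); (m', n)]
| teq_Dr m n n' : teq [:: (m, n + n')] [:: (m, n); (m, n')]
| teq_Z a m n : teq [:: (a *: m, n)] [:: (m, a *: n)].

Definition trel : rel (seq (M * N)) := fun s t => `[< teq s t >].

Lemma trel_equiv : equiv_class_of trel.
Proof.
split=> [x|x y|y x z].
- by apply/asboolP; apply: teq_refl.
- by apply/asboolP/asboolP => /teq_sym.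
- by move=> /asboolP sxy /asboolP syz; apply/asboolP; apply: teq_trans sxy syz.
Qed.

Canonical trel_canonical := EquivRelPack trel_equiv.

Definition tens := {eq_quot trel}.
HB.instance Definition _ := Choice.on tens.
HB.instance Definition _ := EqQuotient.on tens.

Lemma eq_tensP s t : (\pi_tens s = \pi_tens t) <-> teq s t.
Proof. by split=> [/eqmodP/asboolP|st]; last by apply/eqmodP/asboolP. Qed.

Lemma teq_repr s : teq (repr (\pi_tens s)) s.
Proof. by apply/eq_tensP; rewrite reprK. Qed.

Definition tmapl (f : M -> M) (s : seq (M * N)) := [seq (f p.1, p.2) | p <- s].

Lemma teq_mapl (f : {linear M -> M}) s t :
  teq s t -> teq (tmapl f s) (tmapl f t).
Proof.
elim=> {s t} [s|s t _|t s u _ st _|s s' t t' _ ss _ tt|s t|n|m m' n|m n n'|a m n].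
- exact: teq_refl.
- exact: teq_sym.
- exact: teq_trans.
- by rewrite /tmapl !map_cat; apply: teq_cat.
- by rewrite /tmapl !map_cat; apply: teq_catC.
- by rewrite /= linear0; apply: teq_0.
- by rewrite /= linearD; apply: teq_Dl.
- exact: teq_Dr.
- by rewrite /= linearZ_LR; apply: teq_Z.
Qed.

Definition tadd : tens -> tens -> tens :=
  locked (fun x y => \pi_tens (repr x ++ repr y)).
Definition topp : tens -> tens :=
  locked (fun x => \pi_tens (tmapl -%R (repr x))).
Definition tscale : k -> tens -> tens :=
  locked (fun a x => \pi_tens (tmapl ( *:%R a) (repr x))).

Lemma taddE s t : tadd (\pi_tens s) (\pi_tens t) = \pi_tens (s ++ t).
Proof.
rewrite /tadd -lock. by apply/eq_tensP; apply: teq_cat; apply: teq_repr. Qed.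
Lemma toppE s : topp (\pi_tens s) = \pi_tens (tmapl -%R s).
Proof.
rewrite /topp -lock. by apply/eq_tensP; apply: (@teq_mapl -%R); apply: teq_repr. Qed.
Lemma tscaleE a s : tscale a (\pi_tens s) = \pi_tens (tmapl ( *:%R a) s).
Proof.
rewrite /tscale -lock. by apply/eq_tensP; apply: (@teq_mapl ( *:%R a)); apply: teq_repr. Qed.

Lemma taddA : associative tadd.
Proof. by move=> x y z; elim/quotW: x => x; elim/quotW: y => y; elim/quotW: z => z; rewrite !taddE catA. Qed.
Lemma taddC : commutative tadd.
Proof.
move=> x y; elim/quotW: x => x; elim/quotW: y => y; rewrite !taddE.
by apply/eq_tensP; apply: teq_catC.
Qed.
Lemma tadd0 : left_id (\pi_tens [::]) tadd.
Proof. by move=> x; elim/quotW: x => x; rewrite taddE. Qed.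
Lemma taddN : left_inverse (\pi_tens [::]) topp tadd.
Proof.
move=> x; elim/quotW: x => x; rewrite toppE taddE; apply/eq_tensP.
elim: x => [|[m n] s IH] /=; first exact: teq_refl.
apply: (@teq_trans (([:: (- m, n)] ++ [:: (m, n)]) ++ (tmapl -%R s ++ s))).
  rewrite -cat1s -(cat1s (m, n)) -!catA; apply: teq_cat; first exact: teq_refl.
  by rewrite !catA; apply: teq_cat; [apply: teq_catC | apply: teq_refl].
apply: (@teq_trans ([::] ++ [::])); last exact: teq_refl.
apply: teq_cat => //; apply: teq_trans (teq_sym (teq_Dl _ _ _)) _.
by rewrite addNr; apply: teq_0.
Qed.

HB.instance Definition _ := GRing.isZmodule.Build tens taddA taddC tadd0 taddN.

Lemma tpiD s t : \pi_tens s + \pi_tens t = \pi_tens (s ++ t).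
Proof. exact: taddE. Qed.

Lemma tscaleA a b v : tscale a (tscale b v) = tscale (a * b) v.
Proof.
elim/quotW: v => s; rewrite !tscaleE; congr (\pi_tens _).
by rewrite /tmapl -map_comp; apply: eq_map => p /=; rewrite scalerA.
Qed.
Lemma tscale1 : left_id 1 tscale.
Proof.
move=> s; elim/quotW: s => s; rewrite tscaleE; congr (\pi_tens _).
by rewrite /tmapl -[RHS]map_id; apply: eq_map => -[m n] /=; rewrite scale1r.
Qed.
Lemma tscaleDr : right_distributive tscale +%R.
Proof.
move=> a; move=> s t; elim/quotW: s => s; elim/quotW: t => t.
by rewrite tpiD !tscaleE tpiD /tmapl map_cat.
Qed.
Lemma tscaleDl v : {morph tscale^~ v : a b / a + b}.
Proof.
move=> a b; elim/quotW: v => s; rewrite !tscaleE tpiD; apply/eq_tensP.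
elim: s => [|[m n] s IH] /=; first exact: teq_refl.
pose A := [:: (a *: m, n)]; pose B := [:: (b *: m, n)].
apply: (@teq_trans ((A ++ B) ++ (tmapl ( *:%R a) s ++ tmapl ( *:%R b) s))).
  rewrite -cat1s; apply: teq_cat => //.
  by rewrite scalerDl; apply: teq_Dl.
rewrite -(cat1s (a *: m, n)) -(cat1s (b *: m, n)) -!catA.
apply: teq_cat; first exact: teq_refl.
by rewrite !catA; apply: teq_cat; [apply: teq_catC | apply: teq_refl].
Qed.

HB.instance Definition _ :=
  GRing.Zmodule_isLmodule.Build k tens tscaleA tscale1 tscaleDr tscaleDl.

Lemma tpiZ a s : a *: \pi_tens s = \pi_tens (tmapl ( *:%R a) s).
Proof. exact: tscaleE. Qed.

Definition ptens (m : M) (n : N) : tens := \pi_tens [:: (m, n)].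

Lemma ptens_bilin : bilin ptens.
Proof.
split=> [n a m m'|m a n n']; rewrite /ptens tpiZ tpiD.
  by apply/eq_tensP; apply: teq_Dl.
apply/eq_tensP; apply: teq_trans (teq_Dr _ _ _) _.
rewrite -cat1s -[tmapl _ _ ++ _]/([:: (a *: m, n)] ++ _).
apply: teq_cat; last exact: teq_refl.
by apply: teq_sym; apply: teq_Z.
Qed.

(* A sum over a chosen decomposition of t into pure tensors; by [swE] and
   [sw_linear] it does not depend on that choice when f is k-bilinear, which is
   the case wherever it is used. *)
Definition sw (P : zmodType) (t : tens) (f : M -> N -> P) : P :=
  \sum_(p <- repr t) f p.1 p.2.

Lemma teq_sum (P : lmodType k) (f : M -> N -> P) s t : bilin f -> teq s t ->
  \sum_(p <- s) f p.1 p.2 = \sum_(p <- t) f p.1 p.2.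
Proof.
move=> fB; elim=> {s t}
  [//|s t _ -> //|t s u _ -> _ -> //|s s' t t' _ ss _ tt|s t|n|m m' n|m n n'|a m n].
- by rewrite !big_cat /= ss tt.
- by rewrite !big_cat /= addrC.
- by rewrite big_seq1 big_nil /= bilin0l.
- by rewrite !big_cons !big_nil !addr0 /= bilinDl.
- by rewrite !big_cons !big_nil !addr0 /= bilinDr.
- by rewrite !big_seq1 /= bilinZl // bilinZr.
Qed.

Lemma sw_pi (P : lmodType k) (f : M -> N -> P) s : bilin f ->
  sw (\pi_tens s) f = \sum_(p <- s) f p.1 p.2.
Proof. by move=> bf; apply: teq_sum => //; apply: teq_repr. Qed.

Lemma swE (P : lmodType k) (f : M -> N -> P) m n : bilin f ->
  sw (ptens m n) f = f m n.
Proof. by move=> bf; rewrite sw_pi // big_seq1. Qed.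

Lemma sw_linear (P : lmodType k) (f : M -> N -> P) : bilin f ->
  linear (fun t => sw t f).
Proof.
move=> bf a; move=> s t; elim/quotW: s => s; elim/quotW: t => t.
rewrite tpiZ tpiD !sw_pi //.
rewrite big_cat /= big_map scaler_sumr; congr (_ + _).
by apply: eq_bigr => p _ /=; rewrite bilinZl.
Qed.

Lemma tens_sw (t : tens) : t = sw t ptens.
Proof.
elim/quotW: t => s; rewrite sw_pi; last exact: ptens_bilin.
elim: s => [|p s IH]; first by rewrite big_nil.
by rewrite big_cons -IH tpiD -surjective_pairing.
Qed.

End Tensor.

Notation "m ⊗ n" := (ptens m n) (at level 40, left associativity) : ring_scope.
Notation "\sw_ ( x , y <- t ) E" := (sw t (fun x y => E))
  (at level 41, x name, y name, t at level 60, E at level 41, right associativity) : ring_scope.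

Lemma tens_ext (k : comPzRingType) (M N P : lmodType k)
    (f g : {linear tens M N -> P}) :
  (forall m n, f (m ⊗ n) = g (m ⊗ n)) -> f =1 g.
Proof.
by move=> fg t; rewrite (tens_sw t) !linear_sum; apply: eq_bigr => p _; apply: fg.
Qed.

Definition tens_map (k : comPzRingType) (M N M' N' : lmodType k)
  (f : M -> M') (g : N -> N') (t : tens M N) : tens M' N' :=
  \sw_(m, n <- t) (f m ⊗ g n).

Section TensMap.
Variables (k : comPzRingType) (M N M' N' : lmodType k).
Variables (f : {linear M -> M'}) (g : {linear N -> N'}).

Lemma tens_map_bilin : bilin (fun m n => f m ⊗ g n).
Proof.
split=> [n a m m'|m a n n']; rewrite linearP.
  exact: (ptens_bilin M' N').1.
exact: (ptens_bilin M' N').2.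
Qed.

Lemma tens_map_linear : linear (tens_map f g).
Proof. exact/sw_linear/tens_map_bilin. Qed.
HB.instance Definition _ :=
  GRing.isLinear.Build k (tens M N) (tens M' N') _ (tens_map f g) tens_map_linear.

Lemma tens_mapE m n : tens_map f g (m ⊗ n) = f m ⊗ g n.
Proof. by rewrite /tens_map swE //; apply: tens_map_bilin. Qed.

End TensMap.

Record hobj (k : comPzRingType) := HObj {
  hobj_mod :> lmodType k;
  tw : {linear hobj_mod -> hobj_mod};
  twV : {linear hobj_mod -> hobj_mod};
  twK : cancel tw twV;
  twVK : cancel twV tw
}.
Arguments tw {k h}.
Arguments twV {k h}.

Definition hunit (k : comPzRingType) : hobj k :=
  @HObj k k^o idfun idfun (fun=> erefl) (fun=> erefl).

Section TensorObject.
Variables (k : comPzRingType) (M N : hobj k).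

Definition htens_tw : {linear tens M N -> tens M N} :=
  tens_map (@tw k M) (@tw k N).
Definition htens_twV : {linear tens M N -> tens M N} :=
  tens_map (@twV k M) (@twV k N).

Lemma htens_twK : cancel htens_tw htens_twV.
Proof.
move=> t; apply: (@tens_ext _ _ _ _ (htens_twV \o htens_tw) idfun) => m n /=.
by rewrite !tens_mapE !twK.
Qed.
Lemma htens_twVK : cancel htens_twV htens_tw.
Proof.
move=> t; apply: (@tens_ext _ _ _ _ (htens_tw \o htens_twV) idfun) => m n /=.
by rewrite !tens_mapE !twVK.
Qed.

Definition htens : hobj k := HObj htens_twK htens_twVK.
End TensorObject.

Record homBialgebra (k : comPzRingType) := HomBialgebra {
  hb_obj :> hobj k;
  hmul : hb_obj -> hb_obj -> hb_obj;
  hone : hb_obj;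
  hcomul : {linear hb_obj -> tens hb_obj hb_obj};
  hcounit : {linear hb_obj -> k^o};
  hmul_bilin : bilin hmul;
  hmul_tw : forall a b, tw (hmul a b) = hmul (tw a) (tw b);
  hone_tw : tw hone = hone;
  hmulA : forall a b c, hmul (tw a) (hmul b c) = hmul (hmul a b) (tw c);
  hmul1 : forall a, hmul a hone = tw a;
  h1mul : forall a, hmul hone a = tw a;
  hcomul_tw : forall c, hcomul (tw c) = \sw_(c1, c2 <- hcomul c) (tw c1 ⊗ tw c2);
  hcounit_tw : forall c, hcounit (tw c) = hcounit c;
  hcomulA : forall c,
    \sw_(c1, c2 <- hcomul c) (twV c1 ⊗ hcomul c2) =
    \sw_(c1, c2 <- hcomul c) \sw_(c11, c12 <- hcomul c1) (c11 ⊗ (c12 ⊗ twV c2));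
  hcounitr : forall c, \sw_(c1, c2 <- hcomul c) (hcounit c2 *: c1) = twV c;
  hcounitl : forall c, \sw_(c1, c2 <- hcomul c) (hcounit c1 *: c2) = twV c;
  hcomulM : forall a b, hcomul (hmul a b) =
    \sw_(a1, a2 <- hcomul a) \sw_(b1, b2 <- hcomul b) (hmul a1 b1 ⊗ hmul a2 b2);
  hcomul1 : hcomul hone = hone ⊗ hone;
  hcounitM : forall a b, hcounit (hmul a b) = hcounit a * hcounit b;
  hcounit1 : hcounit hone = 1
}.
Arguments hmul {k h}.
Arguments hone {k} h.
Arguments hcomul {k h}.
Arguments hcounit {k h}.

Record homHopf (k : comPzRingType) := HomHopf {
  hh_bialg :> homBialgebra k;
  antipode : {linear hh_bialg -> hh_bialg};
  antipode_tw : forall h, antipode (tw h) = tw (antipode h);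
  antipodel : forall h,
    \sw_(h1, h2 <- hcomul h) hmul (antipode h1) h2 = hcounit h *: hone hh_bialg;
  antipoder : forall h,
    \sw_(h1, h2 <- hcomul h) hmul h1 (antipode h2) = hcounit h *: hone hh_bialg
}.
Arguments antipode {k h} : rename.

Section Actions.
Variables (k : comPzRingType) (H : homHopf k) (M : hobj k).

Record is_lmodule (act : H -> M -> M) : Prop := IsLmodule {
  lmod_bilin : bilin act;
  lmod_tw : forall h m, tw (act h m) = act (tw h) (tw m);
  lmodA : forall g h m, act (tw g) (act h m) = act (hmul g h) (tw m);
  lmod1 : forall m, act (hone H) m = tw m
}.

Record is_rmodule (act : M -> H -> M) : Prop := IsRmodule {
  rmod_bilin : bilin act;
  rmod_tw : forall m h, tw (act m h) = act (tw m) (tw h);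
  rmodA : forall m g h, act (act m g) (tw h) = act (tw m) (hmul g h);
  rmod1 : forall m, act m (hone H) = tw m
}.

Record is_lcomodule (rho : M -> tens H M) : Prop := IsLcomodule {
  lcom_linear : linear rho;
  lcom_tw : forall m, rho (tw m) = \sw_(h, m0 <- rho m) (tw h ⊗ tw m0);
  lcomA : forall m,
    \sw_(h, m0 <- rho m) (hcomul h ⊗ twV m0) =
    \sw_(h, m0 <- rho m) \sw_(h', m00 <- rho m0) ((twV h ⊗ h') ⊗ m00);
  lcom1 : forall m, \sw_(h, m0 <- rho m) (hcounit h *: m0) = twV m
}.

Record is_rcomodule (sigma : M -> tens M H) : Prop := IsRcomodule {
  rcom_linear : linear sigma;
  rcom_tw : forall m, sigma (tw m) = \sw_(m0, h <- sigma m) (tw m0 ⊗ tw h);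
  rcomA : forall m,
    \sw_(m0, h <- sigma m) (twV m0 ⊗ hcomul h) =
    \sw_(m0, h <- sigma m) \sw_(m00, h' <- sigma m0) (m00 ⊗ (h' ⊗ twV h));
  rcom1 : forall m, \sw_(m0, h <- sigma m) (hcounit h *: m0) = twV m
}.

End Actions.

Record bicov_on (k : comPzRingType) (H : homHopf k) (M : hobj k) := BicovOn {
  lact : H -> M -> M;
  ract : M -> H -> M;
  lco : M -> tens H M;
  rco : M -> tens M H;
  bc_lmod : is_lmodule lact;
  bc_rmod : is_rmodule ract;
  bc_bimod : forall g m h, ract (lact g m) (tw h) = lact (tw g) (ract m h);
  bc_lcom : is_lcomodule lco;
  bc_rcom : is_rcomodule rco;
  bc_lco_act : forall h m g,
    lco (ract (lact h m) (tw g)) =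
    \sw_(h1, h2 <- hcomul (tw h)) \sw_(m1, m0 <- lco m) \sw_(g1, g2 <- hcomul g)
      (hmul h1 (hmul m1 g1) ⊗ lact h2 (ract m0 g2));
  bc_rco_act : forall h m g,
    rco (ract (lact h m) (tw g)) =
    \sw_(h1, h2 <- hcomul (tw h)) \sw_(m0, m1 <- rco m) \sw_(g1, g2 <- hcomul g)
      (lact h1 (ract m0 g1) ⊗ hmul h2 (hmul m1 g2));
  bc_bicom : forall m,
    \sw_(m1, m0 <- lco m) (m1 ⊗ rco m0) =
    \sw_(m0, m1 <- rco m) \sw_(m01, m00 <- lco m0) (tw m01 ⊗ (m00 ⊗ twV m1))
}.

Record bicov (k : comPzRingType) (H : homHopf k) := Bicov {
  bicov_obj :> hobj k;
  bicov_str : bicov_on H bicov_obj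
}.

Section BicovTheory.
Variables (k : comPzRingType) (H : homHopf k).

Definition la (M : bicov H) : H -> M -> M := lact (bicov_str M).
Definition ra (M : bicov H) : M -> H -> M := ract (bicov_str M).
Definition lc (M : bicov H) : M -> tens H M := lco (bicov_str M).
Definition rc (M : bicov H) : M -> tens M H := rco (bicov_str M).

Definition PL (M : bicov H) (m : M) : M :=
  \sw_(h, m0 <- lc m) la (antipode h) m0.
Definition PR (M : bicov H) (m : M) : M :=
  \sw_(m0, h <- rc m) ra m0 (antipode h).

Record is_bicov_hom (M N : bicov H) (f : M -> N) : Prop := IsBicovHom {
  bh_linear : linear f;
  bh_tw : forall m, tw (f m) = f (tw m);
  bh_la : forall h m, f (la h m) = la h (f m);
  bh_ra : forall m h, f (ra m h) = ra (f m) h;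
  bh_lc : forall m, lc (f m) = \sw_(h, m0 <- lc m) (h ⊗ f m0);
  bh_rc : forall m, rc (f m) = \sw_(m0, h <- rc m) (f m0 ⊗ h)
}.

End BicovTheory.

Section BalancedTensor.
Variables (k : comPzRingType) (H : homHopf k) (M N : bicov H).

Definition balanced (t : tens M N) : Prop :=
  exists m h n, t = ra m h ⊗ n - tw m ⊗ la h (twV n).

(* Coequalizer of the two maps (M ⊗ H) ⊗ N -> M ⊗ N. *)
Definition tensH : lmodType k := qmod balanced.

Definition ptensH (m : M) (n : N) : tensH := qpi balanced (m ⊗ n).

Lemma tensH_ext (P : lmodType k) (f g : {linear tensH -> P}) :
  (forall m n, f (ptensH m n) = g (ptensH m n)) -> f =1 g.
Proof.
move=> fg x; rewrite -[x]reprK.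
exact: (@tens_ext _ _ _ _ (f \o qpi balanced) (g \o qpi balanced)).
Qed.

Lemma tw_balanced r : balanced r ->
  (qpi balanced \o tens_map (@tw k M) (@tw k N)) r = 0.
Proof.
move=> [m [h [n ->]]]; rewrite linearB /= !tens_mapE -linearB.
apply/(eq_qmodP balanced _ 0); rewrite subr0; apply: lspan_gen.
exists (tw m), (tw h), (tw n); rewrite twK.
rewrite (rmod_tw (bc_rmod (bicov_str M))) (lmod_tw (bc_lmod (bicov_str N))).
by rewrite twVK.
Qed.

Lemma twV_balanced r : balanced r ->
  (qpi balanced \o tens_map (@twV k M) (@twV k N)) r = 0.
Proof.
move=> [m [h [n ->]]]; rewrite linearB /= !tens_mapE -linearB.
apply/(eq_qmodP balanced _ 0); rewrite subr0; apply: lspan_gen.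
exists (twV m), (twV h), (twV n); rewrite twVK twK.
congr (_ ⊗ _ - _ ⊗ _).
  apply: (can_inj (@twK k M)); rewrite twVK.
  by rewrite (rmod_tw (bc_rmod (bicov_str M))) !twVK.
apply: (can_inj (@twK k N)); rewrite twVK.
by rewrite (lmod_tw (bc_lmod (bicov_str N))) !twVK.
Qed.

Definition tensH_tw : {linear tensH -> tensH} := mklin (qlift_linear tw_balanced).
Definition tensH_twV : {linear tensH -> tensH} := mklin (qlift_linear twV_balanced).

Lemma tensH_twE m n : tensH_tw (ptensH m n) = ptensH (tw m) (tw n).
Proof.
apply: etrans (qliftE _ tw_balanced) _.
by rewrite /= tens_mapE.
Qed.
Lemma tensH_twVE m n : tensH_twV (ptensH m n) = ptensH (twV m) (twV n).
Proof.
apply: etrans (qliftE _ twV_balanced) _.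
by rewrite /= tens_mapE.
Qed.

Lemma tensH_twK : cancel tensH_tw tensH_twV.
Proof.
move=> x; apply: (@tensH_ext _ (tensH_twV \o tensH_tw) idfun) => m n.
by rewrite -[LHS]/(tensH_twV (tensH_tw _)) tensH_twE tensH_twVE !twK.
Qed.
Lemma tensH_twVK : cancel tensH_twV tensH_tw.
Proof.
move=> x; apply: (@tensH_ext _ (tensH_tw \o tensH_twV) idfun) => m n.
by rewrite -[LHS]/(tensH_tw (tensH_twV _)) tensH_twVE tensH_twE !twVK.
Qed.

Definition htensH : hobj k := HObj tensH_twK tensH_twVK.

End BalancedTensor.
Notation "m ⊗_H n" := (ptensH m n) (at level 40, left associativity) : ring_scope.

Record category := Category {
  cobj :> Type;
  hom : cobj -> cobj -> Type;
  cid : forall A, hom A A;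
  ccomp : forall A B C, hom B C -> hom A B -> hom A C;
  ccompA : forall A B C D (f : hom C D) (g : hom B C) (h : hom A B),
    ccomp f (ccomp g h) = ccomp (ccomp f g) h;
  ccomp1 : forall A B (f : hom A B), ccomp f (cid A) = f;
  c1comp : forall A B (f : hom A B), ccomp (cid B) f = f
}.
Arguments cid {c} A.
Notation "f ∘ g" := (ccomp f g) (at level 50, left associativity).

Definition is_iso (C : category) (A B : C) (f : hom A B) :=
  exists g : hom B A, g ∘ f = cid A /\ f ∘ g = cid B.

(* [braid] is not required to be invertible, see [is_braided]. *)
Record prebraided_on (C : category) (T : C -> C -> C) (I : C) := PrebraidedOn {
  tmap : forall A A' B B', hom A A' -> hom B B' -> hom (T A B) (T A' B');
  assoc : forall A B D, hom (T (T A B) D) (T A (T B D));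
  assocV : forall A B D, hom (T A (T B D)) (T (T A B) D);
  lunit : forall A, hom (T I A) A;
  runit : forall A, hom (T A I) A;
  braid : forall A B, hom (T A B) (T B A);
  tmap1 : forall A B, tmap (cid A) (cid B) = cid (T A B);
  tmap_comp : forall A A' A'' B B' B''
    (f : hom A' A'') (f' : hom A A') (g : hom B' B'') (g' : hom B B'),
    tmap (f ∘ f') (g ∘ g') = tmap f g ∘ tmap f' g';
  assocK : forall A B D, assocV A B D ∘ assoc A B D = cid (T (T A B) D);
  assocVK : forall A B D, assoc A B D ∘ assocV A B D = cid (T A (T B D));
  assoc_nat : forall A A' B B' D D'
    (f : hom A A') (g : hom B B') (h : hom D D'),
    assoc A' B' D' ∘ tmap (tmap f g) h = tmap f (tmap g h) ∘ assoc A B D;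
  lunit_iso : forall A, is_iso (lunit A);
  lunit_nat : forall A A' (f : hom A A'),
    lunit A' ∘ tmap (cid I) f = f ∘ lunit A;
  runit_iso : forall A, is_iso (runit A);
  runit_nat : forall A A' (f : hom A A'),
    runit A' ∘ tmap f (cid I) = f ∘ runit A;
  pentagon : forall A B D E,
    assoc A B (T D E) ∘ assoc (T A B) D E =
    tmap (cid A) (assoc B D E) ∘ assoc A (T B D) E ∘ tmap (assoc A B D) (cid E);
  triangle : forall A B,
    tmap (cid A) (lunit B) ∘ assoc A I B = tmap (runit A) (cid B);
  braid_nat : forall A A' B B' (f : hom A A') (g : hom B B'),
    braid A' B' ∘ tmap f g = tmap g f ∘ braid A B;
  hexagon1 : forall A B D,
    assoc B D A ∘ braid A (T B D) ∘ assoc A B D =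
    tmap (cid B) (braid A D) ∘ assoc B A D ∘ tmap (braid A B) (cid D);
  hexagon2 : forall A B D,
    assocV D A B ∘ braid (T A B) D ∘ assocV A B D =
    tmap (braid A D) (cid B) ∘ assocV A D B ∘ tmap (cid A) (braid B D)
}.

Definition is_braided (C : category) (T : C -> C -> C) (I : C)
    (S : prebraided_on T I) :=
  forall A B, is_iso (braid S A B).

Record functor (C D : category) := Functor {
  fobj :> C -> D;
  fmap : forall A B, hom A B -> hom (fobj A) (fobj B);
  fmap1 : forall A, fmap (cid A) = cid (fobj A);
  fmap_comp : forall A B E (f : hom B E) (g : hom A B),
    fmap (f ∘ g) = fmap f ∘ fmap g
}.
Arguments fmap {C D} f {A B} : rename.

Definition is_equivalence (C D : category) (F : functor C D) :=
  exists (G : functor D C)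
         (eta : forall A : C, hom A (G (F A)))
         (eps : forall B : D, hom (F (G B)) B),
    [/\ forall A, is_iso (eta A),
        forall A A' (f : hom A A'), eta A' ∘ f = fmap G (fmap F f) ∘ eta A,
        forall B, is_iso (eps B) &
        forall B B' (g : hom B B'), eps B' ∘ fmap F (fmap G g) = g ∘ eps B].

(* Strong monoidal functors compatible with the prebraidings. *)
Record prebraided_functor (C D : category)
    (T : C -> C -> C) (I : C) (S : prebraided_on T I)
    (T' : D -> D -> D) (I' : D) (S' : prebraided_on T' I') := PrebraidedFunctor {
  pf_functor :> functor C D;
  pf_tens : forall A B,
    hom (T' (pf_functor A) (pf_functor B)) (pf_functor (T A B));
  pf_unit : hom I' (pf_functor I);
  pf_tens_iso : forall A B, is_iso (pf_tens A B);
  pf_unit_iso : is_iso pf_unit;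
  pf_tens_nat : forall A A' B B' (f : hom A A') (g : hom B B'),
    pf_tens A' B' ∘ tmap S' (fmap pf_functor f) (fmap pf_functor g) =
    fmap pf_functor (tmap S f g) ∘ pf_tens A B;
  pf_assoc : forall A B E,
    fmap pf_functor (assoc S A B E) ∘ pf_tens (T A B) E
      ∘ tmap S' (pf_tens A B) (cid (pf_functor E)) =
    pf_tens A (T B E) ∘ tmap S' (cid (pf_functor A)) (pf_tens B E)
      ∘ assoc S' (pf_functor A) (pf_functor B) (pf_functor E);
  pf_lunit : forall A,
    fmap pf_functor (lunit S A) ∘ pf_tens I A
      ∘ tmap S' pf_unit (cid (pf_functor A)) =
    lunit S' (pf_functor A);
  pf_runit : forall A,
    fmap pf_functor (runit S A) ∘ pf_tens A I
      ∘ tmap S' (cid (pf_functor A)) pf_unit =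
    runit S' (pf_functor A);
  pf_braid : forall A B,
    fmap pf_functor (braid S A B) ∘ pf_tens A B =
    pf_tens B A ∘ braid S' (pf_functor A) (pf_functor B)
}.

Section BicovCategory.
Variables (k : comPzRingType) (H : homHopf k).

Record bicov_hom (M N : bicov H) := BicovHom {
  bh_fun :> M -> N;
  bh_ax : is_bicov_hom bh_fun
}.

Lemma bicov_hom_eq (M N : bicov H) (f g : bicov_hom M N) : f =1 g -> f = g.
Proof.
case: f g => [f fP] [g gP] /= /funext fg; case: g / fg gP => gP.
by rewrite (Prop_irrelevance fP gP).
Qed.

Lemma bicov_id_ax (M : bicov H) : is_bicov_hom (@id M).
Proof. by split=> //= m; apply: tens_sw. Qed.

Lemma sw_sum (U V W X : lmodType k) (f : W -> X -> tens U V) (t : tens W X)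
    (P : lmodType k) (g : U -> V -> P) : bilin g ->
  sw (sw t f) g = sw t (fun x y => sw (f x y) g).
Proof.
move=> gB; rewrite -[LHS]/(mklin (sw_linear gB) (sw t f)) linear_sum.
exact: eq_bigr.
Qed.

Lemma bicov_comp_ax (M N P : bicov H) (f : bicov_hom N P) (g : bicov_hom M N) :
  is_bicov_hom (f \o g).
Proof.
have [fL ftw fl fr flc frc] := bh_ax f; have [gL gtw gl gr glc grc] := bh_ax g.
split=> [a x y|m|h m|m h|m|m] /=.
- by rewrite gL fL.
- by rewrite ftw gtw.
- by rewrite gl fl.
- by rewrite gr fr.
- rewrite flc glc sw_sum; last exact: (tens_map_bilin idfun (mklin fL)).
  by apply: eq_bigr => p _; rewrite swE //; apply: (tens_map_bilin idfun (mklin fL)).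
- rewrite frc grc sw_sum; last exact: (tens_map_bilin (mklin fL) idfun).
  by apply: eq_bigr => p _; rewrite swE //; apply: (tens_map_bilin (mklin fL) idfun).
Qed.

Definition bicov_cat : category.
Proof.
refine (@Category (bicov H) bicov_hom (fun M => BicovHom (bicov_id_ax M))
  (fun M N P f g => BicovHom (bicov_comp_ax f g)) _ _ _).
- by move=> *; apply: bicov_hom_eq.
- by move=> *; apply: bicov_hom_eq.
- by move=> *; apply: bicov_hom_eq.
Defined.

(* Every datum is prescribed on pure tensors, hence determined; what a term of
   this type (or of [yd_prebraided] below) adds is that the data are well defined
   on tensor products and satisfy the axioms. *)
Record bicov_prebraided := BicovPrebraided {
  bp_tens_str : forall M N : bicov H, bicov_on H (htensH M N);
  bp_la : forall (M N : bicov H) h m n,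
    lact (bp_tens_str M N) h (m ⊗_H n) = la (twV h) m ⊗_H tw n;
  bp_ra : forall (M N : bicov H) m n h,
    ract (bp_tens_str M N) (m ⊗_H n) h = tw m ⊗_H ra n (twV h);
  bp_lc : forall (M N : bicov H) m n,
    lco (bp_tens_str M N) (m ⊗_H n) =
    \sw_(m1, m0 <- lc m) \sw_(n1, n0 <- lc n) (hmul m1 n1 ⊗ (m0 ⊗_H n0));
  bp_rc : forall (M N : bicov H) m n,
    rco (bp_tens_str M N) (m ⊗_H n) =
    \sw_(m0, m1 <- rc m) \sw_(n0, n1 <- rc n) ((m0 ⊗_H n0) ⊗ hmul m1 n1);
  bp_unit_str : bicov_on H H;
  bp_unit_la : lact bp_unit_str = hmul;
  bp_unit_ra : ract bp_unit_str = hmul;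
  bp_unit_lc : lco bp_unit_str = hcomul;
  bp_unit_rc : rco bp_unit_str = hcomul;
  bp_str :> @prebraided_on bicov_cat
    (fun M N => Bicov (bp_tens_str M N)) (Bicov bp_unit_str);
  bp_tmap : forall (M M' N N' : bicov H) (f : bicov_hom M M') (g : bicov_hom N N') m n,
    (tmap bp_str f g : bicov_hom _ _) (m ⊗_H n) = f m ⊗_H g n;
  bp_assoc : forall (M N P : bicov H) (m : M) (n : N) (p : P),
    (assoc bp_str M N P : bicov_hom _ _)
      (@ptensH k H (Bicov (bp_tens_str M N)) P (m ⊗_H n) p) =
    @ptensH k H M (Bicov (bp_tens_str N P)) (tw m) (n ⊗_H twV p);
  bp_lunit : forall (M : bicov H) (h : H) (m : M),
    (lunit bp_str M : bicov_hom _ _) (@ptensH k H (Bicov bp_unit_str) M h m) =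
    la h m;
  bp_runit : forall (M : bicov H) (h : H) (m : M),
    (runit bp_str M : bicov_hom _ _) (@ptensH k H M (Bicov bp_unit_str) m h) =
    ra m h;
  bp_braid : forall (M N : bicov H) (m : M) (n : N),
    (braid bp_str M N : bicov_hom _ _) (m ⊗_H n) =
    \sw_(m1, m0 <- lc m) \sw_(n0, n1 <- rc n) (la m1 (PR n0) ⊗_H ra (PL m0) n1)
}.

End BicovCategory.

Record yd_on (k : comPzRingType) (H : homHopf k) (N : hobj k) := YDOn {
  yact : N -> H -> N;
  yco : N -> tens N H;
  yd_rmod : is_rmodule yact;
  yd_rcom : is_rcomodule yco;
  yd_compat : forall n h,
    \sw_(n0, n1 <- yco n) \sw_(h1, h2 <- hcomul h)
      (yact n0 (twV h1) ⊗ hmul n1 (twV h2)) =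
    \sw_(h1, h2 <- hcomul h) \sw_(x0, x1 <- yco (yact n h2))
      (x0 ⊗ twV (hmul h1 x1))
}.

Record yd (k : comPzRingType) (H : homHopf k) := YD {
  yd_obj :> hobj k;
  yd_str : yd_on H yd_obj
}.

Section YDCategory.
Variables (k : comPzRingType) (H : homHopf k).

Definition ya (V : yd H) : V -> H -> V := yact (yd_str V).
Definition yc (V : yd H) : V -> tens V H := yco (yd_str V).

Record is_yd_hom (V W : yd H) (f : V -> W) : Prop := IsYDHom {
  yh_linear : linear f;
  yh_tw : forall v, tw (f v) = f (tw v);
  yh_ya : forall v h, f (ya v h) = ya (f v) h;
  yh_yc : forall v, yc (f v) = \sw_(v0, h <- yc v) (f v0 ⊗ h)
}.

Record yd_hom (V W : yd H) := YDHom {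
  yh_fun :> V -> W;
  yh_ax : is_yd_hom yh_fun
}.

Lemma yd_hom_eq (V W : yd H) (f g : yd_hom V W) : f =1 g -> f = g.
Proof.
case: f g => [f fP] [g gP] /= /funext fg; case: g / fg gP => gP.
by rewrite (Prop_irrelevance fP gP).
Qed.

Lemma yd_id_ax (V : yd H) : is_yd_hom (@id V).
Proof. by split=> //= v; apply: tens_sw. Qed.

Lemma yd_comp_ax (U V W : yd H) (f : yd_hom V W) (g : yd_hom U V) :
  is_yd_hom (f \o g).
Proof.
have [fL ftw fr frc] := yh_ax f; have [gL gtw gr grc] := yh_ax g.
split=> [a x y|m|m h|m] /=.
- by rewrite gL fL.
- by rewrite ftw gtw.
- by rewrite gr fr.
- rewrite frc grc sw_sum; last exact: (tens_map_bilin (mklin fL) idfun).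
  by apply: eq_bigr => p _; rewrite swE //; apply: (tens_map_bilin (mklin fL) idfun).
Qed.

Definition yd_cat : category.
Proof.
refine (@Category (yd H) yd_hom (fun V => YDHom (yd_id_ax V))
  (fun U V W f g => YDHom (yd_comp_ax f g)) _ _ _).
- by move=> *; apply: yd_hom_eq.
- by move=> *; apply: yd_hom_eq.
- by move=> *; apply: yd_hom_eq.
Defined.

Record yd_prebraided := YDPrebraided {
  yp_tens_str : forall V W : yd H, yd_on H (htens V W);
  yp_ya : forall (V W : yd H) (v : V) (w : W) h,
    yact (yp_tens_str V W) (v ⊗ w) h = \sw_(h1, h2 <- hcomul h) (ya v h1 ⊗ ya w h2);
  yp_yc : forall (V W : yd H) (v : V) (w : W),
    yco (yp_tens_str V W) (v ⊗ w) =
    \sw_(v0, v1 <- yc v) \sw_(w0, w1 <- yc w) ((v0 ⊗ w0) ⊗ hmul v1 w1);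
  yp_unit_str : yd_on H (hunit k);
  yp_unit_ya : forall x h, yact yp_unit_str x h = hcounit h * x;
  yp_unit_yc : forall x, yco yp_unit_str x = x ⊗ hone H;
  yp_str :> @prebraided_on yd_cat
    (fun V W => YD (yp_tens_str V W)) (YD yp_unit_str);
  yp_tmap : forall (V V' W W' : yd H) (f : yd_hom V V') (g : yd_hom W W') v w,
    (tmap yp_str f g : yd_hom _ _) (v ⊗ w) = f v ⊗ g w;
  yp_assoc : forall (U V W : yd H) (u : U) (v : V) (w : W),
    (assoc yp_str U V W : yd_hom _ _) ((u ⊗ v) ⊗ w) = tw u ⊗ (v ⊗ twV w);
  yp_lunit : forall (V : yd H) (x : k) (v : V),
    (lunit yp_str V : yd_hom _ _) ((x : k^o) ⊗ v) = x *: tw v;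
  yp_runit : forall (V : yd H) (x : k) (v : V),
    (runit yp_str V : yd_hom _ _) (v ⊗ (x : k^o)) = x *: tw v;
  yp_braid : forall (V W : yd H) (v : V) (w : W),
    (braid yp_str V W : yd_hom _ _) (v ⊗ w) =
    \sw_(w0, w1 <- yc w) (tw w0 ⊗ ya (twV v) w1)
}.

End YDCategory.

(* Main.v *)
Require Import Defs.
From mathcomp Require Import all_boot all_algebra.
From mathcomp Require Import boolp.

(* Twisting by the automorphism turns every Hom-structure into an ordinary
   one: a.b := alpha^-1(ab) and D(c) := Delta(alpha c) make H an ordinary Hopf
   algebra, h.m := mu^-1(hm) and rho o mu (and their right-handed analogues) make
   a Hom-bicovariant bimodule or a Hom-Yetter-Drinfeld module an ordinary one on
   which mu acts semilinearly, and this is reversible.  The Hom-tensor products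
   become the ordinary ones transported along the twist.

   For ordinary Hopf algebras, P_L is idempotent, H-invariant
   (P_L(hm) = eps(h) P_L(m)) and has left coinvariant values, and
   m = m_(-1) P_L(m_(0)).  Hence M is isomorphic to H (x) F(M), where F(M) is the
   image of P_L with action v <| h = P_L(vh) and the restricted right coaction,
   and F is an equivalence with quasi-inverse V |-> H (x) V.  The isomorphism
   F(M) (x) F(N) -> F(M (x)_H N) is v (x) w |-> v (x)_H w, with inverse induced by
   m (x)_H n |-> P_L(m n_(-1)) (x) P_L(n_(0)).  The braiding of bicovariant
   bimodules simplifies to m (x) n |-> m_(-1) n_[0] (x) P_L(m_(0) n_[1]).

   If S is bijective, v <| S^-1(w_(1)) (x) w_(0) inverts the Yetter-Drinfeld
   braiding at w (x) v; the braiding of bicovariant bimodules is then invertible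
   because F preserves the braiding and reflects isomorphisms. *)

Set Implicit Arguments.
Unset Strict Implicit.
Unset Printing Implicit Defensive.

Import GRing.Theory.
Local Open Scope ring_scope.

(** * Multilinear maps and Sweedler notation *)

(** The statement prescribes where each twist sits, so two difficulties have to be separated. All
    Sweedler computations take place in ordinary structures; afterwards each operation and each map
    is only checked to commute with the twist. Untwisting is inverted by equalities of records, and
    the Hom-balanced relations are literally the ordinary ones at other arguments, so both versions
    share one quotient module. The tensor structures, however, do not untwist to the plain ones: the
    prescribed action h(m ⊗ n) = alpha^-1(h)m ⊗ nu(n) contains one more inverse twist, which
    conjugation by the twist of the tensor product supplies. A Sweedler sum runs over a chosen
    decomposition, so a tensor under such a sum may be replaced only when the summand is
    multilinear. This side condition accompanies almost every rewriting step and is decided from the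
    shape of the summand. Antimultiplicativity of S enters only through the identities for its
    inverse. The projection P_L is handled by substituting m = m_(-1) P_L(m_(0)), after which the
    antipode axiom applies to a whole product at once. *)

Section Multilinear.
Variable k : comPzRingType.
Implicit Types U V W M N P A B C : lmodType k.

Definition lin U V (f : U -> V) : Prop := linear f.
Definition trilin A B C P (F : A -> B -> C -> P) : Prop :=
  (forall b c, lin (fun a => F a b c)) /\ (forall a, bilin (F a)).

(** Bundling gives every linear or bilinear map a visible head constant, by which [mlin] recognises
    linearity syntactically. *)
Record lmap U V := Lmap { lfun :> U -> V; lmapP : lin lfun }.
Record bmap M N P := Bmap { bfun :> M -> N -> P; bmapP : bilin bfun }.

Lemma bilinI M N P (f : M -> N -> P) :
  (forall n, lin (fun m => f m n)) -> (forall m, lin (fun n => f m n)) -> bilin f.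
Proof. by split. Qed.
Lemma trilinI A B C P (F : A -> B -> C -> P) :
  (forall b c, lin (fun a => F a b c)) -> (forall a c, lin (fun b => F a b c)) ->
  (forall a b, lin (fun c => F a b c)) -> trilin F.
Proof. by move=> ? ? ?; split=> // a; apply: bilinI. Qed.

Definition TT M N : lmodType k := tens M N.
Definition tn M N : bmap M N (TT M N) := Bmap (ptens_bilin M N).
(* Locked, so that unification does not unfold sums over representatives. *)
Definition sg M N P (t : TT M N) (f : M -> N -> P) : P := locked (sw t f).
Lemma sgE M N P (t : TT M N) (f : M -> N -> P) : sg t f = sw t f.
Proof. by rewrite /sg -lock. Qed.

Lemma lin0 U V (f : U -> V) : lin f -> f 0 = 0.
Proof. by move=> fL; rewrite -(linear0 (mklin fL)). Qed.
Lemma linZ U V (f : U -> V) a x : lin f -> f (a *: x) = a *: f x.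
Proof. by move=> fL; have := fL a x 0; rewrite !addr0 (lin0 fL) addr0. Qed.
Lemma lin_sum U V (f : U -> V) (I : Type) (r : seq I) (F : I -> U) :
  lin f -> f (\sum_(i <- r) F i) = \sum_(i <- r) f (F i).
Proof. by move=> fL; rewrite -[LHS]/(mklin fL _) linear_sum. Qed.

Lemma lin_id U : lin (fun x : U => x). Proof. by []. Qed.
Lemma lin_f U V W (f : V -> W) (g : U -> V) :
  lin f -> lin g -> lin (fun x => f (g x)).
Proof. by move=> fL gL a x y; rewrite gL fL. Qed.
Lemma lin_lm U V W (f : lmap V W) (g : U -> V) : lin g -> lin (fun x => f (g x)).
Proof. exact/lin_f/lmapP. Qed.
Lemma lin_Linear U V W (f : {linear V -> W}) (g : U -> V) :
  lin g -> lin (fun x => f (g x)).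
Proof. by apply: lin_f => a x y; rewrite linearP. Qed.
Lemma lin_bl U M N P (b : bmap M N P) (g : U -> M) n :
  lin g -> lin (fun x => b (g x) n).
Proof. exact/(lin_f ((bmapP b).1 n)). Qed.
Lemma lin_br U M N P (b : bmap M N P) (g : U -> N) m :
  lin g -> lin (fun x => b m (g x)).
Proof. exact/(lin_f ((bmapP b).2 m)). Qed.
Lemma lin_zl U M (g : U -> k^o) (m : M) : lin g -> lin (fun x => g x *: m).
Proof. by apply: (lin_f (f := fun a : k^o => a *: m)) => a x y; rewrite scalerDl scalerA. Qed.
Lemma lin_zr U M (g : U -> M) (a : k) : lin g -> lin (fun x => a *: g x).
Proof. by apply: (lin_f (f := fun x => a *: x)) => b x y; rewrite scalerDr !scalerA mulrC. Qed.
Lemma lin_sgt U M N P (f : M -> N -> P) (g : U -> TT M N) :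
  bilin f -> lin g -> lin (fun x => sg (g x) f).
Proof. by move=> fB; apply: (lin_f (f := fun t => sg t f)) => a x y; rewrite !sgE; apply: sw_linear. Qed.
Lemma lin_sgf U M N P (t : TT M N) (f : U -> M -> N -> P) :
  (forall a b, lin (fun x => f x a b)) -> lin (fun x => sg t (f x)).
Proof.
move=> fL a x y; rewrite !sgE /sw scaler_sumr -big_split.
by apply: eq_bigr => p _; apply: fL.
Qed.

Lemma eq_sg M N P (t : TT M N) (f g : M -> N -> P) :
  (forall a b, f a b = g a b) -> sg t f = sg t g.
Proof. by move=> fg; rewrite !sgE; apply: eq_bigr => p _; apply: fg. Qed.
Lemma sg_tn M N P (f : M -> N -> P) m n : bilin f -> sg (tn M N m n) f = f m n.
Proof. by move=> fB; rewrite sgE; apply: swE. Qed.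
Lemma sg_sg U V M N P (t : TT U V) (f : U -> V -> TT M N) (g : M -> N -> P) :
  bilin g -> sg (sg t f) g = sg t (fun x y => sg (f x y) g).
Proof.
move=> gB; rewrite !sgE sw_sum //; apply: eq_bigr => p _; exact/esym/sgE.
Qed.
Lemma sg_lin M N P U (t : TT M N) (f : M -> N -> P) (L : P -> U) :
  lin L -> L (sg t f) = sg t (fun x y => L (f x y)).
Proof. by move=> LL; rewrite !sgE /sw lin_sum. Qed.
Lemma sg_C U V M N P (t : TT U V) (s : TT M N) (f : U -> V -> M -> N -> P) :
  sg t (fun x y => sg s (f x y)) = sg s (fun a b => sg t (fun x y => f x y a b)).
Proof.
rewrite !sgE /sw; under eq_bigr do rewrite sgE /sw; rewrite exchange_big.
by apply: eq_bigr => p _; rewrite sgE.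
Qed.
Lemma sg_id M N (t : TT M N) : sg t (tn M N) = t.
Proof. by rewrite sgE {2}(tens_sw t). Qed.
Lemma sg_Z M N P (t : TT M N) (f : M -> N -> P) (a : k) :
  sg t (fun x y => a *: f x y) = a *: sg t f.
Proof. by rewrite (sg_lin t f (L := fun x => a *: x)) //; apply/lin_zr/lin_id. Qed.
Lemma TT_ext M N P (f g : TT M N -> P) : lin f -> lin g ->
  (forall m n, f (tn M N m n) = g (tn M N m n)) -> forall t, f t = g t.
Proof.
move=> fL gL fg; exact: (@tens_ext _ _ _ _ (mklin fL) (mklin gL) fg).
Qed.
End Multilinear.

Arguments tn {k M N}.
Notation "x ⊠ y" := (bfun tn x y) (at level 40, left associativity).
Notation "'do' ( x , y <- t ) E" := (sg t (fun x y => E))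
  (at level 60, x name, y name, t at level 59, E at level 60, right associativity).

(* Redefined below, once the lift to balanced tensor products is available. *)
Ltac lin_hook := fail.
Ltac lin_step :=
  lazymatch goal with
  | |- lin (fun x => x) => exact: lin_id
  | |- lin (lfun ?f) => exact: lmapP
  | |- lin (bfun ?b ?m) => exact: ((bmapP b).2 m)
  | H : lin ?f |- lin ?f => exact H
  | H : bilin ?f |- lin (?f ?a) => exact: (H.2 a)
  | H : trilin ?f |- lin (?f ?a ?b) => exact: ((H.2 a).2 b)
  | |- lin (fun x => sg _ _) => first [apply: lin_sgt | apply: lin_sgf; intros; cbv beta]
  | |- lin (fun x => lfun _ _) => apply: lin_lm
  | |- lin (fun x => bfun _ _ _) => first [apply: lin_br | apply: lin_bl]
  | |- lin (fun x => @GRing.scale _ _ _ _) => first [apply: lin_zr | apply: lin_zl]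
  | H : lin ?f |- lin (fun x => ?f _) => apply: (lin_f H)
  | H : bilin ?f |- lin (fun x => ?f _ _) =>
      first [apply: (lin_f (H.2 _)) | apply: (lin_f (H.1 _))]
  | H : trilin ?f |- lin (fun x => ?f _ _ _) =>
      first [apply: (lin_f ((H.2 _).2 _)) | apply: (lin_f ((H.2 _).1 _)) | apply: (lin_f (H.1 _ _))]
  | |- _ => lin_hook
  end.
Ltac mlin_step :=
  lazymatch goal with
  | |- trilin _ => apply: trilinI; intros; cbv beta
  | H : bilin ?f |- bilin ?f => exact H
  | |- bilin (bfun ?b) => exact: (bmapP b)
  | H : trilin ?f |- bilin (?f _) => exact: (H.2 _)
  | |- bilin _ => apply: bilinI; intros; cbv beta
  | |- lin _ => lin_step
  end.
Ltac mlin := solve [repeat mlin_step].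

Section Push.
Variable k : comPzRingType.
Implicit Types U V W M N P Q A B C : lmodType k.

Lemma lm_sg M N P U (L : lmap P U) (t : TT M N) f :
  L (sg t f) = sg t (fun x y => L (f x y)).
Proof. by apply: sg_lin; mlin. Qed.
Lemma bl_sg M N P Q U (b : bmap P Q U) (t : TT M N) f q :
  b (sg t f) q = sg t (fun x y => b (f x y) q).
Proof. by apply: (sg_lin _ _ (L := fun z => b z q)); mlin. Qed.
Lemma br_sg M N P Q U (b : bmap P Q U) (t : TT M N) f q :
  b q (sg t f) = sg t (fun x y => b q (f x y)).
Proof. by apply: (sg_lin _ _ (L := fun z => b q z)); mlin. Qed.
Lemma sg_tZ M N P (t : TT M N) (f : M -> N -> P) (a : k) : bilin f ->
  sg (a *: t) f = a *: sg t f.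
Proof. by move=> fB; apply: (linZ (f := fun t => sg t f)); mlin. Qed.
Lemma lmZ P U (L : lmap P U) a x : L (a *: x) = a *: L x.
Proof. by apply: linZ; mlin. Qed.
Lemma bZl P Q U (b : bmap P Q U) a x y : b (a *: x) y = a *: b x y.
Proof. by apply: (linZ (f := fun z => b z y)); mlin. Qed.
Lemma bZr P Q U (b : bmap P Q U) a x y : b x (a *: y) = a *: b x y.
Proof. by apply: (linZ (f := fun z => b x z)); mlin. Qed.

Lemma pullE M N Q P (u : M -> N -> Q) (t : TT M N) (f : M -> N -> P) (G : Q -> P) :
  (forall a b, f a b = G (u a b)) -> lin G -> sg t f = G (sg t u).
Proof. by move=> fG GL; rewrite sg_lin //; apply: eq_sg. Qed.
End Push.

Lemma congrZ (k : comPzRingType) (U : lmodType k) (a : k) (x y : U) : x = y -> a *: x = a *: y.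
Proof. by move->. Qed.

(* The rewriting tactics act on the left-hand side of an equation between
   iterated Sweedler sums [do (x, y <- t) E], under the binders:
   [inn tac] runs [tac] at the outermost position where it succeeds and proves
   the (multi)linearity side conditions, [inat n: tac] runs it under [n] binders,
   and [nrm] pushes all maps inside and flattens nested sums. *)
Ltac into tac :=
  eapply etrans;
  [ lazymatch goal with
    | |- sg _ _ = _ => eapply eq_sg; intros ? ?
    | |- @GRing.scale _ _ _ _ = _ => eapply congrZ
    end; cbv beta; tac; reflexivity
  | cbv beta ].
Ltac down n tac :=
  idtac; lazymatch n with O => tac | S ?m => into ltac:(down m tac) end.
Ltac insd tac := idtac; first [ tac | into ltac:(insd tac) ].
Ltac lhs tac := eapply etrans; [tac; reflexivity | cbv beta].
Tactic Notation "inn" tactic3(t) := lhs ltac:(insd ltac:(t; [ | mlin ..])).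
Tactic Notation "inat" constr(n) ":" tactic3(t) := lhs ltac:(down n ltac:(t; [ | mlin ..])).
Ltac zout1 :=
  lazymatch goal with |- sg _ (fun x y => @GRing.scale _ _ _ _) = _ => rewrite sg_Z end.
Ltac nrm1 := first
  [ rewrite lm_sg | rewrite bl_sg | rewrite br_sg | zout1
  | rewrite sg_tn; [ | mlin] | rewrite sg_sg; [ | mlin] | rewrite sg_tZ; [ | mlin]
  | rewrite lmZ | rewrite bZl | rewrite bZr ].
Ltac nrm := repeat (lhs ltac:(insd nrm1)).
(* Applies the summation of [G] to both sides of the tensor identity [E]. *)
Ltac via E G :=
  let e := fresh in
  have e := congr1 (fun t => sg t G) E; cbv beta in e;
  eapply etrans; [ eapply etrans; [ | exact e]; symmetry | ]; unfold G; nrm.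
(* Rewrites [do (a, b <- t) G (u a b)] as [G (do (a, b <- t) u a b)]. *)
Ltac pull u :=
  eapply etrans;
  [ eapply (pullE (u := u));
    [ let a := fresh in let b := fresh in intros a b; cbv beta;
      let v := eval cbv beta in (u a b) in
      lazymatch goal with |- ?E = ?R =>
        let E' := eval pattern v in E in
        lazymatch E' with ?G _ => lazymatch R with ?G0 _ => unify G0 G end end
      end; reflexivity
    | cbv beta; mlin ]
  | cbv beta ].
(* Solves [E = F s t] for the second-order unknown [F]. *)
Ltac gpat :=
  intros; cbv beta;
  lazymatch goal with
  | |- ?L = ?F ?s ?t => is_evar F;
      let L' := eval pattern s, t in L in
      lazymatch L' with ?G _ _ => unify F G end
  | |- ?L = ?F ?t => is_evar F;
      let L' := eval pattern t in L in
      lazymatch L' with ?G _ => unify F G end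
  end; reflexivity.
Tactic Notation "rul" open_constr(L) :=
  lhs ltac:(insd ltac:(eapply etrans; [eapply L; [gpat | cbv beta; mlin ..] | cbv beta])).
Tactic Notation "nrm" "with" tactic3(t) :=
  repeat (lhs ltac:(insd ltac:(first [nrm1 | t; [ | mlin ..]]))).
Ltac ext t := move: t; apply: TT_ext; [mlin | mlin | intros; cbv beta].
(* [fin] closes an equation between two nests of sums that differ only by the
   order of independent summations. *)
Ltac bub t :=
  idtac; lazymatch goal with |- sg ?s _ = _ =>
    tryif constr_eq s t then idtac else (into ltac:(bub t); rewrite sg_C) end.
Ltac fin :=
  cbv beta; lazymatch goal with
  | |- _ = sg ?t _ =>
      first [lhs ltac:(bub t); eapply eq_sg; intros ? ?; fin | reflexivity]
  | |- @GRing.scale _ _ ?a _ = @GRing.scale _ _ ?a _ => eapply congrZ; fin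
  | |- _ => try reflexivity
  end.
Tactic Notation "ctr" constr(u) := lhs ltac:(insd ltac:(pull u)).
Tactic Notation "swp" constr(n) := lhs ltac:(down n ltac:(rewrite sg_C)).

(** * Hopf algebras and bicovariant bimodules *)

Record hopf_on (k : comPzRingType) (A : lmodType k) := HopfOn {
  mul : bmap A A A;
  one : A;
  cop : lmap A (TT A A);
  cou : lmap A k^o;
  ant : lmap A A;
  mulA : forall a b c, mul a (mul b c) = mul (mul a b) c;
  mulr1' : forall a, mul a one = a;
  mul1r' : forall a, mul one a = a;
  copA : forall c, (do (a, b <- cop c) a ⊠ cop b) =
    do (a, b <- cop c) do (x, y <- cop a) x ⊠ (y ⊠ b);
  cou_r : forall c, (do (a, b <- cop c) cou b *: a) = c;
  cou_l : forall c, (do (a, b <- cop c) cou a *: b) = c;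
  copM : forall a b, cop (mul a b) =
    do (a1, a2 <- cop a) do (b1, b2 <- cop b) mul a1 b1 ⊠ mul a2 b2;
  cop1 : cop one = one ⊠ one;
  couM : forall a b, cou (mul a b) = cou a * cou b;
  cou1 : cou one = 1;
  antl : forall h, (do (a, b <- cop h) mul (ant a) b) = cou h *: one;
  antr : forall h, (do (a, b <- cop h) mul a (ant b)) = cou h *: one
}.

Section Hopf.
Variables (k : comPzRingType) (A : lmodType k) (H : hopf_on A).
Local Notation "x ∙ y" := (mul H x y) (at level 40, left associativity).
Local Notation Δ := (cop H).
Local Notation ε := (cou H).
Local Notation S := (ant H).

(** Contracting [copA] with an arbitrary trilinear [F] turns coassociativity into a rewriting rule
    usable inside a sum, where [F] is read off from the summand. The coactions get rules of the same
    kind below. *)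
Lemma coassoc (X : lmodType k) (F : A -> A -> A -> X) c : trilin F ->
  (do (a, b <- Δ c) do (x, y <- Δ a) F x y b) =
  do (a, b <- Δ c) do (x, y <- Δ b) F a x y.
Proof.
move=> FT.
pose G := fun (x : A) (t : TT A A) => do (y, z <- t) F x y z.
have GB : bilin G.
  rewrite /G. mlin.
via (esym (copA H c)) G; reflexivity.
Qed.
Lemma counitl (X : lmodType k) (F : A -> X) c : lin F ->
  (do (a, b <- Δ c) ε a *: F b) = F c.
Proof. by move=> FL; rewrite -{2}(cou_l H c) (sg_lin _ _ FL); apply: eq_sg => a b; rewrite (linZ _ _ FL). Qed.
Lemma counitr (X : lmodType k) (F : A -> X) c : lin F ->
  (do (a, b <- Δ c) ε b *: F a) = F c.
Proof. by move=> FL; rewrite -{2}(cou_r H c) (sg_lin _ _ FL); apply: eq_sg => a b; rewrite (linZ _ _ FL). Qed.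

(* Both sides are convolution inverses of the product; the intermediate term is
   S(g_1 h_1) (g_2 h_2) (S(h_3) S(g_3)). *)
Lemma antM g h : S (g ∙ h) = S h ∙ S g.
Proof.
transitivity (do (a, b <- Δ g) do (x, y <- Δ a) do (c, d <- Δ h) do (u, v <- Δ c)
   S (x ∙ u) ∙ (y ∙ v) ∙ (S d ∙ S b)).
  symmetry.
  inn rewrite coassoc.
  inat 2%N: rewrite coassoc.
  swp 1%N.
  inn rewrite -mulA.
  inn rewrite -(mulA H _ _ (mul H _ _)).
  inn rewrite (mulA H _ (S _) (S _)).
  ctr (fun a b => a ∙ S b).
  inn rewrite antr. nrm.
  inn rewrite counitr.
  inn rewrite mul1r'.
  ctr (fun a b => a ∙ S b).
  inn rewrite antr. nrm.
  inn rewrite counitr.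
  inn rewrite mulr1'. reflexivity.
transitivity (do (a, b <- Δ g) do (c, d <- Δ h) do (x, y <- Δ (a ∙ c)) S x ∙ y ∙ (S d ∙ S b)).
  symmetry; inn rewrite copM; nrm. inat 1%N: rewrite sg_C. reflexivity.
ctr (fun x y => S x ∙ y); inn rewrite antl; nrm; inn rewrite mul1r'.
inn rewrite couM; inn rewrite -scalerA.
nrm.
inn rewrite counitl.
inn rewrite counitl.
reflexivity.
Qed.

Lemma ant1 : S (one H) = one H.
Proof.
have := antl H (one H); rewrite cop1 cou1 scale1r sg_tn; last by mlin.
by rewrite mulr1'.
Qed.
End Hopf.

(** Ordinary bicovariant bimodules. Multiplicativity of the coactions is required for each action
    separately; the two-sided Hom-axioms yield this by inserting a unit (see [clL]). *)
Record bcv_on (k : comPzRingType) (A : lmodType k) (H : hopf_on A) (M : lmodType k) := BcvOn {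
  bL : bmap A M M;
  bR : bmap M A M;
  bl : lmap M (TT A M);
  br : lmap M (TT M A);
  bLA : forall g h m, bL g (bL h m) = bL (mul H g h) m;
  bL1 : forall m, bL (one H) m = m;
  bRA : forall m g h, bR (bR m g) h = bR m (mul H g h);
  bR1 : forall m, bR m (one H) = m;
  bLR : forall g m h, bR (bL g m) h = bL g (bR m h);
  blA : forall m, (do (h, x <- bl m) cop H h ⊠ x) =
    do (h, x <- bl m) do (g, y <- bl x) (h ⊠ g) ⊠ y;
  bl1 : forall m, (do (h, x <- bl m) cou H h *: x) = m;
  brA : forall m, (do (x, h <- br m) x ⊠ cop H h) =
    do (x, h <- br m) do (y, g <- br x) y ⊠ (g ⊠ h);
  br1 : forall m, (do (x, h <- br m) cou H h *: x) = m;
  blL : forall h m, bl (bL h m) =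
    do (a, b <- cop H h) do (c, x <- bl m) mul H a c ⊠ bL b x;
  blR : forall m h, bl (bR m h) =
    do (c, x <- bl m) do (a, b <- cop H h) mul H c a ⊠ bR x b;
  brL : forall h m, br (bL h m) =
    do (a, b <- cop H h) do (x, c <- br m) bL a x ⊠ mul H b c;
  brR : forall m h, br (bR m h) =
    do (x, c <- br m) do (a, b <- cop H h) bR x a ⊠ mul H c b;
  bic : forall m, (do (h, x <- bl m) h ⊠ br x) =
    do (x, h <- br m) do (g, y <- bl x) g ⊠ (y ⊠ h)
}.

Section Bcv.
Variables (k : comPzRingType) (A : lmodType k) (H : hopf_on A).
Local Notation "x ∙ y" := (mul H x y) (at level 40, left associativity).
Local Notation Δ := (cop H).
Local Notation ε := (cou H).
Local Notation S := (ant H).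
Variables (M : lmodType k) (B : bcv_on H M).
Local Notation "h ▹ m" := (bL B h m) (at level 38, right associativity).

Section F.
Variables (X : lmodType k).
Lemma bl_coassoc (F : A -> A -> M -> X) m : trilin F ->
  (do (h, x <- bl B m) do (a, b <- Δ h) F a b x) =
  do (h, x <- bl B m) do (g, y <- bl B x) F h g y.
Proof.
move=> FT.
pose G := fun (t : TT A A) (x : M) => do (a, b <- t) F a b x.
have GB : bilin G by rewrite /G; mlin.
by via (blA B m) G; reflexivity.
Qed.
Lemma br_coassoc (F : M -> A -> A -> X) m : trilin F ->
  (do (x, h <- br B m) do (a, b <- Δ h) F x a b) =
  do (x, h <- br B m) do (y, g <- br B x) F y g h.
Proof.
move=> FT.
pose G := fun (x : M) (t : TT A A) => do (a, b <- t) F x a b.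
have GB : bilin G by rewrite /G; mlin.
by via (brA B m) G; reflexivity.
Qed.
Lemma bicomod (F : A -> M -> A -> X) m : trilin F ->
  (do (h, x <- bl B m) do (y, g <- br B x) F h y g) =
  do (x, g <- br B m) do (h, y <- bl B x) F h y g.
Proof.
move=> FT.
pose G := fun (h : A) (t : TT M A) => do (x, g <- t) F h x g.
have GB : bilin G by rewrite /G; mlin.
by via (bic B m) G; reflexivity.
Qed.
Lemma bl_counit (F : M -> X) m : lin F -> (do (h, x <- bl B m) ε h *: F x) = F m.
Proof. by move=> FL; rewrite -{2}(bl1 B m) (sg_lin _ _ FL); apply: eq_sg => a b; rewrite (linZ _ _ FL). Qed.
Lemma br_counit (F : M -> X) m : lin F -> (do (x, h <- br B m) ε h *: F x) = F m.
Proof. by move=> FL; rewrite -{2}(br1 B m) (sg_lin _ _ FL); apply: eq_sg => a b; rewrite (linZ _ _ FL). Qed.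
End F.

Definition pl_fun m := do (h, x <- bl B m) S h ▹ x.
Lemma pl_lin : lin pl_fun. Proof. by rewrite /pl_fun; mlin. Qed.
Definition pl := locked (Lmap pl_lin).
Lemma plE m : pl m = do (h, x <- bl B m) S h ▹ x.
Proof. by rewrite /pl -lock. Qed.

(** Coassociativity creates the factor m_(-2) S(m_(-1)), which the antipode axiom collapses to a
    counit. *)
Lemma recon m : (do (h, x <- bl B m) h ▹ pl x) = m.
Proof.
inn rewrite plE; nrm.
inn rewrite -bl_coassoc.
inn rewrite bLA.
ctr (fun a b => a ∙ S b); inn rewrite antr; nrm; inn rewrite bL1.
inn rewrite bl_counit.
reflexivity.
Qed.
End Bcv.

Section Projection.
Variables (k : comPzRingType) (A : lmodType k) (H : hopf_on A).
Local Notation "x ∙ y" := (mul H x y) (at level 40, left associativity).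
Local Notation Δ := (cop H).
Local Notation ε := (cou H).
Local Notation S := (ant H).
Variables (M : lmodType k) (B : bcv_on H M).
Local Notation "h ▹ m" := (bL B h m) (at level 38, right associativity).
Local Notation "m ◃ h" := (bR B m h) (at level 39, left associativity).
Local Notation pl := (pl B).

(** Substituting m = m_(-1) P_L(m_(0)) turns P_L(hm) into S(u) v P_L(m_(0)) with u ⊗ v the coproduct
    of the product h m_(-1). The antipode axiom applies to that product as a whole. *)
Lemma pl_L h m : pl (h ▹ m) = ε h *: pl m.
Proof.
transitivity (do (g, x <- bl B m) do (u, v <- Δ (h ∙ g)) S u ▹ v ▹ pl x).
  symmetry; inn rewrite copM; nrm; inn rewrite -bLA; swp 1%N.
  inn rewrite bl_coassoc. swp 1%N.
  ctr (fun h x => h ▹ pl x).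
  inn rewrite recon. symmetry.
  rewrite plE blL. nrm. swp 0%N. reflexivity.
inn rewrite bLA. ctr (fun a b => S a ∙ b). inn rewrite antl.
nrm. inn rewrite couM. inn rewrite -scalerA. nrm. inn rewrite bL1.
inn rewrite bl_counit. reflexivity.
Qed.

(** Apply P_L to m = m_(-1) P_L(m_(0)): invariance replaces m_(-1) by its counit. *)
Lemma pl_pl m : pl (pl m) = pl m.
Proof.
rewrite -{2}(recon B m). symmetry. nrm. inn rewrite pl_L.
inn rewrite (bl_counit B (F := fun x => pl (pl x))).
reflexivity.
Qed.

(** The diagonal action of A on A ⊗ M, for which the left coaction is linear ([blL']). *)
Definition dact_fun (u : A) (t : TT A M) : TT A M :=
  do (a, b <- Δ u) do (c, x <- t) (a ∙ c) ⊠ (b ▹ x).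
Lemma dact_bilin : bilin dact_fun. Proof. by rewrite /dact_fun; mlin. Qed.
Definition dact := locked (Bmap dact_bilin).

Lemma dactE u c x : dact u (c ⊠ x) = do (a, b <- Δ u) (a ∙ c) ⊠ (b ▹ x).
Proof. by rewrite /dact -lock /= /dact_fun; inn rewrite sg_tn. Qed.
Lemma blL' h m : bl B (h ▹ m) = dact h (bl B m).
Proof. by rewrite blL /dact -lock. Qed.
Lemma dactM u v c x : dact u (dact v (c ⊠ x)) = dact (u ∙ v) (c ⊠ x).
Proof.
rewrite !dactE. nrm. inn rewrite dactE. symmetry. rewrite copM. nrm. swp 0%N.
inn rewrite -mulA. inn rewrite -bLA. reflexivity.
Qed.

(* rho(P_L m) = D(S m_(-2)) D(m_(-1)) (1 (x) P_L m_(0)), which avoids the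
   anticomultiplicativity of S. *)
Lemma pl_coinv m : bl B (pl m) = one H ⊠ pl m.
Proof.
rewrite [in LHS]plE. nrm. inn rewrite blL'.
transitivity (do (h, x <- bl B m) dact (S h) (do (c, z <- bl B x) dact c (one H ⊠ pl z))).
  apply: eq_sg => h x. congr (dact _ _). symmetry.
  inn rewrite dactE. nrm. inn rewrite bl_coassoc.
  inn rewrite mulr1'. ctr (fun h x => h ▹ pl x). inn rewrite recon. exact: sg_id.
nrm. inn rewrite dactM.
inn rewrite -(bl_coassoc B (F:= fun a b x => dact (S a ∙ b) (one H ⊠ pl x))).
ctr (fun a b => S a ∙ b). inn rewrite antl.
nrm. inn rewrite bl_counit.
rewrite dactE cop1. nrm. by rewrite mul1r' bL1.
Qed.

(** The right action commutes with the factor m_(-1) of the reconstruction, and P_L reduces that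
    factor to its counit. This is what makes v ◁ h = P_L(vh) associative. *)
Lemma pl_R m h : pl (pl m ◃ h) = pl (m ◃ h).
Proof.
rewrite -{2}(recon B m). symmetry. nrm. inn rewrite bLR. inn rewrite pl_L.
inn rewrite (bl_counit B (F := fun x => pl (pl x ◃ h))).
reflexivity.
Qed.

(** In sigma(hm) = h_1 m_[0] ⊗ h_2 m_[1] the projection turns h_1 into a counit, so [h] survives
    only on the comodule leg. *)
Lemma br_pl_L (X : lmodType k) (F : M -> A -> X) h m : bilin F ->
  (do (x, g <- br B (h ▹ m)) F (pl x) g) = do (x, g <- br B m) F (pl x) (h ∙ g).
Proof.
move=> FB. rewrite brL. nrm. inn rewrite pl_L.
inn rewrite (linZ (f := fun x => F x _)). inn rewrite sg_C.
inn rewrite counitl. reflexivity.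
Qed.

(** The right coaction preserves left coinvariants: applying the left coaction to the first leg of
    sigma(P_L m) gives a trivial A-leg, because the two coactions commute. *)
Lemma br_pl_coinv (X : lmodType k) (F : M -> A -> X) m : bilin F ->
  (do (x, g <- br B (pl m)) F (pl x) g) = do (x, g <- br B (pl m)) F x g.
Proof.
move=> FB.
(* Contracting the left A-leg with the antipode produces P_L on one side of the bicomodule identity
   and S(1) = 1 on the other. *)
pose G := fun h x g => F (S h ▹ x) g.
have GT : trilin G by rewrite /G; mlin.
have := bicomod B (pl m) GT; rewrite /G pl_coinv sg_tn; last by mlin.
rewrite ant1 => E; symmetry.
transitivity (do (x, g <- br B (pl m)) F (one H ▹ x) g).
  by symmetry; inn rewrite bL1.
rewrite E; apply: eq_sg => x g.
by rewrite plE (sg_lin _ _ (L := fun z => F z g)) //; apply: FB.1.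
Qed.

(** The straightening rule v h = h_1 (v ◁ h_2) for coinvariant v: since rho(v) = 1 ⊗ v, the left
    coaction of v h is h_1 ⊗ v h_2, and reconstruction applies. *)
Lemma coinv_R m h : pl m ◃ h = do (a, b <- Δ h) a ▹ pl (pl m ◃ b).
Proof.
rewrite -[LHS](recon B) blR pl_coinv. nrm. inn rewrite mul1r'. reflexivity.
Qed.

(** On coinvariants the action v ◁ h is the adjoint action S(h_1) v h_2. *)
Lemma pl_adj m h : (do (a, b <- Δ h) S a ▹ (pl m ◃ b)) = pl (pl m ◃ h).
Proof.
by rewrite [RHS]plE blR pl_coinv; symmetry; nrm; inn rewrite mul1r'; reflexivity.
Qed.

(** Substitute the reconstruction of m into sigma(m): [br_pl_L] moves m_(-1) to the comodule leg,
    and on the coinvariant factor the outer projection disappears by [br_pl_coinv]. *)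
Lemma br_pl_recon (X : lmodType k) (F : M -> A -> X) m : bilin F ->
  (do (h, y <- bl B m) do (x, g <- br B (pl y)) F x (h ∙ g)) =
  do (x, g <- br B m) F (pl x) g.
Proof.
move=> FB. rewrite -{2}(recon B m). symmetry. nrm.
inn rewrite br_pl_L. apply: eq_sg => h y.
rewrite (br_pl_coinv (F := fun x g => F x (h ∙ g))) //; mlin.
Qed.
End Projection.

(** * Yetter-Drinfeld modules *)

Record ydm_on (k : comPzRingType) (A : lmodType k) (H : hopf_on A) (V : lmodType k) := YdmOn {
  ya : bmap V A V;
  yc : lmap V (TT V A);
  yaA : forall v g h, ya (ya v g) h = ya v (mul H g h);
  ya1 : forall v, ya v (one H) = v;
  ycA : forall v, (do (x, h <- yc v) x ⊠ cop H h) =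
    do (x, h <- yc v) do (y, g <- yc x) y ⊠ (g ⊠ h);
  yc1 : forall v, (do (x, h <- yc v) cou H h *: x) = v;
  ycomp : forall v h, (do (a, b <- cop H h) do (x, g <- yc (ya v b)) x ⊠ mul H a g) =
    do (x, g <- yc v) do (a, b <- cop H h) ya x a ⊠ mul H g b
}.

Section YdTheory.
Variables (k : comPzRingType) (A : lmodType k) (H : hopf_on A).
Local Notation "x ∙ y" := (mul H x y) (at level 40, left associativity).
Local Notation Δ := (cop H).
Local Notation ε := (cou H).
Variables (V : lmodType k) (Y : ydm_on H V).
Local Notation "v ◁ h" := (ya Y v h) (at level 39, left associativity).

Variable X : lmodType k.
Lemma yc_coassoc (F : V -> A -> A -> X) m : trilin F ->
  (do (x, h <- yc Y m) do (a, b <- Δ h) F x a b) =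
  do (x, h <- yc Y m) do (y, g <- yc Y x) F y g h.
Proof.
move=> FT.
pose G := fun (x : V) (t : TT A A) => do (a, b <- t) F x a b.
have GB : bilin G by rewrite /G; mlin.
by via (ycA Y m) G; reflexivity.
Qed.
Lemma yc_counit (F : V -> X) m : lin F -> (do (x, h <- yc Y m) ε h *: F x) = F m.
Proof. by move=> FL; rewrite -{2}(yc1 Y m) (sg_lin _ _ FL); apply: eq_sg => a b; rewrite (linZ _ _ FL). Qed.

(** The Yetter-Drinfeld condition as a rule under binders: [E] is the summand as it stands, and the
    first hypothesis asks that it involve [a] and [g] only through the product a ∙ g, the quantity
    that the condition controls. *)
Lemma yd_ya (E : A -> A -> V -> A -> X) (F : V -> A -> X) v h :
  (forall a b x g, E a b x g = F x (a ∙ g)) -> bilin F ->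
  (do (a, b <- Δ h) do (x, g <- yc Y (v ◁ b)) E a b x g) =
  do (x, g <- yc Y v) do (a, b <- Δ h) F (x ◁ a) (g ∙ b).
Proof.
move=> EF FB.
pose G := F; have GB : bilin G by [].
via (ycomp Y v h) G; last reflexivity.
by apply: eq_sg => a b; apply: eq_sg => x g; rewrite EF.
Qed.
End YdTheory.

(** * The free bicovariant bimodule H ⊗ V on a Yetter-Drinfeld module *)

Section FreeBcv.
Variables (k : comPzRingType) (A : lmodType k) (H : hopf_on A).
Local Notation "x ∙ y" := (mul H x y) (at level 40, left associativity).
Local Notation Δ := (cop H).
Local Notation ε := (cou H).
Variables (V : lmodType k) (Y : ydm_on H V).
Local Notation "v ◁ h" := (ya Y v h) (at level 39, left associativity).

Definition fL_fun (g : A) (t : TT A V) : TT A V := do (h, v <- t) (g ∙ h) ⊠ v.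
Lemma fL_bilin : bilin fL_fun. Proof. by rewrite /fL_fun; mlin. Qed.
Definition fL := locked (Bmap fL_bilin).
Lemma fLE g h v : fL g (h ⊠ v) = (g ∙ h) ⊠ v.
Proof. by rewrite /fL -lock /= /fL_fun; nrm. Qed.

(** The straightening rule v g = g_1 (v ◁ g_2) of [coinv_R], read as a definition. *)
Definition fR_fun (t : TT A V) (g : A) : TT A V :=
  do (h, v <- t) do (a, b <- Δ g) (h ∙ a) ⊠ (v ◁ b).
Lemma fR_bilin : bilin fR_fun. Proof. by rewrite /fR_fun; mlin. Qed.
Definition fR := locked (Bmap fR_bilin).
Lemma fRE h v g : fR (h ⊠ v) g = do (a, b <- Δ g) (h ∙ a) ⊠ (v ◁ b).
Proof. by rewrite /fR -lock /= /fR_fun; nrm. Qed.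

Definition fl_fun (t : TT A V) : TT A (TT A V) :=
  do (h, v <- t) do (a, b <- Δ h) a ⊠ (b ⊠ v).
Lemma fl_lin : lin fl_fun. Proof. by rewrite /fl_fun; mlin. Qed.
Definition fl := locked (Lmap fl_lin).
Lemma flE h v : fl (h ⊠ v) = do (a, b <- Δ h) a ⊠ (b ⊠ v).
Proof. by rewrite /fl -lock /= /fl_fun; nrm. Qed.

Definition fr_fun (t : TT A V) : TT (TT A V) A :=
  do (h, v <- t) do (a, b <- Δ h) do (x, g <- yc Y v) (a ⊠ x) ⊠ (b ∙ g).
Lemma fr_lin : lin fr_fun. Proof. by rewrite /fr_fun; mlin. Qed.
Definition fr := locked (Lmap fr_lin).
Lemma frE h v : fr (h ⊠ v) = do (a, b <- Δ h) do (x, g <- yc Y v) (a ⊠ x) ⊠ (b ∙ g).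
Proof. by rewrite /fr -lock /= /fr_fun; nrm. Qed.

Ltac fE := first [rewrite fLE | rewrite fRE | rewrite flE | rewrite frE].

Lemma free_fLA g h m : fL g (fL h m) = fL (g ∙ h) m.
Proof. by ext m; rewrite !fLE mulA. Qed.
Lemma free_fL1 m : fL (one H) m = m.
Proof. by ext m; rewrite !fLE mul1r'. Qed.
Lemma free_fRA m g h : fR (fR m g) h = fR m (g ∙ h).
Proof.
ext m. nrm with fE. symmetry. nrm with fE. rewrite copM; nrm.
inn rewrite mulA. inn rewrite -yaA. reflexivity.
Qed.
Lemma free_fR1 m : fR m (one H) = m.
Proof. ext m. nrm with fE. rewrite cop1; nrm. by rewrite mulr1' ya1. Qed.
Lemma free_fLR g m h : fR (fL g m) h = fL g (fR m h).
Proof. ext m. nrm with fE. symmetry. nrm with fE. inn rewrite mulA. reflexivity. Qed.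
Lemma free_flA m : (do (h, x <- fl m) Δ h ⊠ x) =
    do (h, x <- fl m) do (g, y <- fl x) (h ⊠ g) ⊠ y.
Proof.
ext m. rewrite flE. nrm. symmetry. nrm with fE. inn rewrite -coassoc.
ctr (fun x y : A => x ⊠ y). inn rewrite sg_id. reflexivity.
Qed.
Lemma free_fl1 m : (do (h, x <- fl m) ε h *: x) = m.
Proof. ext m. nrm with fE. inn rewrite counitl. reflexivity. Qed.
Lemma free_frA m : (do (x, h <- fr m) x ⊠ Δ h) =
    do (x, h <- fr m) do (y, g <- fr x) y ⊠ (g ⊠ h).
Proof.
ext m. nrm with fE. inn rewrite copM. nrm.
symmetry. nrm with fE.
inat 1%N: rewrite sg_C. inn rewrite coassoc.
inn rewrite -yc_coassoc. swp 1%N. reflexivity.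
Qed.
Lemma free_fr1 m : (do (x, h <- fr m) ε h *: x) = m.
Proof.
ext m. nrm with fE. inn rewrite couM. inn rewrite -scalerA. nrm.
inn rewrite counitr. inn rewrite yc_counit. reflexivity.
Qed.
Lemma free_flL h m : fl (fL h m) = do (a, b <- Δ h) do (c, x <- fl m) (a ∙ c) ⊠ fL b x.
Proof. ext m. rewrite fLE flE copM; nrm. symmetry. nrm with fE. reflexivity. Qed.
Lemma free_flR m h : fl (fR m h) = do (c, x <- fl m) do (a, b <- Δ h) (c ∙ a) ⊠ fR x b.
Proof.
ext m. rewrite fRE. nrm with fE. inn rewrite copM; nrm. symmetry. nrm with fE.
inn rewrite -coassoc. fin.
Qed.
Lemma free_frL h m : fr (fL h m) = do (a, b <- Δ h) do (x, c <- fr m) fL a x ⊠ (b ∙ c).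
Proof.
ext m. rewrite fLE frE copM; nrm. symmetry. nrm with fE. inn rewrite mulA. reflexivity.
Qed.
(** The axiom of H ⊗ V that expresses the Yetter-Drinfeld condition: coassociativity brings g_2 next
    to the coaction leg of v ◁ g_3, and [yd_ya] exchanges the action and the coaction. *)
Lemma free_frR m h : fr (fR m h) = do (x, c <- fr m) do (a, b <- Δ h) fR x a ⊠ (c ∙ b).
Proof.
ext m. rewrite fRE. nrm with fE. inn rewrite copM; nrm. swp 1%N. inn rewrite coassoc.
inat 1%N: rewrite sg_C. inn rewrite -mulA. rul yd_ya.
symmetry. nrm with fE. inn rewrite coassoc. inn rewrite -mulA. fin.
Qed.
Lemma free_bic m : (do (h, x <- fl m) h ⊠ fr x) =
    do (x, h <- fr m) do (g, y <- fl x) g ⊠ (y ⊠ h).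
Proof.
ext m. nrm with fE. symmetry. nrm with fE. inat 1%N: rewrite sg_C. inn rewrite coassoc.
reflexivity.
Qed.

Definition free_bcv : bcv_on H (TT A V) :=
  BcvOn free_fLA free_fL1 free_fRA free_fR1 free_fLR free_flA free_fl1 free_frA free_fr1
    free_flL free_flR free_frL free_frR free_bic.
End FreeBcv.

(** * Left coinvariants as a Yetter-Drinfeld module *)

Section Coinvariants.
Variables (k : comPzRingType) (A : lmodType k) (H : hopf_on A).
Local Notation "x ∙ y" := (mul H x y) (at level 40, left associativity).
Local Notation Δ := (cop H).
Local Notation ε := (cou H).
Variables (M : lmodType k) (B : bcv_on H M).
Local Notation "h ▹ m" := (bL B h m) (at level 38, right associativity).
Local Notation "m ◃ h" := (bR B m h) (at level 39, left associativity).
Local Notation pl := (pl B).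
(** An abstract splitting of the idempotent P_L. The two equations on [i] and [p] reduce every
    statement about coinvariants to an equational one in M, and V may later carry a twist of its
    own. *)
Variables (V : lmodType k) (i : lmap V M) (p : lmap M V).
Hypotheses (ipE : forall m, i (p m) = pl m) (piK : forall v, p (i v) = v).

Lemma pl_i v : pl (i v) = i v. Proof. by rewrite -ipE piK. Qed.
Lemma p_pl m : p (pl m) = p m. Proof. by rewrite -ipE piK. Qed.
Lemma p_L h m : p (h ▹ m) = ε h *: p m.
Proof. by rewrite -p_pl pl_L lmZ p_pl. Qed.
Lemma i_coinv v : bl B (i v) = one H ⊠ i v.
Proof. by rewrite -pl_i pl_coinv. Qed.
Lemma recon_ip m : (do (h, x <- bl B m) h ▹ i (p x)) = m.
Proof. by inn rewrite ipE; inn rewrite recon. Qed.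
Lemma p_R m h : p (i (p m) ◃ h) = p (m ◃ h).
Proof. by rewrite ipE -p_pl pl_R p_pl. Qed.
Lemma br_i (X : lmodType k) (F : M -> A -> X) v : bilin F ->
  (do (x, g <- br B (i v)) F (i (p x)) g) = do (x, g <- br B (i v)) F x g.
Proof.
move=> FB; rewrite -pl_i -(br_pl_coinv B _ FB); apply: eq_sg => x g.
by rewrite ipE.
Qed.

Lemma ciA_bilin : bilin (fun v h => p (i v ◃ h)). Proof. mlin. Qed.
Definition ciA := locked (Bmap ciA_bilin).
Lemma ciAE v h : ciA v h = p (i v ◃ h). Proof. by rewrite /ciA -lock. Qed.
Lemma ciC_lin : lin (fun v => do (x, g <- br B (i v)) p x ⊠ g). Proof. mlin. Qed.
Definition ciC := locked (Lmap ciC_lin).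
Lemma ciCE v : ciC v = do (x, g <- br B (i v)) p x ⊠ g. Proof. by rewrite /ciC -lock. Qed.

Lemma ciAA v g h : ciA (ciA v g) h = ciA v (g ∙ h).
Proof. by rewrite !ciAE p_R bRA. Qed.
Lemma ciA1 v : ciA v (one H) = v. Proof. by rewrite ciAE bR1 piK. Qed.
Lemma ciCA v : (do (x, h <- ciC v) x ⊠ Δ h) =
    do (x, h <- ciC v) do (y, g <- ciC x) y ⊠ (g ⊠ h).
Proof.
rewrite ciCE. nrm.
inn rewrite -(sg_id (Δ _)). nrm. inn rewrite br_coassoc. inn rewrite -br_i.
symmetry. inn rewrite ciCE. nrm. reflexivity.
Qed.
Lemma ciC1 v : (do (x, h <- ciC v) ε h *: x) = v.
Proof. by rewrite ciCE; nrm; inn rewrite br_counit; rewrite piK. Qed.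
(** Both sides compute the projection of sigma(vh) on its first leg: the left one after
    straightening vh = h_1 (v ◁ h_2), the right one by multiplicativity of sigma. *)
Lemma ciComp v h : (do (a, b <- Δ h) do (x, g <- ciC (ciA v b)) x ⊠ (a ∙ g)) =
    do (x, g <- ciC v) do (a, b <- Δ h) ciA x a ⊠ (g ∙ b).
Proof.
transitivity (do (x, g <- br B (i v ◃ h)) p x ⊠ g).
  rewrite -[i v]pl_i coinv_R. symmetry. nrm.
  inn rewrite -p_pl.
  inn rewrite (br_pl_L B (F := fun x g => p x ⊠ g)). symmetry.
  inn rewrite ciCE. nrm. inn rewrite ciAE. inn rewrite ipE. symmetry. inn rewrite pl_i.
  inn rewrite p_pl. fin.
rewrite brR; nrm. symmetry. rewrite ciCE; nrm. inn rewrite ciAE. inn rewrite p_R. fin.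
Qed.
Definition coinv_ydm : ydm_on H V := YdmOn ciAA ciA1 ciCA ciC1 ciComp.
End Coinvariants.

(** * Tensor products of Yetter-Drinfeld modules *)

Section YdTensor.
Variables (k : comPzRingType) (A : lmodType k) (H : hopf_on A).
Local Notation "x ∙ y" := (mul H x y) (at level 40, left associativity).
Local Notation Δ := (cop H).
Local Notation ε := (cou H).
Variables (V W : lmodType k) (Y : ydm_on H V) (Z : ydm_on H W).

Definition tyA_fun (t : TT V W) (h : A) : TT V W :=
  do (v, w <- t) do (a, b <- Δ h) ya Y v a ⊠ ya Z w b.
Lemma tyA_bilin : bilin tyA_fun. Proof. by rewrite /tyA_fun; mlin. Qed.
Definition tyA := locked (Bmap tyA_bilin).
Lemma tyAE v w h : tyA (v ⊠ w) h = do (a, b <- Δ h) ya Y v a ⊠ ya Z w b.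
Proof. by rewrite /tyA -lock /= /tyA_fun; nrm. Qed.
Definition tyC_fun (t : TT V W) : TT (TT V W) A :=
  do (v, w <- t) do (x, g <- yc Y v) do (y, h <- yc Z w) (x ⊠ y) ⊠ (g ∙ h).
Lemma tyC_lin : lin tyC_fun. Proof. by rewrite /tyC_fun; mlin. Qed.
Definition tyC := locked (Lmap tyC_lin).
Lemma tyCE v w : tyC (v ⊠ w) =
  do (x, g <- yc Y v) do (y, h <- yc Z w) (x ⊠ y) ⊠ (g ∙ h).
Proof. by rewrite /tyC -lock /= /tyC_fun; nrm. Qed.

Ltac tyE := first [rewrite tyAE | rewrite tyCE].

Lemma tyAA t g h : tyA (tyA t g) h = tyA t (g ∙ h).
Proof.
ext t. nrm with tyE. symmetry. nrm with tyE. rewrite copM; nrm. inn rewrite -!yaA. fin.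
Qed.
Lemma tyA1 t : tyA t (one H) = t.
Proof. ext t. nrm with tyE. by rewrite cop1; nrm; rewrite !ya1. Qed.
Lemma tyCA t : (do (x, h <- tyC t) x ⊠ Δ h) =
    do (x, h <- tyC t) do (y, g <- tyC x) y ⊠ (g ⊠ h).
Proof.
ext t. nrm with tyE. inn rewrite copM; nrm. symmetry. nrm with tyE.
swp 1%N. inn rewrite -yc_coassoc. inat 2%N: rewrite -yc_coassoc. symmetry. fin.
Qed.
Lemma tyC1 t : (do (x, h <- tyC t) ε h *: x) = t.
Proof.
ext t. nrm with tyE. inn rewrite couM. inn rewrite -scalerA. nrm.
inn rewrite yc_counit. inn rewrite yc_counit. reflexivity.
Qed.
(** After coassociativity the comodule leg is h_1 (v ◁ h_2)_(1) (w ◁ h_3)_(1). The condition on V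
    turns its first two factors into v_(1) h_2, which puts h_2 in position for the condition on
    W. *)
Lemma tyComp t h : (do (a, b <- Δ h) do (x, g <- tyC (tyA t b)) x ⊠ (a ∙ g)) =
    do (x, g <- tyC t) do (a, b <- Δ h) tyA x a ⊠ (g ∙ b).
Proof.
ext t. nrm with tyE. inn rewrite mulA. inn rewrite -coassoc. rul yd_ya.
swp 1%N. inn rewrite coassoc. inn rewrite -mulA. swp 2%N. rul yd_ya.
symmetry. nrm with tyE. inn rewrite coassoc. inn rewrite -mulA. fin.
Qed.
Definition tensor_ydm : ydm_on H (TT V W) := YdmOn tyAA tyA1 tyCA tyC1 tyComp.
End YdTensor.

(** * Balanced tensor products *)

Record bcv_hom (k : comPzRingType) (A : lmodType k) (H : hopf_on A) (M N : lmodType k)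
    (B : bcv_on H M) (C : bcv_on H N) (f : lmap M N) : Prop := BcvHom {
  hL : forall h m, f (bL B h m) = bL C h (f m);
  hR : forall m h, f (bR B m h) = bR C (f m) h;
  hl : forall m, bl C (f m) = do (h, x <- bl B m) h ⊠ f x;
  hr : forall m, br C (f m) = do (x, h <- br B m) f x ⊠ h
}.

Section Balanced.
Variables (k : comPzRingType) (A : lmodType k) (H : hopf_on A).
Variables (M N : lmodType k) (B : bcv_on H M) (C : bcv_on H N).
Local Notation "m ◃ h" := (bR B m h) (at level 39, left associativity).
Local Notation "h ▸ m" := (bL C h m) (at level 38, right associativity).

Definition bal (P : Type) (f : M -> N -> P) := forall m h n, f (m ◃ h) n = f m (h ▸ n).
Definition is_bal (R : TT M N -> Prop) :=
  forall t, R t <-> exists m h n, t = (m ◃ h) ⊠ n - m ⊠ (h ▸ n).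

(* The relations are a parameter, because those of the Hom-tensor product are
   written with the Hom-actions. *)
Variable R : TT M N -> Prop.
Hypothesis HR : is_bal R.
Definition HT : lmodType k := qmod R.

Lemma pt_bilin : bilin (fun m n => qpi R (m ⊠ n) : HT).
Proof. have qL : lin (fun t => qpi R t : HT) by exact: qpi_linear. by mlin. Qed.
Definition pt : bmap M N HT := locked (Bmap pt_bilin).
Lemma ptE m n : pt m n = qpi R (m ⊠ n). Proof. by rewrite /pt -lock. Qed.
Lemma pt_bal m h n : pt (m ◃ h) n = pt m (h ▸ n).
Proof.
rewrite !ptE; apply/eq_qmodP/lspan_gen/HR.
by exists m, h, n.
Qed.

(** The counterpart of [sg] for balanced tensors: [f] is evaluated on a representative, which is
    independent of the choice when [f] is bilinear and balanced ([sh_pt]). *)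
Definition sh (P : lmodType k) (x : HT) (f : M -> N -> P) : P :=
  locked (qlift (fun t => sg t f) x).
Lemma shE P x f : @sh P x f = qlift (fun t => sg t f) x.
Proof. by rewrite /sh -lock. Qed.

Section Lift.
Variables (P : lmodType k) (f : M -> N -> P).
Hypotheses (fB : bilin f) (fb : bal f).
Let L : lin (fun t => sg t f). Proof. by mlin. Qed.
Lemma bal_R r : R r -> mklin L r = 0.
Proof.
move=> /HR [m [h [n ->]]]; rewrite linearB /=.
by rewrite !sg_tn // fb subrr.
Qed.
Lemma sh_pt m n : sh (pt m n) f = f m n.
Proof. by rewrite shE ptE (qliftE _ bal_R) /= sg_tn. Qed.
Lemma lin_sht (U : lmodType k) (g : U -> HT) : lin g -> lin (fun x => sh (g x) f).
Proof.
apply: (lin_f (f := fun x => sh x f)) => a x y; rewrite !shE.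
exact: (qlift_linear bal_R).
Qed.
End Lift.

Lemma lin_shf (U P : lmodType k) t (f : U -> M -> N -> P) :
  (forall a b, lin (fun x => f x a b)) -> lin (fun x => sh t (f x)).
Proof.
move=> fL a x y; rewrite !shE; exact: (lin_sgf _ fL).
Qed.

Lemma HT_ext (P : lmodType k) (f g : HT -> P) : lin f -> lin g ->
  (forall m n, f (pt m n) = g (pt m n)) -> forall t, f t = g t.
Proof.
move=> fL gL fg t; rewrite -[t]reprK.
have qL : lin (fun t => qpi R t : HT) by exact: qpi_linear.
apply: (TT_ext (f := fun t => f (qpi R t)) (g := fun t => g (qpi R t))).
- exact: lin_f.
- exact: lin_f.
- by move=> m n; rewrite -ptE.
Qed.
End Balanced.

Ltac lin_hook ::=
  lazymatch goal with
  | |- lin (fun x => sh _ _) => first [apply: lin_sht => // | apply: lin_shf; intros; cbv beta]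
  end.

Section BcvTensor.
Variables (k : comPzRingType) (A : lmodType k) (H : hopf_on A).
Local Notation "x ∙ y" := (mul H x y) (at level 40, left associativity).
Local Notation Δ := (cop H).
Local Notation ε := (cou H).
Variables (M N : lmodType k) (B : bcv_on H M) (C : bcv_on H N).
Local Notation "h ▹ m" := (bL B h m) (at level 38, right associativity).
Local Notation "m ◂ h" := (bR C m h) (at level 39, left associativity).
Variable R : TT M N -> Prop.
Hypothesis HR : is_bal B C R.
Local Notation T := (HT R).
Local Notation pt := (pt R).

Lemma tL_bal h : bal B C (fun m n => pt (h ▹ m) n).
Proof. by move=> m g n; rewrite -bLR (pt_bal HR). Qed.
Lemma tL_bilin : bilin (fun h (x : T) => sh x (fun m n => pt (h ▹ m) n)).
Proof. have ? := HR; have ? := tL_bal; mlin. Qed.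
Definition tL := locked (Bmap tL_bilin).
Lemma tLE h m n : tL h (pt m n) = pt (h ▹ m) n.
Proof. rewrite /tL -lock; apply: (sh_pt HR); [mlin | exact: tL_bal]. Qed.

Lemma tR_bal h : bal B C (fun m n => pt m (n ◂ h)).
Proof. by move=> m g n; rewrite bLR (pt_bal HR). Qed.
Lemma tR_bilin : bilin (fun (x : T) h => sh x (fun m n => pt m (n ◂ h))).
Proof. have ? := HR; have ? := tR_bal; mlin. Qed.
Definition tR := locked (Bmap tR_bilin).
Lemma tRE h m n : tR (pt m n) h = pt m (n ◂ h).
Proof. rewrite /tR -lock; apply: (sh_pt HR); [mlin | exact: tR_bal]. Qed.

Lemma tl_bal : bal B C (fun m n =>
  do (a, x <- bl B m) do (b, y <- bl C n) (a ∙ b) ⊠ pt x y).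
Proof.
move=> m h n. rewrite blR; nrm. symmetry; rewrite blL; nrm.
inn rewrite mulA. symmetry. inn rewrite (pt_bal HR). fin.
Qed.
Lemma tl_lin : lin (fun x : T => sh x (fun m n =>
  do (a, x <- bl B m) do (b, y <- bl C n) (a ∙ b) ⊠ pt x y)).
Proof. have ? := HR; have ? := tl_bal; mlin. Qed.
Definition tl := locked (Lmap tl_lin).
Lemma tlE m n : tl (pt m n) = do (a, x <- bl B m) do (b, y <- bl C n) (a ∙ b) ⊠ pt x y.
Proof. rewrite /tl -lock; apply: (sh_pt HR); [mlin | exact: tl_bal]. Qed.

Lemma tr_bal : bal B C (fun m n =>
  do (x, a <- br B m) do (y, b <- br C n) pt x y ⊠ (a ∙ b)).
Proof.
move=> m h n. rewrite brR; nrm. symmetry; rewrite brL; nrm.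
inn rewrite mulA. symmetry. inn rewrite (pt_bal HR). fin.
Qed.
Lemma tr_lin : lin (fun x : T => sh x (fun m n =>
  do (x, a <- br B m) do (y, b <- br C n) pt x y ⊠ (a ∙ b))).
Proof. have ? := HR; have ? := tr_bal; mlin. Qed.
Definition tr := locked (Lmap tr_lin).
Lemma trE m n : tr (pt m n) = do (x, a <- br B m) do (y, b <- br C n) pt x y ⊠ (a ∙ b).
Proof. rewrite /tr -lock; apply: (sh_pt HR); [mlin | exact: tr_bal]. Qed.

Ltac tE := first [rewrite tLE | rewrite tRE | rewrite tlE | rewrite trE].
Ltac hext t := move: t; apply: HT_ext; [mlin | mlin | intros; cbv beta].

Lemma tensor_LA g h m : tL g (tL h m) = tL (g ∙ h) m.
Proof. by hext m; rewrite !tLE bLA. Qed.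
Lemma tensor_L1 m : tL (one H) m = m.
Proof. by hext m; rewrite !tLE bL1. Qed.
Lemma tensor_RA m g h : tR (tR m g) h = tR m (g ∙ h).
Proof. by hext m; rewrite !tRE bRA. Qed.
Lemma tensor_R1 m : tR m (one H) = m.
Proof. by hext m; rewrite !tRE bR1. Qed.
Lemma tensor_LR g m h : tR (tL g m) h = tL g (tR m h).
Proof. by hext m; rewrite tLE !tRE tLE. Qed.
Lemma tensor_lA m : (do (h, x <- tl m) Δ h ⊠ x) =
    do (h, x <- tl m) do (g, y <- tl x) (h ⊠ g) ⊠ y.
Proof.
hext m. nrm with tE. inn rewrite copM; nrm. swp 1%N.
inn rewrite bl_coassoc. inat 2%N: rewrite bl_coassoc. symmetry. nrm with tE. fin.
Qed.
Lemma tensor_l1 m : (do (h, x <- tl m) ε h *: x) = m.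
Proof.
hext m. nrm with tE. inn rewrite couM. inn rewrite -scalerA. nrm.
inn rewrite bl_counit. inn rewrite bl_counit. reflexivity.
Qed.
Lemma tensor_rA m : (do (x, h <- tr m) x ⊠ Δ h) =
    do (x, h <- tr m) do (y, g <- tr x) y ⊠ (g ⊠ h).
Proof.
hext m. nrm with tE. inn rewrite copM; nrm. swp 1%N.
inn rewrite br_coassoc. inat 2%N: rewrite br_coassoc. symmetry. nrm with tE. fin.
Qed.
Lemma tensor_r1 m : (do (x, h <- tr m) ε h *: x) = m.
Proof.
hext m. nrm with tE. inn rewrite couM. inn rewrite -scalerA. nrm.
inn rewrite br_counit. inn rewrite br_counit. reflexivity.
Qed.
Lemma tensor_lL h m : tl (tL h m) = do (a, b <- Δ h) do (c, x <- tl m) (a ∙ c) ⊠ tL b x.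
Proof.
hext m. rewrite tLE tlE blL; nrm. symmetry. nrm with tE. inn rewrite mulA. fin.
Qed.
Lemma tensor_lR m h : tl (tR m h) = do (c, x <- tl m) do (a, b <- Δ h) (c ∙ a) ⊠ tR x b.
Proof.
hext m. rewrite tRE tlE; nrm. inn rewrite blR; nrm. symmetry. nrm with tE. inn rewrite -mulA. fin.
Qed.
Lemma tensor_rL h m : tr (tL h m) = do (a, b <- Δ h) do (x, c <- tr m) tL a x ⊠ (b ∙ c).
Proof.
hext m. rewrite tLE trE brL; nrm. symmetry. nrm with tE. inn rewrite mulA. fin.
Qed.
Lemma tensor_rR m h : tr (tR m h) = do (x, c <- tr m) do (a, b <- Δ h) tR x a ⊠ (c ∙ b).
Proof.
hext m. rewrite tRE trE; nrm. inn rewrite brR; nrm. symmetry. nrm with tE. inn rewrite -mulA. fin.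
Qed.
Lemma tensor_bic m : (do (h, x <- tl m) h ⊠ tr x) =
    do (x, h <- tr m) do (g, y <- tl x) g ⊠ (y ⊠ h).
Proof.
hext m. nrm with tE. swp 1%N. inn rewrite bicomod. inat 2%N: rewrite bicomod.
symmetry. nrm with tE. fin.
Qed.
Definition tensor_bcv : bcv_on H T :=
  BcvOn tensor_LA tensor_L1 tensor_RA tensor_R1 tensor_LR tensor_lA tensor_l1
    tensor_rA tensor_r1 tensor_lL tensor_lR tensor_rL tensor_rR tensor_bic.
Lemma tensorLE h m n : bL tensor_bcv h (pt m n) = pt (h ▹ m) n.
Proof. exact: tLE. Qed.
Lemma tensorRE h m n : bR tensor_bcv (pt m n) h = pt m (n ◂ h).
Proof. exact: tRE. Qed.
Lemma tensorlE m n : bl tensor_bcv (pt m n) =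
  do (a, x <- bl B m) do (b, y <- bl C n) (a ∙ b) ⊠ pt x y.
Proof. exact: tlE. Qed.
Lemma tensorrE m n : br tensor_bcv (pt m n) =
  do (x, a <- br B m) do (y, b <- br C n) pt x y ⊠ (a ∙ b).
Proof. exact: trE. Qed.
End BcvTensor.

(** * The braiding of bicovariant bimodules *)

Section Braid.
Variables (k : comPzRingType) (A : lmodType k) (H : hopf_on A).
Local Notation "x ∙ y" := (mul H x y) (at level 40, left associativity).
Local Notation Δ := (cop H).
Variables (M N : lmodType k) (B : bcv_on H M) (C : bcv_on H N).
Local Notation "m ◃ h" := (bR B m h) (at level 39, left associativity).
Local Notation "h ▸ m" := (bL C h m) (at level 38, right associativity).
Local Notation pl := (pl B).
Variables (R : TT M N -> Prop) (R' : TT N M -> Prop).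
Hypotheses (HR : is_bal B C R) (HR' : is_bal C B R').
Local Notation T := (HT R).
Local Notation pt' := (pt R').
Local Notation pt := (pt R).

(** Moving h across the tensor inserts h_1 between m_(-1) and n_[0] and h_2 between m_(0) and n_[1],
    whichever side h starts from; associativity of the actions finishes. *)
Lemma brd_bal : bal B C (fun m n =>
  do (h, y <- bl B m) do (z, g <- br C n) pt' (h ▸ z) (pl (y ◃ g))).
Proof.
move=> m h n. rewrite blR; nrm. symmetry; rewrite brL; nrm.
inn rewrite bLA. inn rewrite -bRA. fin.
Qed.
Lemma brd_lin : lin (fun x : T => sh x (fun m n =>
  do (h, y <- bl B m) do (z, g <- br C n) pt' (h ▸ z) (pl (y ◃ g)))).
Proof. have ? := HR; have ? := brd_bal; mlin. Qed.
Definition brd := locked (Lmap brd_lin).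
Lemma brdE m n : brd (pt m n) =
  do (h, y <- bl B m) do (z, g <- br C n) pt' (h ▸ z) (pl (y ◃ g)).
Proof. rewrite /brd -lock; apply: (sh_pt HR); [mlin | exact: brd_bal]. Qed.

(** [br_pl_recon] at [m ◃ q], with both coactions of the product expanded so that it matches the sum
    met in [brdr]. *)
Lemma br_pl_rul (X : lmodType k) (E : A -> M -> A -> A -> M -> A -> X) (F : M -> A -> X) m q :
  (forall c y a g w b, E c y a g w b = F w (c ∙ a ∙ b)) -> bilin F ->
  (do (c, y <- bl B m) do (a, g <- Δ q) do (w, b <- br B (pl (y ◃ g))) E c y a g w b) =
  do (x, a <- br B m) do (c, d <- Δ q) F (pl (x ◃ c)) (a ∙ d).
Proof.
move=> EF FB; have := br_pl_recon B (m ◃ q) FB; rewrite blR brR => e.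
eapply etrans; [ eapply etrans; [|exact: e] | nrm; reflexivity ].
symmetry; nrm; do 3![apply: eq_sg => ? ?]; by rewrite EF.
Qed.

Local Notation TB := (tensor_bcv HR).
Local Notation TB' := (tensor_bcv HR').

Ltac tE := first [rewrite tLE | rewrite tRE | rewrite tlE | rewrite trE | rewrite brdE].
Ltac hext t := move: t; apply: HT_ext; [mlin | mlin | intros; cbv beta].

Lemma brdL h t : brd (tL HR h t) = tL HR' h (brd t).
Proof.
hext t. rewrite tLE !brdE blL; nrm. inn rewrite bLR. inn rewrite pl_L. nrm.
inn rewrite counitr. inn rewrite -bLA. symmetry. nrm with tE. fin.
Qed.
(** Acting by h on the factor P_L(m_(0) n_[1]) produces by straightening a left factor h_1, which
    crosses the balanced tensor product and lands behind n_[0]. *)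
Lemma brdR t h : brd (tR HR t h) = tR HR' (brd t) h.
Proof.
hext t. rewrite tRE !brdE brR; nrm. symmetry. nrm with tE.
inn rewrite coinv_R. nrm. inn rewrite -(pt_bal HR'). inn rewrite pl_R. inn rewrite bLR.
inn rewrite bRA. fin.
Qed.
Lemma brdl t : tl HR' (brd t) = do (h, x <- tl HR t) h ⊠ brd x.
Proof.
hext t. rewrite brdE; nrm. nrm with tE. inn rewrite pl_coinv; nrm. inn rewrite mulr1'.
inn rewrite blL; nrm. symmetry. nrm with tE. swp 1%N. inn rewrite -bl_coassoc.
inat 2%N: rewrite bicomod. fin.
Qed.
(** With q a comodule leg of n, the coaction leg contains (mq)_(-1) times the coaction leg of
    P_L((mq)_(0)). Reconstruction collapses this pair to the right coaction of mq. *)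
Lemma brdr t : tr HR' (brd t) = do (x, h <- tr HR t) brd x ⊠ h.
Proof.
hext t. rewrite brdE; nrm. nrm with tE. inn rewrite brL; nrm.
swp 1%N. inn rewrite bl_coassoc. inat 2%N: rewrite -br_coassoc.
swp 1%N. rul br_pl_rul.
symmetry. nrm with tE. swp 1%N. inn rewrite -bicomod. inat 2%N: rewrite -br_coassoc. fin.
Qed.
Lemma brd_hom : bcv_hom TB TB' brd.
Proof. by split; [exact: brdL | exact: brdR | exact: brdl | exact: brdr]. Qed.
End Braid.

Record ydm_hom (k : comPzRingType) (A : lmodType k) (H : hopf_on A) (V W : lmodType k)
    (Y : ydm_on H V) (Z : ydm_on H W) (f : lmap V W) : Prop := YdmHom {
  hya : forall v h, f (ya Y v h) = ya Z (f v) h;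
  hyc : forall v, yc Z (f v) = do (x, h <- yc Y v) f x ⊠ h
}.

(** * The natural isomorphisms between M and H ⊗ F(M), and between F(H ⊗ W) and W *)

Section Unit.
Variables (k : comPzRingType) (A : lmodType k) (H : hopf_on A).
Local Notation "x ∙ y" := (mul H x y) (at level 40, left associativity).

Variables (M : lmodType k) (B : bcv_on H M).
Local Notation "h ▹ m" := (bL B h m) (at level 38, right associativity).
Local Notation pl := (pl B).

Lemma br_pl_recon_rul (X : lmodType k) (E : A -> M -> M -> A -> X) (F : M -> A -> X) m :
  (forall h y x g, E h y x g = F x (h ∙ g)) -> bilin F ->
  (do (h, y <- bl B m) do (x, g <- br B (pl y)) E h y x g) = do (x, g <- br B m) F (pl x) g.
Proof.
move=> EF FB; rewrite -(br_pl_recon B m FB).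
by apply: eq_sg => h y; apply: eq_sg => x g; apply: EF.
Qed.

Variables (V : lmodType k) (i : lmap V M) (p : lmap M V).
Hypotheses (ipE : forall m, i (p m) = pl m) (piK : forall v, p (i v) = v).

Lemma eta_lin : lin (fun m => do (h, x <- bl B m) h ⊠ p x). Proof. mlin. Qed.
Definition eta := locked (Lmap eta_lin).
Lemma etaE m : eta m = do (h, x <- bl B m) h ⊠ p x. Proof. by rewrite /eta -lock. Qed.
Lemma theta_lin : lin (fun t : TT A V => do (h, v <- t) h ▹ i v). Proof. mlin. Qed.
Definition theta := locked (Lmap theta_lin).
Lemma thetaE h v : theta (h ⊠ v) = h ▹ i v.
Proof. by rewrite /theta -lock; apply: (etrans (sg_tn _ _ _)) => //; mlin. Qed.

Local Notation V' := (coinv_ydm ipE piK).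
Local Notation G := (free_bcv V').

Lemma etaL h m : eta (h ▹ m) = fL H V h (eta m).
Proof.
rewrite !etaE blL; nrm. inn rewrite (p_L ipE piK); nrm.
symmetry; nrm. inn rewrite fLE. symmetry. inn rewrite counitr. fin.
Qed.
(** The delicate clause is right colinearity: the leg m_(-1) P_L(m_(0))_[1] collapses by
    [br_pl_recon], and [bicomod] then exchanges the two coactions. *)
Lemma eta_hom : bcv_hom B G eta.
Proof.
split=> [h m|m h|m|m].
- exact: etaL.
- rewrite !etaE blR; nrm. symmetry; nrm. inn rewrite fRE; nrm. inn rewrite ciAE.
  inn rewrite (p_R ipE piK). fin.
- rewrite etaE; nrm. inn rewrite flE; nrm. symmetry. inn rewrite etaE; nrm.
  inn rewrite -bl_coassoc. fin.
- rewrite etaE; nrm. inn rewrite frE; nrm. inn rewrite ciCE; nrm. inn rewrite ipE.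
  inn rewrite bl_coassoc. rul br_pl_recon_rul. inn rewrite (p_pl ipE piK).
  symmetry. inn rewrite etaE. nrm. inn rewrite -bicomod. fin.
Qed.
Lemma etaK m : theta (eta m) = m.
Proof. rewrite etaE; nrm. inn rewrite thetaE. inn rewrite (recon_ip ipE). reflexivity. Qed.
Lemma thetaK t : eta (theta t) = t.
Proof.
ext t. rewrite thetaE etaL etaE (i_coinv ipE piK); nrm. by rewrite fLE mulr1' piK.
Qed.
End Unit.

Section Counit.
Variables (k : comPzRingType) (A : lmodType k) (H : hopf_on A).
Local Notation "x ∙ y" := (mul H x y) (at level 40, left associativity).
Local Notation ε := (cou H).
Local Notation S := (ant H).

Variables (W : lmodType k) (Y : ydm_on H W).
Local Notation G := (free_bcv Y).
Variables (V : lmodType k) (i : lmap V (TT A W)) (p : lmap (TT A W) V).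
Hypotheses (ipE : forall m, i (p m) = pl G m) (piK : forall v, p (i v) = v).

Lemma ew_lin : lin (fun t : TT A W => do (h, v <- t) ε h *: v). Proof. mlin. Qed.
Definition ew := locked (Lmap ew_lin).
Lemma ewE h v : ew (h ⊠ v) = ε h *: v.
Proof. by rewrite /ew -lock; apply: (etrans (sg_tn _ _ _)) => //; mlin. Qed.
(** Since S(h_1) h_2 = eps(h) 1, the coinvariants of H ⊗ W are exactly 1 ⊗ W, and [ew] identifies
    them with W. *)
Lemma pl_free t : pl G t = one H ⊠ ew t.
Proof.
ext t. rewrite ewE plE flE; nrm. inn rewrite fLE.
ctr (fun a b : A => S a ∙ b). inn rewrite antl. nrm. by rewrite bZr.
Qed.
Lemma eps_lin : lin (fun v => ew (i v)). Proof. mlin. Qed.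
Definition eps := locked (Lmap eps_lin).
Lemma epsE v : eps v = ew (i v). Proof. by rewrite /eps -lock. Qed.
Definition epsV_fun w := p (one H ⊠ w).
Lemma epsV_lin : lin epsV_fun. Proof. rewrite /epsV_fun; mlin. Qed.
Definition epsV := locked (Lmap epsV_lin).
Lemma epsVE w : epsV w = p (one H ⊠ w). Proof. by rewrite /epsV -lock. Qed.
Lemma eps_p t : eps (p t) = ew t.
Proof. by rewrite epsE ipE pl_free ewE cou1 scale1r. Qed.
Lemma epsVK w : eps (epsV w) = w.
Proof. by rewrite epsVE eps_p ewE cou1 scale1r. Qed.
Lemma epsK v : epsV (eps v) = v.
Proof. by rewrite epsVE epsE -pl_free (p_pl ipE piK) piK. Qed.
Lemma ewR t g : ew (fR Y t g) = ya Y (ew t) g.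
Proof.
ext t. rewrite fRE ewE; nrm. inn rewrite ewE. inn rewrite couM. inn rewrite -scalerA.
nrm. inn rewrite counitl. by rewrite bZl.
Qed.
Lemma eps_hom : ydm_hom (coinv_ydm ipE piK) Y eps.
Proof.
split=> [v h|v].
- by rewrite [ya _ _ _]ciAE eps_p ewR -epsE.
- symmetry; rewrite [yc (coinv_ydm _ _) _]ciCE; nrm. inn rewrite eps_p.
  rewrite -(pl_i ipE piK) pl_free -epsE [br _ _]frE cop1; nrm. inn rewrite ewE.
  inn rewrite cou1. inn rewrite scale1r. inn rewrite mul1r'. by rewrite [LHS]sg_id.
Qed.
End Counit.

(** * The braiding of Yetter-Drinfeld modules *)

Section YdBraid.
Variables (k : comPzRingType) (A : lmodType k) (H : hopf_on A).
Local Notation "x ∙ y" := (mul H x y) (at level 40, left associativity).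
Local Notation Δ := (cop H).
Local Notation ε := (cou H).
Local Notation S := (ant H).
Variables (V W : lmodType k) (Y : ydm_on H V) (Z : ydm_on H W).
Local Notation "v ◁ h" := (ya Y v h) (at level 39, left associativity).

Lemma yB_lin : lin (fun t : TT V W => do (v, w <- t) do (y, g <- yc Z w) y ⊠ (v ◁ g)).
Proof. mlin. Qed.
Definition yB := locked (Lmap yB_lin).
Lemma yBE v w : yB (v ⊠ w) = do (y, g <- yc Z w) y ⊠ (v ◁ g).
Proof. by rewrite /yB -lock; apply: (etrans (sg_tn _ _ _)) => //; mlin. Qed.

Ltac tyE := first [rewrite tyAE | rewrite tyCE | rewrite yBE].

(** Linearity is the Yetter-Drinfeld condition of W, through the product h_1 (w ◁ h_2)_(1);
    colinearity is that of V, through w_(1) (v ◁ w_(2))_(1). *)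
Lemma yB_hom : ydm_hom (tensor_ydm Y Z) (tensor_ydm Z Y) yB.
Proof.
split=> [t h|t].
- change (yB (tyA Y Z t h) = tyA Z Y (yB t) h). ext t. nrm with tyE. inn rewrite yaA. rul yd_ya.
  symmetry. nrm with tyE. inn rewrite yaA. fin.
- change (tyC Z Y (yB t) = do (x, h <- tyC Y Z t) yB x ⊠ h). ext t. nrm with tyE.
  inn rewrite -yc_coassoc. rul yd_ya.
  symmetry. nrm with tyE. inn rewrite -yc_coassoc. fin.
Qed.

Section Inverse.
Variable T : lmap A A.
Hypotheses (STK : cancel T S) (TSK : cancel S T).
(** S is injective and reverses products, so applying it to b T(a) gives a S(b), and the identity
    becomes an antipode axiom. *)
Lemma antV_r h : (do (a, b <- Δ h) b ∙ T a) = ε h *: one H.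
Proof.
apply: (can_inj TSK); nrm. inn rewrite antM. inn rewrite STK. by rewrite antr lmZ ant1.
Qed.
Lemma antV_l h : (do (a, b <- Δ h) T b ∙ a) = ε h *: one H.
Proof.
apply: (can_inj TSK); nrm. inn rewrite antM. inn rewrite STK. by rewrite antl lmZ ant1.
Qed.
Lemma yBV_lin : lin (fun t : TT W V => do (w, v <- t) do (y, g <- yc Z w) (v ◁ T g) ⊠ y).
Proof. mlin. Qed.
Definition yBV := locked (Lmap yBV_lin).
Lemma yBVE w v : yBV (w ⊠ v) = do (y, g <- yc Z w) (v ◁ T g) ⊠ y.
Proof. by rewrite /yBV -lock; apply: (etrans (sg_tn _ _ _)) => //; mlin. Qed.
Lemma yBK t : yBV (yB t) = t.
Proof.
ext t. rewrite yBE; nrm. inn rewrite yBVE. inn rewrite -yc_coassoc. inn rewrite yaA.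
ctr (fun a b : A => b ∙ T a). inn rewrite antV_r. nrm. inn rewrite ya1. inn rewrite yc_counit.
reflexivity.
Qed.
Lemma yBVK t : yB (yBV t) = t.
Proof.
ext t. rewrite yBVE; nrm. inn rewrite yBE. inn rewrite -yc_coassoc. inn rewrite yaA.
ctr (fun a b : A => T b ∙ a). inn rewrite antV_l. nrm. inn rewrite ya1. inn rewrite yc_counit.
reflexivity.
Qed.
End Inverse.
End YdBraid.

(** * Equality of structures and their transport along an automorphism *)

Lemma bmap_eq (k : comPzRingType) (M N P : lmodType k) (f g : bmap M N P) : f =2 g -> f = g.
Proof.
case: f g => [f fP] [g gP] /= fg.
have {fg} E : f = g by apply/funext => x; apply/funext => y.
by case: g / E gP => gP; rewrite (Prop_irrelevance fP gP).
Qed.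
Lemma lmap_eq (k : comPzRingType) (M N : lmodType k) (f g : lmap M N) : f =1 g -> f = g.
Proof.
case: f g => [f fP] [g gP] /= /funext E.
by case: g / E gP => gP; rewrite (Prop_irrelevance fP gP).
Qed.

Section Transport.
Variables (k : comPzRingType) (A : lmodType k) (H : hopf_on A) (M : lmodType k).

(** Extensionality makes two structures with the same operations equal as records, so one may
    replace the other by rewriting. *)
Lemma bcv_eq (B C : bcv_on H M) : bL B =2 bL C -> bR B =2 bR C -> bl B =1 bl C ->
  br B =1 br C -> B = C.
Proof.
case: B C => [L R l r ? ? ? ? ? ? ? ? ? ? ? ? ? ?] [L' R' l' r' ? ? ? ? ? ? ? ? ? ? ? ? ? ?] /=.
move=> /bmap_eq EL /bmap_eq ER /lmap_eq El /lmap_eq Er.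
subst L' R' l' r'; congr BcvOn; exact: Prop_irrelevance.
Qed.
Lemma ydm_eq (B C : ydm_on H M) : ya B =2 ya C -> yc B =1 yc C -> B = C.
Proof.
case: B C => [L l ? ? ? ? ?] [L' l' ? ? ? ? ?] /= /bmap_eq EL /lmap_eq El.
subst L' l'; congr YdmOn; exact: Prop_irrelevance.
Qed.

Variables (f g : lmap M M).
Hypotheses (fK : cancel f g) (gK : cancel g f).

Section TrBcv.
Variable B : bcv_on H M.
Lemma trL_bilin : bilin (fun h m => g (bL B h (f m))). Proof. mlin. Qed.
Definition trL := locked (Bmap trL_bilin).
Lemma trLE h m : trL h m = g (bL B h (f m)). Proof. by rewrite /trL -lock. Qed.
Lemma trR_bilin : bilin (fun m h => g (bR B (f m) h)). Proof. mlin. Qed.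
Definition trR := locked (Bmap trR_bilin).
Lemma trRE m h : trR m h = g (bR B (f m) h). Proof. by rewrite /trR -lock. Qed.
Lemma trl_lin : lin (fun m => do (h, x <- bl B (f m)) h ⊠ g x). Proof. mlin. Qed.
Definition trl := locked (Lmap trl_lin).
Lemma trlE m : trl m = do (h, x <- bl B (f m)) h ⊠ g x. Proof. by rewrite /trl -lock. Qed.
Lemma trr_lin : lin (fun m => do (x, h <- br B (f m)) g x ⊠ h). Proof. mlin. Qed.
Definition trr := locked (Lmap trr_lin).
Lemma trrE m : trr m = do (x, h <- br B (f m)) g x ⊠ h. Proof. by rewrite /trr -lock. Qed.

Ltac tE := first [rewrite trLE | rewrite trRE | rewrite trlE | rewrite trrE | rewrite gK].

(** The structure on M for which [f] is an isomorphism onto [B]. The Hopf algebra is left untouched,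
    so for [f] a twist that is only semilinear this is a new structure. *)
Definition transport_bcv : bcv_on H M.
Proof.
refine (@BcvOn _ _ _ _ trL trR trl trr _ _ _ _ _ _ _ _ _ _ _ _ _ _).
- by move=> *; rewrite !trLE gK bLA.
- by move=> *; rewrite !trLE bL1 fK.
- by move=> *; rewrite !trRE gK bRA.
- by move=> *; rewrite !trRE bR1 fK.
- by move=> *; rewrite !trLE !trRE !gK bLR.
- move=> m; rewrite trlE. nrm. symmetry. nrm with tE.
  inn rewrite -bl_coassoc. ctr (fun a b : A => a ⊠ b). inn rewrite sg_id. fin.
- by move=> m; rewrite trlE; nrm; inn rewrite bl_counit.
- move=> m; rewrite trrE. nrm. symmetry. nrm with tE.
  inn rewrite -br_coassoc. ctr (fun a b : A => a ⊠ b). inn rewrite sg_id. fin.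
- by move=> m; rewrite trrE; nrm; inn rewrite br_counit.
- move=> h m. rewrite trLE trlE gK blL; nrm. symmetry. nrm with tE. fin.
- move=> h m. rewrite trRE trlE gK blR; nrm. symmetry. nrm with tE. fin.
- move=> h m. rewrite trLE trrE gK brL; nrm. symmetry. nrm with tE. fin.
- move=> h m. rewrite trRE trrE gK brR; nrm. symmetry. nrm with tE. fin.
- move=> m. nrm with tE. inn rewrite bicomod. symmetry. nrm with tE. fin.
Defined.
End TrBcv.

Section TrYdm.
Variable Y : ydm_on H M.
Lemma trA_bilin : bilin (fun m h => g (ya Y (f m) h)). Proof. mlin. Qed.
Definition trA := locked (Bmap trA_bilin).
Lemma trAE m h : trA m h = g (ya Y (f m) h). Proof. by rewrite /trA -lock. Qed.
Lemma trC_lin : lin (fun m => do (x, h <- yc Y (f m)) g x ⊠ h). Proof. mlin. Qed.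
Definition trC := locked (Lmap trC_lin).
Lemma trCE m : trC m = do (x, h <- yc Y (f m)) g x ⊠ h. Proof. by rewrite /trC -lock. Qed.
Ltac tE' := first [rewrite trAE | rewrite trCE | rewrite gK].
Definition transport_ydm : ydm_on H M.
Proof.
refine (@YdmOn _ _ _ _ trA trC _ _ _ _ _).
- by move=> *; rewrite !trAE gK yaA.
- by move=> *; rewrite !trAE ya1 fK.
- move=> m; rewrite trCE. nrm. symmetry. nrm with tE'.
  inn rewrite -yc_coassoc. ctr (fun a b : A => a ⊠ b). inn rewrite sg_id. fin.
- by move=> m; rewrite trCE; nrm; inn rewrite yc_counit.
- move=> v h. nrm with tE'. rul yd_ya. symmetry. nrm with tE'. fin.
Defined.
End TrYdm.
End Transport.

Section TransportHom.
Variables (k : comPzRingType) (A : lmodType k) (H : hopf_on A) (M N : lmodType k).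
Variables (f g : lmap M M) (f' g' : lmap N N).
Hypotheses (fK : cancel f g) (gK : cancel g f) (fK' : cancel f' g') (gK' : cancel g' f').
Variable (u : lmap M N).
Hypothesis uf : forall m, u (f m) = f' (u m).
Lemma trans_g m : u (g m) = g' (u m).
Proof. by apply: (can_inj fK'); rewrite -uf gK gK'. Qed.
Lemma transport_bcv_hom (B : bcv_on H M) (C : bcv_on H N) : bcv_hom B C u ->
  bcv_hom (transport_bcv fK gK B) (transport_bcv fK' gK' C) u.
Proof.
case=> uL uR ul ur; split=> [h m|m h|m|m].
- by rewrite [bL _ _ _]trLE [bL (transport_bcv _ _ _) _ _]trLE trans_g uL uf.
- by rewrite [bR _ _ _]trRE [bR (transport_bcv _ _ _) _ _]trRE trans_g uR uf.
- rewrite [bl _ _]trlE [bl (transport_bcv _ _ _) _]trlE -uf ul; nrm.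
  by symmetry; nrm; inn rewrite trans_g.
- rewrite [br _ _]trrE [br (transport_bcv _ _ _) _]trrE -uf ur; nrm.
  by symmetry; nrm; inn rewrite trans_g.
Qed.
Lemma transport_ydm_hom (B : ydm_on H M) (C : ydm_on H N) : ydm_hom B C u ->
  ydm_hom (transport_ydm fK gK B) (transport_ydm fK' gK' C) u.
Proof.
case=> uL ul; split=> [m h|m].
- by rewrite [ya _ _ _]trAE [ya (transport_ydm _ _ _) _ _]trAE trans_g uL uf.
- rewrite [yc _ _]trCE [yc (transport_ydm _ _ _) _]trCE -uf ul; nrm.
  by symmetry; nrm; inn rewrite trans_g.
Qed.
End TransportHom.

(** * Untwisting Hom-structures *)

Section Bridge.
Variable k : comPzRingType.

(** Stated between functions without arguments, so that it also rewrites under binders; it is the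
    passage between the locked sums and those of the given axioms. *)
Lemma sgF (M N P : lmodType k) : @sg k M N P = @sw k M N P.
Proof. by apply/funext => t; apply/funext => f; rewrite sgE. Qed.

Definition tW_def (X : hobj k) : lmap X X := locked (Lmap (lin_Linear (@tw k X) (@lin_id k X))).
Definition tV_def (X : hobj k) : lmap X X := locked (Lmap (lin_Linear (@twV k X) (@lin_id k X))).
Definition tW X := tW_def X.
Definition tV X := tV_def X.
Lemma tWE (X : hobj k) (x : X) : tW X x = tw x. Proof. by rewrite /tW /tW_def -lock. Qed.
Lemma tVE (X : hobj k) (x : X) : tV X x = twV x. Proof. by rewrite /tV /tV_def -lock. Qed.
Lemma tWK (X : hobj k) (x : X) : tV X (tW X x) = x. Proof. by rewrite tWE tVE twK. Qed.
Lemma tVK (X : hobj k) (x : X) : tW X (tV X x) = x. Proof. by rewrite tWE tVE twVK. Qed.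
End Bridge.
Arguments tW {k X}.
Arguments tV {k X}.

Section HopfCore.
Variables (k : comPzRingType) (H : homHopf k).

(* The suffix 0 marks the given (twisted) Hom-operations; [mul1], [D1] and, below,
   [cL], [cR], [cl], [cr], [cA], [cC] are the untwisted ones. *)
Definition m0 : bmap H H H := locked (Bmap (hmul_bilin H)).
Lemma m0E a b : m0 a b = hmul a b. Proof. by rewrite /m0 -lock. Qed.
Definition D0 : lmap H (TT H H) := locked (Lmap (lin_Linear (@hcomul k H) (@lin_id k H))).
Lemma D0E a : D0 a = hcomul a. Proof. by rewrite /D0 -lock. Qed.
Definition e0 : lmap H k^o := locked (Lmap (lin_Linear (@hcounit k H) (@lin_id k H))).
Lemma e0E a : e0 a = hcounit a. Proof. by rewrite /e0 -lock. Qed.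
Definition S0 : lmap H H := locked (Lmap (lin_Linear (@antipode k H) (@lin_id k H))).
Lemma S0E a : S0 a = antipode a. Proof. by rewrite /S0 -lock. Qed.

Lemma m0_tW a b : tW (m0 a b) = m0 (tW a) (tW b).
Proof. by rewrite !m0E !tWE hmul_tw. Qed.
Lemma m0_tV a b : tV (m0 a b) = m0 (tV a) (tV b).
Proof. by apply: (can_inj (@tWK _ _)); rewrite m0_tW !tVK. Qed.
Lemma D0_tW c : D0 (tW c) = do (a, b <- D0 c) tW a ⊠ tW b.
Proof.
rewrite sgF !D0E tWE hcomul_tw /sw; apply: eq_bigr => p _; by rewrite !tWE.
Qed.
Lemma D0A c : (do (a, b <- D0 c) tV a ⊠ D0 b) =
  do (a, b <- D0 c) do (x, y <- D0 a) x ⊠ (y ⊠ tV b).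
Proof.
rewrite !sgF /D0 /tV /tV_def -!lock. exact: hcomulA.
Qed.
Lemma D0M a b : D0 (m0 a b) = do (a1, a2 <- D0 a) do (b1, b2 <- D0 b) m0 a1 b1 ⊠ m0 a2 b2.
Proof. by rewrite !sgF /D0 /m0 -!lock; exact: hcomulM. Qed.

Definition mul1 : bmap H H H := locked (Bmap (ltac:(mlin) : bilin (fun a b => tV (m0 a b)))).
Lemma mul1E a b : mul1 a b = tV (m0 a b). Proof. by rewrite /mul1 -lock. Qed.
Definition D1 : lmap H (TT H H) := locked (Lmap (ltac:(mlin) : lin (fun a => D0 (tW a)))).
Lemma D1E a : D1 a = D0 (tW a). Proof. by rewrite /D1 -lock. Qed.

(** Applying the twist once more cancels the inner inverse twists and leaves Hom-associativity
    verbatim. The associativity of each untwisted action below is obtained in the same way. *)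
Lemma mul1A a b c : mul1 a (mul1 b c) = mul1 (mul1 a b) c.
Proof.
rewrite !mul1E; congr (tV _); apply: (can_inj (@tWK _ _)); rewrite !m0_tW !tVK !m0E !tWE.
exact: hmulA.
Qed.
Lemma mulr1_1 a : mul1 a (hone H) = a.
Proof. by rewrite mul1E m0E hmul1 -tWE tWK. Qed.
Lemma mul1r_1 a : mul1 (hone H) a = a.
Proof. by rewrite mul1E m0E h1mul -tWE tWK. Qed.
(** Hom-coassociativity with its inverse twist on the first leg moved to the other side; on the
    twisted legs of D1 the remaining twists cancel. *)
Lemma D0_co (X : lmodType k) (F : H -> H -> H -> X) c : trilin F ->
  (do (a, b <- D0 c) do (x, y <- D0 b) F a x y) =
  do (a, b <- D0 c) do (x, y <- D0 a) F (tW x) y (tV b).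
Proof.
move=> FT.
pose G := fun (a : H) (t : TT H H) => do (x, y <- t) F (tW a) x y.
have GB : bilin G by rewrite /G; mlin.
via (D0A c) G; last by fin.
inn rewrite tVK. fin.
Qed.
Lemma D1E2 c : D1 c = do (a, b <- D0 c) tW a ⊠ tW b.
Proof. by rewrite D1E D0_tW. Qed.
Lemma D1_tW c : D1 (tW c) = do (a, b <- D1 c) tW a ⊠ tW b.
Proof. by rewrite [LHS]D1E2 D1E. Qed.
Lemma D1A c : (do (a, b <- D1 c) a ⊠ D1 b) =
    do (a, b <- D1 c) do (x, y <- D1 a) x ⊠ (y ⊠ b).
Proof.
rewrite D1E2; nrm. inn rewrite D1_tW; nrm. inn rewrite D1E2; nrm. inn rewrite D0_co.
inn rewrite tVK. symmetry; nrm. inn rewrite D1_tW; nrm. inn rewrite D1E2; nrm. fin.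
Qed.
Lemma e0_tW c : e0 (tW c) = e0 c.
Proof. by rewrite !e0E tWE hcounit_tw. Qed.
Lemma e0_r c : (do (a, b <- D1 c) e0 b *: a) = c.
Proof.
rewrite D1E -[RHS]tWK !tVE sgF /D0 /e0 -!lock. exact: hcounitr.
Qed.
Lemma e0_l c : (do (a, b <- D1 c) e0 a *: b) = c.
Proof.
rewrite D1E -[RHS]tWK !tVE sgF /D0 /e0 -!lock. exact: hcounitl.
Qed.
Lemma D1M a b : D1 (mul1 a b) =
  do (a1, a2 <- D1 a) do (b1, b2 <- D1 b) mul1 a1 b1 ⊠ mul1 a2 b2.
Proof.
rewrite D1E mul1E tVK D0M. symmetry. rewrite !D1E2; nrm.
inn rewrite mul1E. inn rewrite mul1E. inn rewrite -m0_tW. inn rewrite -m0_tW. inn rewrite tWK.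
inn rewrite tWK. fin.
Qed.
Lemma D1_1 : D1 (hone H) = hone H ⊠ hone H.
Proof. by rewrite D1E D0E tWE hone_tw; exact: hcomul1. Qed.
Lemma e0M a b : e0 (mul1 a b) = e0 a * e0 b.
Proof. by rewrite mul1E -e0_tW tVK m0E !e0E hcounitM. Qed.
Lemma e0_1 : e0 (hone H) = 1.
Proof. by rewrite e0E hcounit1. Qed.
Lemma tV_1 : tV (hone H) = hone H.
Proof. by rewrite -{1}hone_tw -tWE tWK. Qed.
Lemma S0_l h : (do (a, b <- D1 h) mul1 (S0 a) b) = e0 h *: hone H.
Proof.
rewrite D1E; inn rewrite mul1E; rewrite -[LHS]lm_sg.
have -> : (do (a, b <- D0 (tW h)) m0 (S0 a) b) = e0 (tW h) *: hone H.
  by rewrite sgF /D0 /m0 /S0 /e0 -!lock; exact: antipodel.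
by rewrite lmZ tV_1 e0_tW.
Qed.
Lemma S0_r h : (do (a, b <- D1 h) mul1 a (S0 b)) = e0 h *: hone H.
Proof.
rewrite D1E; inn rewrite mul1E; rewrite -[LHS]lm_sg.
have -> : (do (a, b <- D0 (tW h)) m0 a (S0 b)) = e0 (tW h) *: hone H.
  by rewrite sgF /D0 /m0 /S0 /e0 -!lock; exact: antipoder.
by rewrite lmZ tV_1 e0_tW.
Qed.
Definition core_hopf : hopf_on H :=
  HopfOn mul1A mulr1_1 mul1r_1 D1A e0_r e0_l D1M D1_1 e0M e0_1 S0_l S0_r.
End HopfCore.

Section BicovCore.
Variables (k : comPzRingType) (H : homHopf k).
Variables (M : hobj k) (s : bicov_on H M).

Definition L0 : bmap H M M := locked (Bmap (lmod_bilin (bc_lmod s))).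
Lemma L0E h m : L0 h m = lact s h m. Proof. by rewrite /L0 -lock. Qed.
Definition R0 : bmap M H M := locked (Bmap (rmod_bilin (bc_rmod s))).
Lemma R0E h m : R0 h m = ract s h m. Proof. by rewrite /R0 -lock. Qed.
Definition l0 : lmap M (TT H M) := locked (Lmap (lcom_linear (bc_lcom s) : lin _)).
Lemma l0E m : l0 m = lco s m. Proof. by rewrite /l0 -lock. Qed.
Definition r0 : lmap M (TT M H) := locked (Lmap (rcom_linear (bc_rcom s) : lin _)).
Lemma r0E m : r0 m = rco s m. Proof. by rewrite /r0 -lock. Qed.

Lemma L0_tW h m : tW (L0 h m) = L0 (tW h) (tW m).
Proof. by rewrite !L0E !tWE (lmod_tw (bc_lmod s)). Qed.
Lemma R0_tW m h : tW (R0 m h) = R0 (tW m) (tW h).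
Proof. by rewrite !R0E !tWE (rmod_tw (bc_rmod s)). Qed.
Lemma l0_tW m : l0 (tW m) = do (h, x <- l0 m) tW h ⊠ tW x.
Proof. by rewrite sgF /l0 /tW /tW_def -!lock; exact: (lcom_tw (bc_lcom s)). Qed.
Lemma r0_tW m : r0 (tW m) = do (x, h <- r0 m) tW x ⊠ tW h.
Proof. by rewrite sgF /r0 /tW /tW_def -!lock; exact: (rcom_tw (bc_rcom s)). Qed.

Definition cL : bmap H M M := locked (Bmap (ltac:(mlin) : bilin (fun h m => tV (L0 h m)))).
Lemma cLE h m : cL h m = tV (L0 h m). Proof. by rewrite /cL -lock. Qed.
Definition cR : bmap M H M := locked (Bmap (ltac:(mlin) : bilin (fun m h => tV (R0 m h)))).
Lemma cRE m h : cR m h = tV (R0 m h). Proof. by rewrite /cR -lock. Qed.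
Definition cl : lmap M (TT H M) := locked (Lmap (ltac:(mlin) : lin (fun m => l0 (tW m)))).
Lemma clE m : cl m = l0 (tW m). Proof. by rewrite /cl -lock. Qed.
Definition cr : lmap M (TT M H) := locked (Lmap (ltac:(mlin) : lin (fun m => r0 (tW m)))).
Lemma crE m : cr m = r0 (tW m). Proof. by rewrite /cr -lock. Qed.

Lemma cL_tW h m : tW (cL h m) = cL (tW h) (tW m).
Proof. by rewrite !cLE -L0_tW tWK tVK. Qed.
Lemma cR_tW m h : tW (cR m h) = cR (tW m) (tW h).
Proof. by rewrite !cRE -R0_tW tWK tVK. Qed.
Lemma cl_tW m : cl (tW m) = do (h, x <- cl m) tW h ⊠ tW x.
Proof. by rewrite !clE l0_tW. Qed.
Lemma cr_tW m : cr (tW m) = do (x, h <- cr m) tW x ⊠ tW h.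
Proof. by rewrite !crE r0_tW. Qed.
Lemma clE2 m : cl m = do (h, x <- l0 m) tW h ⊠ tW x.
Proof. by rewrite clE l0_tW. Qed.
Lemma crE2 m : cr m = do (x, h <- r0 m) tW x ⊠ tW h.
Proof. by rewrite crE r0_tW. Qed.

Lemma cLA g h m : cL g (cL h m) = cL (mul1 H g h) m.
Proof.
rewrite !cLE mul1E; congr (tV _); apply: (can_inj (@tWK _ _)); rewrite !L0_tW !tVK.
rewrite m0E !L0E !tWE. exact: (lmodA (bc_lmod s)).
Qed.
Lemma cL1 m : cL (hone H) m = m.
Proof. by rewrite cLE L0E (lmod1 (bc_lmod s)) -tWE tWK. Qed.
Lemma cRA m g h : cR (cR m g) h = cR m (mul1 H g h).
Proof.
rewrite !cRE mul1E; congr (tV _); apply: (can_inj (@tWK _ _)); rewrite !R0_tW !tVK.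
rewrite m0E !R0E !tWE. exact: (rmodA (bc_rmod s)).
Qed.
Lemma cR1 m : cR m (hone H) = m.
Proof. by rewrite cRE R0E (rmod1 (bc_rmod s)) -tWE tWK. Qed.
Lemma cLR g m h : cR (cL g m) h = cL g (cR m h).
Proof.
rewrite !cLE !cRE; congr (tV _); apply: (can_inj (@tWK _ _)); rewrite R0_tW L0_tW !tVK.
rewrite !R0E !L0E !tWE. exact: bc_bimod.
Qed.
Lemma l0_co (X : lmodType k) (F : H -> H -> M -> X) m : trilin F ->
  (do (h, x <- l0 m) do (a, b <- D0 H h) F a b x) =
  do (h, x <- l0 m) do (g, y <- l0 x) F (tV h) g (tW y).
Proof.
move=> FT.
pose G := fun (t : TT H H) (x : M) => do (a, b <- t) F a b (tW x).
have GB : bilin G by rewrite /G; mlin.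
have E : (do (h, x <- l0 m) D0 H h ⊠ tV x) =
         do (h, x <- l0 m) do (g, y <- l0 x) (tV h ⊠ g) ⊠ y.
  by rewrite !sgF /l0 /D0 /tV /tV_def -!lock; exact: (lcomA (bc_lcom s)).
via E G; last by fin.
inn rewrite tVK. fin.
Qed.
Lemma r0_co (X : lmodType k) (F : M -> H -> H -> X) m : trilin F ->
  (do (x, h <- r0 m) do (a, b <- D0 H h) F x a b) =
  do (x, h <- r0 m) do (y, g <- r0 x) F (tW y) g (tV h).
Proof.
move=> FT.
pose G := fun (x : M) (t : TT H H) => do (a, b <- t) F (tW x) a b.
have GB : bilin G by rewrite /G; mlin.
have E : (do (x, h <- r0 m) tV x ⊠ D0 H h) =
         do (x, h <- r0 m) do (y, g <- r0 x) y ⊠ (g ⊠ tV h).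
  by rewrite !sgF /r0 /D0 /tV /tV_def -!lock; exact: (rcomA (bc_rcom s)).
via E G; last by fin.
inn rewrite tVK. fin.
Qed.
Lemma r0l0 (X : lmodType k) (F : H -> M -> H -> X) m : trilin F ->
  (do (h, x <- l0 m) do (y, g <- r0 x) F h y g) =
  do (x, g <- r0 m) do (h, y <- l0 x) F (tW h) y (tV g).
Proof.
move=> FT.
pose G := fun (h : H) (t : TT M H) => do (x, g <- t) F h x g.
have GB : bilin G by rewrite /G; mlin.
have E : (do (h, x <- l0 m) h ⊠ r0 x) =
         do (x, g <- r0 m) do (h, y <- l0 x) tW h ⊠ (y ⊠ tV g).
  by rewrite !sgF /l0 /r0 /tV /tW /tW_def /tV_def -!lock; exact: (bc_bicom s).
by via E G; fin.
Qed.

Lemma clA m : (do (h, x <- cl m) D1 H h ⊠ x) =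
  do (h, x <- cl m) do (g, y <- cl x) (h ⊠ g) ⊠ y.
Proof.
rewrite clE2; nrm. inn rewrite D1_tW; nrm. inn rewrite D1E2; nrm. inn rewrite l0_co.
inn rewrite tVK. symmetry; nrm. inn rewrite cl_tW; nrm. inn rewrite clE2; nrm. fin.
Qed.
Lemma cl1 m : (do (h, x <- cl m) e0 H h *: x) = m.
Proof. by rewrite clE -[RHS]tWK !tVE sgF /l0 /e0 -!lock; exact: (lcom1 (bc_lcom s)). Qed.
Lemma crA m : (do (x, h <- cr m) x ⊠ D1 H h) =
  do (x, h <- cr m) do (y, g <- cr x) y ⊠ (g ⊠ h).
Proof.
rewrite crE2; nrm. inn rewrite D1_tW; nrm. inn rewrite D1E2; nrm. inn rewrite r0_co.
inn rewrite tVK. symmetry; nrm. inn rewrite cr_tW; nrm. inn rewrite crE2; nrm. fin.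
Qed.
Lemma cr1 m : (do (x, h <- cr m) e0 H h *: x) = m.
Proof. by rewrite crE -[RHS]tWK !tVE sgF /r0 /e0 -!lock; exact: (rcom1 (bc_rcom s)). Qed.
Lemma c_bic m : (do (h, x <- cl m) h ⊠ cr x) =
  do (x, h <- cr m) do (g, y <- cl x) g ⊠ (y ⊠ h).
Proof.
rewrite clE2; nrm. inn rewrite cr_tW; nrm. inn rewrite crE2; nrm. inn rewrite r0l0.
symmetry. rewrite crE2; nrm. inn rewrite cl_tW; nrm. inn rewrite clE2; nrm.
symmetry. inn rewrite tVK. fin.
Qed.

Lemma l0_act h m g : l0 (R0 (L0 h m) (tW g)) =
  do (h1, h2 <- D0 H (tW h)) do (c, x <- l0 m) do (g1, g2 <- D0 H g)
    m0 H h1 (m0 H c g1) ⊠ L0 h2 (R0 x g2).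
Proof. by rewrite !sgF tWE /l0 /R0 /L0 /D0 /m0 /tW /tW_def -!lock; exact: (bc_lco_act s). Qed.
Lemma r0_act h m g : r0 (R0 (L0 h m) (tW g)) =
  do (h1, h2 <- D0 H (tW h)) do (x, c <- r0 m) do (g1, g2 <- D0 H g)
    L0 h1 (R0 x g1) ⊠ m0 H h2 (m0 H c g2).
Proof. by rewrite !sgF tWE /r0 /R0 /L0 /D0 /m0 /tW /tW_def -!lock; exact: (bc_rco_act s). Qed.
Lemma m0E' g h : m0 H g h = tW (mul1 H g h). Proof. by rewrite mul1E tVK. Qed.
Lemma mul1_tW a b : tW (mul1 H a b) = mul1 H (tW a) (tW b).
Proof. by rewrite !mul1E -m0_tW tWK tVK. Qed.
End BicovCore.

Section BicovCore.
Variables (k : comPzRingType) (H : homHopf k).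
Local Notation HH := (core_hopf H).
Variables (M : hobj k) (s : bicov_on H M).
Local Notation η := (hone H).

Lemma D0_1 : D0 H η = η ⊠ η. Proof. by rewrite D0E; exact: hcomul1. Qed.
Lemma tW_1 : tW η = η. Proof. by rewrite tWE hone_tw. Qed.
Lemma R0_1 m : R0 s m η = tW m. Proof. by rewrite R0E tWE (rmod1 (bc_rmod s)). Qed.
Lemma L0_1 m : L0 s η m = tW m. Proof. by rewrite L0E tWE (lmod1 (bc_lmod s)). Qed.
Lemma m0_1 m : m0 H m η = tW m. Proof. by rewrite m0E tWE hmul1. Qed.
Lemma m0_1l m : m0 H η m = tW m. Proof. by rewrite m0E tWE h1mul. Qed.
Lemma D1E4 g : D1 H g = do (a, b <- D0 H (tV g)) tW (tW a) ⊠ tW (tW b).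
Proof. by rewrite -{1}[g]tVK D1_tW D1E2; nrm. Qed.
Lemma clE4 m : cl s m = do (a, b <- l0 s (tV m)) tW (tW a) ⊠ tW (tW b).
Proof. by rewrite -{1}[m]tVK cl_tW clE2; nrm. Qed.
Lemma crE4 m : cr s m = do (a, b <- r0 s (tV m)) tW (tW a) ⊠ tW (tW b).
Proof. by rewrite -{1}[m]tVK cr_tW crE2; nrm. Qed.

(** The Hom-axiom only gives the coaction of a two-sided product (hm)alpha(g). The one-sided product
    is brought to that form by taking g = 1 and shifting h and m by the inverse twist; [clR] inserts
    the unit on the left instead. *)
Lemma clL h m : cl s (cL s h m) = do (a, b <- D1 H h) do (c, x <- cl s m) mul1 H a c ⊠ cL s b x.
Proof.
have E : L0 s h m = R0 s (L0 s (tV h) (tV m)) (tW η).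
  by rewrite tW_1 R0_1 L0_tW !tVK.
rewrite clE cLE tVK E l0_act tVK D0_1. nrm. inn rewrite m0_1. inn rewrite R0_1.
symmetry. rewrite clE4 D1E2; nrm. inn rewrite mul1E. inn rewrite -m0_tW. inn rewrite tWK.
inn rewrite cLE. inn rewrite -L0_tW. inn rewrite tWK. fin.
Qed.
Lemma crL h m : cr s (cL s h m) = do (a, b <- D1 H h) do (x, c <- cr s m) cL s a x ⊠ mul1 H b c.
Proof.
have E : L0 s h m = R0 s (L0 s (tV h) (tV m)) (tW η).
  by rewrite tW_1 R0_1 L0_tW !tVK.
rewrite crE cLE tVK E r0_act tVK D0_1. nrm. inn rewrite m0_1. inn rewrite R0_1.
symmetry. rewrite crE4 D1E2; nrm. inn rewrite mul1E. inn rewrite -m0_tW. inn rewrite tWK.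
inn rewrite cLE. inn rewrite -L0_tW. inn rewrite tWK. fin.
Qed.
Lemma clR m g : cl s (cR s m g) = do (c, x <- cl s m) do (a, b <- D1 H g) mul1 H c a ⊠ cR s x b.
Proof.
have E : R0 s m g = R0 s (L0 s η (tV m)) (tW (tV g)).
  by rewrite L0_1 !tVK.
rewrite clE cRE tVK E l0_act tW_1 D0_1. nrm. inn rewrite m0_1l. inn rewrite L0_1.
symmetry. rewrite clE4 D1E4; nrm. inn rewrite mul1E. inn rewrite -m0_tW. inn rewrite tWK.
inn rewrite -m0_tW.
inn rewrite cRE. inn rewrite -R0_tW. inn rewrite tWK. inn rewrite -R0_tW. fin.
Qed.
Lemma crR m g : cr s (cR s m g) = do (x, c <- cr s m) do (a, b <- D1 H g) cR s x a ⊠ mul1 H c b.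
Proof.
have E : R0 s m g = R0 s (L0 s η (tV m)) (tW (tV g)).
  by rewrite L0_1 !tVK.
rewrite crE cRE tVK E r0_act tW_1 D0_1. nrm. inn rewrite m0_1l. inn rewrite L0_1.
symmetry. rewrite crE4 D1E4; nrm. inn rewrite mul1E. inn rewrite -m0_tW. inn rewrite tWK.
inn rewrite -m0_tW.
inn rewrite cRE. inn rewrite -R0_tW. inn rewrite tWK. inn rewrite -R0_tW. fin.
Qed.

Definition core_bcv : bcv_on HH M :=
  @BcvOn _ _ HH _ (cL s) (cR s) (cl s) (cr s) (cLA s) (cL1 s) (cRA s) (cR1 s) (cLR s)
    (clA s) (cl1 s) (crA s) (cr1 s) clL clR crL crR (c_bic s).
End BicovCore.

(** Compatibility of the twist with the four operations: together with an ordinary bimodule this is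
    the information from which the Hom-bimodule is rebuilt ([mk_bicov]). *)
Record tw_bcv (k : comPzRingType) (H : homHopf k) (X : hobj k) (c : bcv_on (core_hopf H) X) : Prop := TwBcv {
  twL : forall h m, tW (bL c h m) = bL c (tW h) (tW m);
  twR : forall m h, tW (bR c m h) = bR c (tW m) (tW h);
  twl : forall m, bl c (tW m) = do (h, x <- bl c m) tW h ⊠ tW x;
  twr : forall m, br c (tW m) = do (x, h <- br c m) tW x ⊠ tW h
}.

Lemma core_tw (k : comPzRingType) (H : homHopf k) (M : hobj k) (s : bicov_on H M) :
  tw_bcv (core_bcv s).
Proof. by split; [exact: cL_tW | exact: cR_tW | exact: cl_tW | exact: cr_tW]. Qed.

Section Build.
Variables (k : comPzRingType) (H : homHopf k) (X : hobj k) (c : bcv_on (core_hopf H) X).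
Hypothesis ct : tw_bcv c.

Definition mL (h : H) (m : X) : X := tW (bL c h m).
Definition mR (m : X) (h : H) : X := tW (bR c m h).
Definition ml (m : X) : tens H X := bl c (tV m).
Definition mr (m : X) : tens X H := br c (tV m).

Lemma twl' m : bl c m = do (h, x <- bl c (tV m)) tW h ⊠ tW x.
Proof. by rewrite -{1}[m]tVK (twl ct). Qed.
Lemma twr' m : br c m = do (h, x <- br c (tV m)) tW h ⊠ tW x.
Proof. by rewrite -{1}[m]tVK (twr ct). Qed.
Lemma twlV m : bl c (tV m) = do (h, x <- bl c m) tV h ⊠ tV x.
Proof. by rewrite (twl' m); symmetry; nrm; inn rewrite tWK; inn rewrite tWK; rewrite [LHS]sg_id. Qed.
Lemma twrV m : br c (tV m) = do (h, x <- br c m) tV h ⊠ tV x.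
Proof. by rewrite (twr' m); symmetry; nrm; inn rewrite tWK; inn rewrite tWK; rewrite [LHS]sg_id. Qed.
Lemma D0E1 h : D0 H h = D1 H (tV h). Proof. by rewrite D1E tVK. Qed.

Lemma mk_lmod : is_lmodule (mL : H -> X -> X).
Proof.
split=> [|h m|g h m|m].
- by rewrite /mL; mlin.
- by rewrite -!tWE /mL (twL ct).
- by rewrite -!tWE -m0E m0E' /mL -!(twL ct) [bL c _ _]bLA.
- by rewrite -tWE /mL bL1.
Qed.
Lemma mk_rmod : is_rmodule (mR : X -> H -> X).
Proof.
split=> [|m h|m g h|m].
- by rewrite /mR; mlin.
- by rewrite -!tWE /mR (twR ct).
- by rewrite -!tWE -m0E m0E' /mR -!(twR ct) [bR c _ _]bRA.
- by rewrite -tWE /mR bR1.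
Qed.
Lemma mk_bimod g m h : mR (mL g m) (tw h) = mL (tw g) (mR m h).
Proof. by rewrite -!tWE /mL /mR -(twL ct) -(twR ct) bLR. Qed.
Lemma D1_tV h : D1 H (tV h) = do (a, b <- D1 H h) tV a ⊠ tV b.
Proof. by rewrite -{2}[h]tVK D1_tW; symmetry; nrm; inn rewrite tWK; inn rewrite tWK; rewrite [LHS]sg_id. Qed.
Lemma mk_lcom : is_lcomodule (H := H) ml.
Proof.
split=> [|m|m|m].
- by have : lin (fun m => bl c (tV m)) by mlin.
- rewrite -tWE; suff : ml (tW m) = do (h, x <- ml m) tW h ⊠ tW x.
    by rewrite sgF /tW /tW_def -!lock.
  by rewrite /ml tWK twl'.
- suff : (do (h, m0 <- bl c (tV m)) (D0 H h ⊠ tV m0)) =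
    do (h, m0 <- bl c (tV m)) do (h', m00 <- bl c (tV m0)) (tV h ⊠ h') ⊠ m00.
    by rewrite /ml !sgF /tV /tV_def /D0 -!lock.
  move: (tV m) => {}m; inn rewrite D0E1. inn rewrite D1_tV; nrm. inn rewrite (bl_coassoc c).
  symmetry. inn rewrite twlV; nrm. fin.
- have : (do (h, x <- bl c (tV m)) e0 H h *: x) = tV m by exact: (bl1 c).
  by rewrite /ml sgF /tV /tV_def /e0 -!lock.
Qed.
Lemma mk_rcom : is_rcomodule (H := H) mr.
Proof.
split=> [|m|m|m].
- by have : lin (fun m => br c (tV m)) by mlin.
- rewrite -tWE; suff : mr (tW m) = do (h, x <- mr m) tW h ⊠ tW x.
    by rewrite sgF /tW /tW_def -!lock.
  by rewrite /mr tWK twr'.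
- suff : (do (m0, h <- br c (tV m)) (tV m0 ⊠ D0 H h)) =
    do (m0, h <- br c (tV m)) do (m00, h' <- br c (tV m0)) m00 ⊠ (h' ⊠ tV h).
    by rewrite /mr !sgF /tV /tV_def /D0 -!lock.
  move: (tV m) => {}m; inn rewrite D0E1. inn rewrite D1_tV; nrm. inn rewrite (br_coassoc c).
  symmetry. inn rewrite twrV; nrm. fin.
- have : (do (x, h <- br c (tV m)) e0 H h *: x) = tV m by exact: (br1 c).
  by rewrite /mr sgF /tV /tV_def /e0 -!lock.
Qed.
Lemma mk_lco_act h m g : ml (mR (mL h m) (tw g)) =
    \sw_(h1, h2 <- hcomul (tw h)) \sw_(m1, m0 <- ml m) \sw_(g1, g2 <- hcomul g)
      (hmul h1 (hmul m1 g1) ⊗ mL h2 (mR m0 g2)).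
Proof.
suff : ml (mR (mL h m) (tW g)) =
    do (h1, h2 <- D0 H (tW h)) do (m1, x <- bl c (tV m)) do (g1, g2 <- D0 H g)
      m0 H h1 (m0 H m1 g1) ⊠ tW (bL c h2 (tW (bR c x g2))).
  by rewrite /ml /mL /mR !sgF /tW /tV /tW_def /tV_def /D0 /m0 -!lock.
(* Writing m and g as twists of new variables cancels the inverse twist inside [ml] and turns the
   Hom-coproduct of g into the untwisted one. *)
rewrite -[m]tVK -[g]tVK; move: (tV m) (tV g) => {}m {}g.
rewrite /ml /mR tWK /mL -(twR ct) (twl ct) blR; nrm. rewrite blL; nrm.
inn rewrite (twl ct); nrm. inn rewrite D1_tW; nrm. inn rewrite mul1_tW. inn rewrite (twR ct).
inn rewrite (twL ct).
symmetry. rewrite !tWK. inn rewrite -D1E. inn rewrite -D1E. inn rewrite m0E'. inn rewrite m0E'.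
inn rewrite !mul1_tW. inn rewrite mul1A. inn rewrite -mul1_tW.
inn rewrite (twL ct). inn rewrite !(twR ct). inn rewrite -bLR. reflexivity.
Qed.
Lemma mk_rco_act h m g : mr (mR (mL h m) (tw g)) =
    \sw_(h1, h2 <- hcomul (tw h)) \sw_(m0, m1 <- mr m) \sw_(g1, g2 <- hcomul g)
      (mL h1 (mR m0 g1) ⊗ hmul h2 (hmul m1 g2)).
Proof.
suff : mr (mR (mL h m) (tW g)) =
    do (h1, h2 <- D0 H (tW h)) do (x, m1 <- br c (tV m)) do (g1, g2 <- D0 H g)
      tW (bL c h1 (tW (bR c x g1))) ⊠ m0 H h2 (m0 H m1 g2).
  by rewrite /mr /mL /mR !sgF /tW /tV /tW_def /tV_def /D0 /m0 -!lock.
rewrite -[m]tVK -[g]tVK; move: (tV m) (tV g) => {}m {}g.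
rewrite /mr /mR tWK /mL -(twR ct) (twr ct) brR; nrm. rewrite brL; nrm.
inn rewrite (twr ct); nrm. inn rewrite D1_tW; nrm. inn rewrite mul1_tW. inn rewrite (twR ct).
inn rewrite (twL ct).
symmetry. rewrite !tWK. inn rewrite -D1E. inn rewrite -D1E. inn rewrite m0E'. inn rewrite m0E'.
inn rewrite !mul1_tW. inn rewrite mul1A. inn rewrite -mul1_tW.
inn rewrite (twL ct). inn rewrite !(twR ct). inn rewrite -bLR. reflexivity.
Qed.
Lemma mk_bicom m : \sw_(m1, m0 <- ml m) (m1 ⊗ mr m0) =
    \sw_(m0, m1 <- mr m) \sw_(m01, m00 <- ml m0) (tw m01 ⊗ (m00 ⊗ twV m1)).
Proof.
suff : (do (h, x <- bl c (tV m)) h ⊠ br c (tV x)) =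
    do (x, h <- br c (tV m)) do (g, y <- bl c (tV x)) tW g ⊠ (y ⊠ tV h).
  by rewrite /ml /mr !sgF /tW /tV /tW_def /tV_def -!lock.
move: (tV m) => {}m. inn rewrite twrV; nrm. inn rewrite (bicomod c). symmetry.
inn rewrite twlV; nrm. inn rewrite tVK. fin.
Qed.
Definition mk_bicov : bicov_on H X :=
  BicovOn mk_lmod mk_rmod mk_bimod mk_lcom mk_rcom mk_lco_act mk_rco_act mk_bicom.

(** Being an equality of structures, it lets the formulas of an ordinary structure be used directly
    for every Hom-bimodule built by [mk_bicov]. *)
Lemma core_mk : core_bcv mk_bicov = c.
Proof.
apply: bcv_eq => [h m|m h|m|m].
- by rewrite [LHS]cLE L0E /= /mL tWK.
- by rewrite [LHS]cRE R0E /= /mR tWK.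
- by rewrite [LHS]clE l0E /= /ml tWK.
- by rewrite [LHS]crE r0E /= /mr tWK.
Qed.
End Build.

(** * Untwisting Hom-Yetter-Drinfeld modules *)

Section YdCore.
Variables (k : comPzRingType) (H : homHopf k).
Local Notation HH := (core_hopf H).
Variables (V : hobj k) (s : yd_on H V).

Definition A0 : bmap V H V := locked (Bmap (rmod_bilin (yd_rmod s))).
Lemma A0E v h : A0 v h = yact s v h. Proof. by rewrite /A0 -lock. Qed.
Definition C0 : lmap V (TT V H) := locked (Lmap (rcom_linear (yd_rcom s) : lin _)).
Lemma C0E v : C0 v = yco s v. Proof. by rewrite /C0 -lock. Qed.
Lemma A0_tW m h : tW (A0 m h) = A0 (tW m) (tW h).
Proof. by rewrite !A0E !tWE (rmod_tw (yd_rmod s)). Qed.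
Lemma A0_tV m h : tV (A0 m h) = A0 (tV m) (tV h).
Proof. by apply: (can_inj (@tWK _ _)); rewrite A0_tW !tVK. Qed.
Lemma C0_tW m : C0 (tW m) = do (x, h <- C0 m) tW x ⊠ tW h.
Proof. by rewrite sgF /C0 /tW /tW_def -!lock; exact: (rcom_tw (yd_rcom s)). Qed.
Lemma C0_co (X : lmodType k) (F : V -> H -> H -> X) m : trilin F ->
  (do (x, h <- C0 m) do (a, b <- D0 H h) F x a b) =
  do (x, h <- C0 m) do (y, g <- C0 x) F (tW y) g (tV h).
Proof.
move=> FT.
pose G := fun (x : V) (t : TT H H) => do (a, b <- t) F (tW x) a b.
have GB : bilin G by rewrite /G; mlin.
have E : (do (x, h <- C0 m) tV x ⊠ D0 H h) =
         do (x, h <- C0 m) do (y, g <- C0 x) y ⊠ (g ⊠ tV h).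
  by rewrite !sgF /C0 /D0 /tV /tV_def -!lock; exact: (rcomA (yd_rcom s)).
via E G; last by fin.
inn rewrite tVK. fin.
Qed.

Definition cA : bmap V H V := locked (Bmap (ltac:(mlin) : bilin (fun m h => tV (A0 m h)))).
Lemma cAE m h : cA m h = tV (A0 m h). Proof. by rewrite /cA -lock. Qed.
Definition cC : lmap V (TT V H) := locked (Lmap (ltac:(mlin) : lin (fun m => C0 (tW m)))).
Lemma cCE m : cC m = C0 (tW m). Proof. by rewrite /cC -lock. Qed.
Lemma cA_tW m h : tW (cA m h) = cA (tW m) (tW h).
Proof. by rewrite !cAE -A0_tW tWK tVK. Qed.
Lemma cC_tW m : cC (tW m) = do (x, h <- cC m) tW x ⊠ tW h.
Proof. by rewrite !cCE C0_tW. Qed.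
Lemma cCE2 m : cC m = do (x, h <- C0 m) tW x ⊠ tW h.
Proof. by rewrite cCE C0_tW. Qed.
Lemma cAA m g h : cA (cA m g) h = cA m (mul1 H g h).
Proof.
rewrite !cAE mul1E; congr (tV _); apply: (can_inj (@tWK _ _)); rewrite !A0_tW !tVK.
rewrite m0E !A0E !tWE. exact: (rmodA (yd_rmod s)).
Qed.
Lemma cA1 m : cA m (hone H) = m.
Proof. by rewrite cAE A0E (rmod1 (yd_rmod s)) -tWE tWK. Qed.
Lemma cCA m : (do (x, h <- cC m) x ⊠ D1 H h) =
  do (x, h <- cC m) do (y, g <- cC x) y ⊠ (g ⊠ h).
Proof.
rewrite cCE2; nrm. inn rewrite D1_tW; nrm. inn rewrite D1E2; nrm. inn rewrite C0_co.
inn rewrite tVK. symmetry; nrm. inn rewrite cC_tW; nrm. inn rewrite cCE2; nrm. fin.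
Qed.
Lemma cC1 m : (do (x, h <- cC m) e0 H h *: x) = m.
Proof. by rewrite cCE -[RHS]tWK !tVE sgF /C0 /e0 -!lock; exact: (rcom1 (yd_rcom s)). Qed.
Lemma cComp v h : (do (a, b <- D1 H h) do (x, g <- cC (cA v b)) x ⊠ mul1 H a g) =
    do (x, g <- cC v) do (a, b <- D1 H h) cA x a ⊠ mul1 H g b.
Proof.
(* The Hom-condition is used at alpha(h), whose Hom-coproduct is the untwisted coproduct of h. *)
transitivity (do (a, b <- D0 H (tW h)) do (x, g <- C0 (A0 v b)) x ⊠ tV (m0 H a g)).
  rewrite D1E. inn rewrite cAE. inn rewrite cCE. inn rewrite tVK. inn rewrite mul1E. fin.
transitivity (do (x, g <- C0 v) do (a, b <- D0 H (tW h)) A0 x (tV a) ⊠ m0 H g (tV b)).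
  by rewrite !sgF /C0 /A0 /D0 /m0 /tV /tV_def -!lock; exact/esym/(yd_compat s).
rewrite cCE2 -D1E; nrm. symmetry; nrm. inn rewrite cAE. inn rewrite mul1E.
inn rewrite A0_tV. inn rewrite m0_tV. inn rewrite !tWK. fin.
Qed.
Definition core_ydm : ydm_on HH V := @YdmOn _ _ HH _ cA cC cAA cA1 cCA cC1 cComp.
End YdCore.

Record tw_ydm (k : comPzRingType) (H : homHopf k) (X : hobj k) (c : ydm_on (core_hopf H) X) : Prop := TwYdm {
  twA : forall m h, tW (ya c m h) = ya c (tW m) (tW h);
  twC : forall m, yc c (tW m) = do (x, h <- yc c m) tW x ⊠ tW h
}.

Lemma core_ydm_tw (k : comPzRingType) (H : homHopf k) (M : hobj k) (s : yd_on H M) :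
  tw_ydm (core_ydm s).
Proof. by split; [exact: cA_tW | exact: cC_tW]. Qed.

Section BuildYd.
Variables (k : comPzRingType) (H : homHopf k) (X : hobj k) (c : ydm_on (core_hopf H) X).
Hypothesis ct : tw_ydm c.

Definition mA (m : X) (h : H) : X := tW (ya c m h).
Definition mC (m : X) : tens X H := yc c (tV m).

Lemma twC' m : yc c m = do (h, x <- yc c (tV m)) tW h ⊠ tW x.
Proof. by rewrite -{1}[m]tVK (twC ct). Qed.
Lemma twCV m : yc c (tV m) = do (h, x <- yc c m) tV h ⊠ tV x.
Proof. by rewrite (twC' m); symmetry; nrm; inn rewrite tWK; inn rewrite tWK; rewrite [LHS]sg_id. Qed.
Lemma mk_yd_rmod : is_rmodule (mA : X -> H -> X).
Proof.
split=> [|m h|m g h|m].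
- by rewrite /mA; mlin.
- by rewrite -!tWE /mA (twA ct).
- by rewrite -!tWE -m0E m0E' /mA -!(twA ct) [ya c _ _]yaA.
- by rewrite -tWE /mA ya1.
Qed.
Lemma mk_yd_rcom : is_rcomodule (H := H) mC.
Proof.
split=> [|m|m|m].
- by have : lin (fun m => yc c (tV m)) by mlin.
- rewrite -tWE; suff : mC (tW m) = do (h, x <- mC m) tW h ⊠ tW x.
    by rewrite sgF /tW /tW_def -!lock.
  by rewrite /mC tWK twC'.
- suff : (do (m0, h <- yc c (tV m)) (tV m0 ⊠ D0 H h)) =
    do (m0, h <- yc c (tV m)) do (m00, h' <- yc c (tV m0)) m00 ⊠ (h' ⊠ tV h).
    by rewrite /mC !sgF /tV /tV_def /D0 -!lock.
  move: (tV m) => {}m; inn rewrite D0E1. inn rewrite D1_tV; nrm. inn rewrite (yc_coassoc c).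
  symmetry. inn rewrite twCV; nrm. fin.
- have : (do (x, h <- yc c (tV m)) e0 H h *: x) = tV m by exact: (yc1 c).
  by rewrite /mC sgF /tV /tV_def /e0 -!lock.
Qed.
Lemma mk_yd_compat n h :
    \sw_(n0, n1 <- mC n) \sw_(h1, h2 <- hcomul h)
      (mA n0 (twV h1) ⊗ hmul n1 (twV h2)) =
    \sw_(h1, h2 <- hcomul h) \sw_(x0, x1 <- mC (mA n h2))
      (x0 ⊗ twV (hmul h1 x1)).
Proof.
suff : (do (x, g <- yc c (tV n)) do (a, b <- D0 H h) tW (ya c x (tV a)) ⊠ m0 H g (tV b)) =
    do (a, b <- D0 H h) do (x, g <- yc c (tV (tW (ya c n b)))) x ⊠ tV (m0 H a g).
  by rewrite /mC /mA !sgF /tW /tV /tW_def /tV_def /m0 /D0 -!lock.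
rewrite D0E1. inn rewrite (twA ct). inn rewrite m0E'. inn rewrite mul1_tW. inn rewrite !tVK.
symmetry. inn rewrite tWK. inn rewrite m0E'. inn rewrite tWK.
rewrite [LHS](ycomp c n (tV h)) [in LHS]twC'; nrm. reflexivity.
Qed.
Definition mk_yd : yd_on H X := YDOn mk_yd_rmod mk_yd_rcom mk_yd_compat.
Lemma core_mk_yd : core_ydm mk_yd = c.
Proof.
apply: ydm_eq => [m h|m].
- by rewrite [LHS]cAE A0E /= /mA tWK.
- by rewrite [LHS]cCE C0E /= /mC tWK.
Qed.
End BuildYd.

(** * The regular bimodule, underlying the unit object *)

Section Regular.
Variables (k : comPzRingType) (A : lmodType k) (H : hopf_on A).
Definition reg_bcv : bcv_on H A.
Proof.
refine (@BcvOn _ _ _ _ (mul H) (mul H) (cop H) (cop H) _ _ _ _ _ _ _ _ _ _ _ _ _ _).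
- exact: mulA.
- exact: mul1r'.
- by move=> *; rewrite mulA.
- exact: mulr1'.
- by move=> *; rewrite mulA.
- move=> m; symmetry; inn rewrite -coassoc. ctr (fun a b : A => a ⊠ b). inn rewrite sg_id.
  reflexivity.
- exact: cou_l.
- move=> m; symmetry; inn rewrite coassoc. ctr (fun a b : A => a ⊠ b). inn rewrite sg_id.
  reflexivity.
- exact: cou_r.
- exact: copM.
- exact: copM.
- exact: copM.
- exact: copM.
- exact: copA.
Defined.
End Regular.

(** * The two prebraided categories *)

Section HomCore.
Variables (k : comPzRingType) (H : homHopf k).
Local Notation HH := (core_hopf H).

Definition cst (M : bicov H) : bcv_on HH M := core_bcv (bicov_str M).
Definition cyd (V : yd H) : ydm_on HH V := core_ydm (yd_str V).
Lemma cst_tw (M : bicov H) : tw_bcv (cst M). Proof. exact: core_tw. Qed.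
Lemma cyd_tw (M : yd H) : tw_ydm (cyd M). Proof. exact: core_ydm_tw. Qed.

Lemma laE (M : bicov H) h (m : M) : la h m = tW (bL (cst M) h m).
Proof. by rewrite [bL _ _ _]cLE tVK L0E. Qed.
Lemma raE (M : bicov H) h (m : M) : ra m h = tW (bR (cst M) m h).
Proof. by rewrite [bR _ _ _]cRE tVK R0E. Qed.
Lemma lcE (M : bicov H) (m : M) : lc m = bl (cst M) (tV m).
Proof. by rewrite [bl _ _]clE tVK l0E. Qed.
Lemma rcE (M : bicov H) (m : M) : rc m = br (cst M) (tV m).
Proof. by rewrite [br _ _]crE tVK r0E. Qed.
Lemma yaE (V : yd H) h (m : V) : Defs.ya m h = tW (ya (cyd V) m h).
Proof. by rewrite [ya _ _ _]cAE tVK A0E. Qed.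
Lemma ycE (V : yd H) (m : V) : Defs.yc m = yc (cyd V) (tV m).
Proof. by rewrite [yc _ _]cCE tVK C0E. Qed.

Lemma is_bicov_homI (M N : bicov H) (f : lmap M N) : (forall m, f (tW m) = tW (f m)) ->
  bcv_hom (cst M) (cst N) f -> is_bicov_hom f.
Proof.
move=> ft [fL fR fl fr].
have fV m : f (tV m) = tV (f m) by rewrite -[f (tV m)]tWK -ft tVK.
split=> [|m|h m|m h|m|m].
- exact: (lmapP f).
- by rewrite -!tWE ft.
- by rewrite !laE ft fL.
- by rewrite !raE ft fR.
- by rewrite !lcE -fV fl sgF.
- by rewrite !rcE -fV fr sgF.
Qed.
Lemma is_bicov_homE (M N : bicov H) (f : lmap M N) : is_bicov_hom f ->
  (forall m, f (tW m) = tW (f m)) /\ bcv_hom (cst M) (cst N) f.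
Proof.
case=> _ ft fL fR fl fr.
have ft' m : f (tW m) = tW (f m) by rewrite !tWE ft.
split=> //; split=> [h m|m h|m|m].
- by apply: (can_inj (@tWK _ _)); rewrite -ft' -!laE fL.
- by apply: (can_inj (@tWK _ _)); rewrite -ft' -!raE fR.
- by have := fl (tW m); rewrite !lcE tWK ft' tWK sgF.
- by have := fr (tW m); rewrite !rcE tWK ft' tWK sgF.
Qed.
Lemma is_yd_homI (M N : yd H) (f : lmap M N) : (forall m, f (tW m) = tW (f m)) ->
  ydm_hom (cyd M) (cyd N) f -> is_yd_hom f.
Proof.
move=> ft [fR fr].
have fV m : f (tV m) = tV (f m) by rewrite -[f (tV m)]tWK -ft tVK.
split=> [|m|m h|m].
- exact: (lmapP f).
- by rewrite -!tWE ft.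
- by rewrite !yaE ft fR.
- by rewrite !ycE -fV fr sgF.
Qed.
Lemma is_yd_homE (M N : yd H) (f : lmap M N) : is_yd_hom f ->
  (forall m, f (tW m) = tW (f m)) /\ ydm_hom (cyd M) (cyd N) f.
Proof.
case=> _ ft fR fr.
have ft' m : f (tW m) = tW (f m) by rewrite !tWE ft.
split=> //; split=> [m h|m].
- by apply: (can_inj (@tWK _ _)); rewrite -ft' -!yaE fR.
- by have := fr (tW m); rewrite !ycE tWK ft' tWK sgF.
Qed.

Lemma transport_tw (X : hobj k) (c : bcv_on HH X) : tw_bcv c ->
  tw_bcv (transport_bcv (@tWK k X) (@tVK k X) c).
Proof.
case=> cL cR cl cr; split=> [h m|m h|m|m].
- by rewrite [bL _ _ _]trLE [bL (transport_bcv _ _ _) _ _]trLE -cL tWK tVK.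
- by rewrite [bR _ _ _]trRE [bR (transport_bcv _ _ _) _ _]trRE -cR tWK tVK.
- rewrite [bl _ _]trlE [bl (transport_bcv _ _ _) _]trlE cl; nrm. symmetry; nrm.
  by inn rewrite tVK; symmetry; inn rewrite tWK.
- rewrite [br _ _]trrE [br (transport_bcv _ _ _) _]trrE cr; nrm. symmetry; nrm.
  by inn rewrite tVK; symmetry; inn rewrite tWK.
Qed.
Lemma transport_ydm_tw (X : hobj k) (c : ydm_on HH X) : tw_ydm c ->
  tw_ydm (transport_ydm (@tWK k X) (@tVK k X) c).
Proof.
case=> cR cr; split=> [m h|m].
- by rewrite [ya _ _ _]trAE [ya (transport_ydm _ _ _) _ _]trAE -cR tWK tVK.
- rewrite [yc _ _]trCE [yc (transport_ydm _ _ _) _]trCE cr; nrm. symmetry; nrm.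
  by inn rewrite tVK; symmetry; inn rewrite tWK.
Qed.

Section Tensor.
Variables M N : bicov H.
(** In untwisted terms the Hom-product mh is mu(m)·alpha(h) and h nu^-1(n) is alpha(h)·n. Hence the
    Hom-relation at (m, h, n) is the ordinary one at (mu(m), alpha(h), n), and the twists are
    bijective. *)
Lemma balP : is_bal (cst M) (cst N) (balanced (M := M) (N := N)).
Proof.
move=> t; split=> [[m [h [n ->]]]|[m [h [n ->]]]].
- exists (tW m), (tW h), n; congr (_ ⊗ _ - _ ⊗ _).
  + by rewrite -(twR (cst_tw M)) -raE.
  + by rewrite tWE.
  + by rewrite laE (twL (cst_tw N)) -tVE tVK.
- exists (tV m), (tV h), n; congr (_ ⊗ _ - _ ⊗ _).
  + by rewrite raE (twR (cst_tw M)) !tVK.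
  + by rewrite -tWE tVK.
  + by rewrite laE (twL (cst_tw N)) -tVE !tVK.
Qed.
Definition pH : bmap M N (htensH M N) := pt (balanced (M := M) (N := N)).
Lemma pHE m n : pH m n = m ⊗_H n.
Proof. exact: ptE. Qed.
Lemma pH_tW m n : tW (pH m n) = pH (tW m) (tW n).
Proof. by rewrite !pHE !tWE; exact: tensH_twE. Qed.
Lemma pH_tV m n : tV (pH m n) = pH (tV m) (tV n).
Proof. by rewrite !pHE !tVE; exact: tensH_twVE. Qed.
Definition T0 : bcv_on HH (htensH M N) := tensor_bcv balP.
Lemma pH_ext (P : lmodType k) (f g : htensH M N -> P) : lin f -> lin g ->
  (forall m n, f (pH m n) = g (pH m n)) -> forall t, f t = g t.
Proof. exact: HT_ext. Qed.
Lemma T0L h m n : bL T0 h (pH m n) = pH (bL (cst M) h m) n.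
Proof. exact: tLE. Qed.
Lemma T0R h m n : bR T0 (pH m n) h = pH m (bR (cst N) n h).
Proof. exact: tRE. Qed.
Lemma T0l m n : bl T0 (pH m n) =
  do (a, x <- bl (cst M) m) do (b, y <- bl (cst N) n) mul1 H a b ⊠ pH x y.
Proof. exact: tlE. Qed.
Lemma T0r m n : br T0 (pH m n) =
  do (x, a <- br (cst M) m) do (y, b <- br (cst N) n) pH x y ⊠ mul1 H a b.
Proof. exact: trE. Qed.
Lemma T0_tw : tw_bcv T0.
Proof.
have [ML MR Ml Mr] := cst_tw M; have [NL NR Nl Nr] := cst_tw N.
split=> [h t|t h|t|t]; move: t; (apply: pH_ext; [mlin|mlin|move=> m n]).
- by rewrite T0L !pH_tW T0L ML.
- by rewrite T0R !pH_tW T0R NR.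
- rewrite pH_tW !T0l Ml Nl; nrm. symmetry; nrm.
  by inn rewrite mul1_tW; inn rewrite pH_tW; fin.
- rewrite pH_tW !T0r Mr Nr; nrm. symmetry; nrm.
  by inn rewrite mul1_tW; inn rewrite pH_tW; fin.
Qed.
(** Without the transport the Hom-action would come out as hm ⊗ nu(n) instead of the prescribed
    alpha^-1(h)m ⊗ nu(n). *)
Definition tens_str : bicov_on H (htensH M N) := mk_bicov (transport_tw T0_tw).
End Tensor.

Definition TB (M N : bicov H) : bicov H := Bicov (tens_str M N).
Lemma cst_TB (M N : bicov H) : cst (TB M N) = transport_bcv (@tWK k _) (@tVK k _) (T0 M N).
Proof. exact: core_mk. Qed.

Section TensorFormulas.
Variables M N : bicov H.
Local Notation PH m n := (pH M N m n : TB M N).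
Lemma tW_TB m n : tW (PH m n) = PH (tW m) (tW n). Proof. exact: pH_tW. Qed.
Lemma tV_TB m n : tV (PH m n) = PH (tV m) (tV n). Proof. exact: pH_tV. Qed.
Lemma TBL h m n : bL (cst (TB M N)) h (PH m n) = PH (bL (cst M) (tV h) m) n.
Proof. by rewrite cst_TB [LHS]trLE pH_tW T0L pH_tV -{1}[h]tVK -(twL (cst_tw M)) !tWK. Qed.
Lemma TBR h m n : bR (cst (TB M N)) (PH m n) h = PH m (bR (cst N) n (tV h)).
Proof. by rewrite cst_TB [LHS]trRE pH_tW T0R pH_tV -{1}[h]tVK -(twR (cst_tw N)) !tWK. Qed.
Lemma TBl m n : bl (cst (TB M N)) (PH m n) =
  do (a, x <- bl (cst M) m) do (b, y <- bl (cst N) n) tW (mul1 H a b) ⊠ PH x y.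
Proof.
rewrite cst_TB [LHS]trlE pH_tW T0l (twl (cst_tw M)) (twl (cst_tw N)); nrm.
inn rewrite pH_tV. inn rewrite -mul1_tW. inn rewrite tWK. inn rewrite tWK. reflexivity.
Qed.
Lemma TBr m n : br (cst (TB M N)) (PH m n) =
  do (x, a <- br (cst M) m) do (y, b <- br (cst N) n) PH x y ⊠ tW (mul1 H a b).
Proof.
rewrite cst_TB [LHS]trrE pH_tW T0r (twr (cst_tw M)) (twr (cst_tw N)); nrm.
inn rewrite pH_tV. inn rewrite -mul1_tW. inn rewrite tWK. inn rewrite tWK. reflexivity.
Qed.
End TensorFormulas.

Section TensorSpec.
Variables M N : bicov H.
Lemma tens_la h m n : lact (tens_str M N) h (m ⊗_H n) = la (twV h) m ⊗_H tw n.
Proof.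
rewrite -[LHS]/(la (M := TB M N) h _) laE -!pHE TBL [LHS]tW_TB laE -tVE -tWE.
by [].
Qed.
Lemma tens_ra m n h : ract (tens_str M N) (m ⊗_H n) h = tw m ⊗_H ra n (twV h).
Proof.
by rewrite -[LHS]/(ra (M := TB M N) _ h) raE -!pHE TBR [LHS]tW_TB raE -tVE -tWE.
Qed.
Lemma tens_lc m n : lco (tens_str M N) (m ⊗_H n) =
    \sw_(m1, m0 <- lc m) \sw_(n1, n0 <- lc n) (hmul m1 n1 ⊗ (m0 ⊗_H n0)).
Proof.
rewrite -[LHS]/(lc (M := TB M N) _) lcE -!pHE [tV _]tV_TB TBl -!lcE.
by inn rewrite -m0E'; inn rewrite m0E; inn rewrite pHE; rewrite !sgF.
Qed.
Lemma tens_rc m n : rco (tens_str M N) (m ⊗_H n) =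
    \sw_(m0, m1 <- rc m) \sw_(n0, n1 <- rc n) ((m0 ⊗_H n0) ⊗ hmul m1 n1).
Proof.
rewrite -[LHS]/(rc (M := TB M N) _) rcE -!pHE [tV _]tV_TB TBr -!rcE.
by inn rewrite -m0E'; inn rewrite m0E; inn rewrite pHE; rewrite !sgF.
Qed.
End TensorSpec.

Lemma unit_tw : tw_bcv (reg_bcv HH : bcv_on HH H).
Proof.
split; [exact: mul1_tW|exact: mul1_tW|exact: D1_tW|exact: D1_tW].
Qed.
Definition unit_str : bicov_on H H := mk_bicov unit_tw.
Definition IB : bicov H := Bicov unit_str.
Lemma cst_IB : cst IB = reg_bcv HH. Proof. exact: core_mk. Qed.
Lemma unit_la : lact unit_str = hmul.
Proof.
by apply/funext => a; apply/funext => b; rewrite -[LHS]/(tW (mul1 H a b)) -m0E' m0E.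
Qed.
Lemma unit_ra : ract unit_str = hmul.
Proof.
by apply/funext => a; apply/funext => b; rewrite -[LHS]/(tW (mul1 H a b)) -m0E' m0E.
Qed.
Lemma unit_lc : lco unit_str = hcomul.
Proof. by apply/funext => a; rewrite -[LHS]/(D1 H (tV a)) -D0E1 D0E. Qed.
Lemma unit_rc : rco unit_str = hcomul.
Proof. by apply/funext => a; rewrite -[LHS]/(D1 H (tV a)) -D0E1 D0E. Qed.
End HomCore.

Section BraidFormula.
Variables (k : comPzRingType) (A : lmodType k) (H : hopf_on A).
Variables (M N : lmodType k) (B : bcv_on H M) (C : bcv_on H N).
Variables (R' : TT N M -> Prop).
Hypotheses (HR' : is_bal C B R').
(* Turns the factor P_R(n_[0]) of the braiding into n_[0]: the antipode moves
   across the balanced tensor product. *)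
Lemma braid_formula h n y :
  (do (z, g <- br C n) do (w, q <- br C z) pt R' (bL C h (bR C w (ant H q))) (bR B (pl B y) g)) =
  do (z, g <- br C n) pt R' (bL C h z) (pl B (bR B y g)).
Proof.
inn rewrite -br_coassoc. inn rewrite -bLR. inn rewrite (pt_bal HR').
ctr (fun a b : A => bL B (ant H a) (bR B (pl B y) b)). inn rewrite pl_adj. inn rewrite pl_R. fin.
Qed.
End BraidFormula.

Section TensorMap.
Variables (k : comPzRingType) (A : lmodType k) (H : hopf_on A).
Variables (M N M' N' : lmodType k) (B : bcv_on H M) (C : bcv_on H N).
Variables (B' : bcv_on H M') (C' : bcv_on H N').
Variables (R : TT M N -> Prop) (R' : TT M' N' -> Prop).
Hypotheses (HR : is_bal B C R) (HR' : is_bal B' C' R').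
Variables (f : lmap M M') (g : lmap N N').
Hypotheses (fH : bcv_hom B B' f) (gH : bcv_hom C C' g).

Lemma tm_bal : bal B C (fun m n => pt R' (f m) (g n)).
Proof. by move=> m h n; rewrite (hR fH) (hL gH) (pt_bal HR'). Qed.
Lemma tm_lin : lin (fun x : HT R => sh x (fun m n => pt R' (f m) (g n))).
Proof. have ? := HR; have ? := tm_bal; mlin. Qed.
Definition tm := locked (Lmap tm_lin).
Lemma tmE m n : tm (pt R m n) = pt R' (f m) (g n).
Proof. rewrite /tm -lock; apply: (sh_pt HR); [mlin | exact: tm_bal]. Qed.
Lemma tm_hom : bcv_hom (tensor_bcv HR) (tensor_bcv HR') tm.
Proof.
split=> [h t|t h|t|t]; move: t; (apply: HT_ext; [mlin|mlin|move=> m n]).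
- by rewrite tensorLE !tmE tensorLE (hL fH).
- by rewrite tensorRE !tmE tensorRE (hR gH).
- rewrite tensorlE !tmE tensorlE (hl fH) (hl gH); nrm. symmetry; nrm.
  inn rewrite tmE. fin.
- rewrite tensorrE !tmE tensorrE (hr fH) (hr gH); nrm. symmetry; nrm.
  inn rewrite tmE. fin.
Qed.
End TensorMap.

Section HomInv.
Variables (k : comPzRingType) (A : lmodType k) (H : hopf_on A).
Variables (M N : lmodType k) (f : lmap M N) (g : lmap N M).
Hypotheses (fK : cancel f g) (gK : cancel g f).
Lemma bcv_hom_inv (B : bcv_on H M) (C : bcv_on H N) : bcv_hom B C f -> bcv_hom C B g.
Proof.
case=> fL fR fl fr; split=> [h m|m h|m|m].
- by apply: (can_inj fK); rewrite gK fL gK.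
- by apply: (can_inj fK); rewrite gK fR gK.
- rewrite -{2}[m]gK fl; symmetry; nrm. inn rewrite fK. by rewrite [LHS]sg_id.
- rewrite -{2}[m]gK fr; symmetry; nrm. inn rewrite fK. by rewrite [LHS]sg_id.
Qed.
Lemma ydm_hom_inv (B : ydm_on H M) (C : ydm_on H N) : ydm_hom B C f -> ydm_hom C B g.
Proof.
case=> fR fr; split=> [m h|m].
- by apply: (can_inj fK); rewrite gK fR gK.
- rewrite -{2}[m]gK fr; symmetry; nrm. inn rewrite fK. by rewrite [LHS]sg_id.
Qed.
End HomInv.

Arguments balP {k H} M N t.

(** * The prebraided category of bicovariant Hom-bimodules *)

Section BicovMorphisms.
Variables (k : comPzRingType) (H : homHopf k).
Local Notation HH := (core_hopf H).
Local Notation "x ∙ y" := (mul1 H x y) (at level 40, left associativity).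

Definition bhl (M N : bicov H) (f : bicov_hom M N) : lmap M N := Lmap (bh_linear (bh_ax f) : lin f).
Lemma bhl_tW (M N : bicov H) (f : bicov_hom M N) m : bhl f (tW m) = tW (bhl f m).
Proof. exact: (is_bicov_homE (f := bhl f) (bh_ax f)).1. Qed.
Lemma bhl_hom (M N : bicov H) (f : bicov_hom M N) : bcv_hom (cst M) (cst N) (bhl f).
Proof. exact: (is_bicov_homE (f := bhl f) (bh_ax f)).2. Qed.

Definition mkbh (M N : bicov H) (f : lmap M N) (ft : forall m, f (tW m) = tW (f m))
  (fh : bcv_hom (cst M) (cst N) f) : bicov_hom M N := BicovHom (is_bicov_homI ft fh).

Section Inv.
Variables (M N : bicov H) (f : bicov_hom M N) (g : lmap N M).
Hypotheses (fK : cancel f g) (gK : cancel g f).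
Lemma inv_tW m : g (tW m) = tW (g m).
Proof. by apply: (can_inj fK); rewrite gK -[RHS]/(bhl f _) bhl_tW /= gK. Qed.
Definition bh_inv : bicov_hom N M :=
  mkbh inv_tW (bcv_hom_inv (f := bhl f) fK gK (bhl_hom f)).
Lemma bh_iso : is_iso (C := bicov_cat H) f.
Proof. by exists bh_inv; split; apply: bicov_hom_eq => x /=; rewrite ?fK ?gK. Qed.
End Inv.

Section Tmap.
Variables (M M' N N' : bicov H) (f : bicov_hom M M') (g : bicov_hom N N').
Definition tmap_l : lmap (TB M N) (TB M' N') :=
  tm (balP M N) (balP M' N') (bhl_hom f) (bhl_hom g).
Lemma tmap_lE m n : tmap_l (pH M N m n) = pH M' N' (f m) (g n).
Proof. exact: tmE. Qed.
Lemma tmap_tW t : tmap_l (tW t) = tW (tmap_l t).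
Proof.
move: t; apply: pH_ext; [mlin|mlin|move=> m n].
by rewrite pH_tW !tmap_lE [RHS]pH_tW -!bhl_tW.
Qed.
Lemma tmap_hom : bcv_hom (cst (TB M N)) (cst (TB M' N')) tmap_l.
Proof.
by rewrite !cst_TB; apply: transport_bcv_hom; [exact: tmap_tW | exact: tm_hom].
Qed.
Definition tmap_bh : bicov_hom (TB M N) (TB M' N') := mkbh tmap_tW tmap_hom.
End Tmap.

Section Assoc.
Variables M N P : bicov H.
(** The associator descends to the balanced products in two stages: first in m and n for fixed [p],
    then, by [as_bal2], as a pairing of M ⊗_H N with P. *)
Lemma as_bal1 p : bal (cst M) (cst N) (fun m n => pH M (TB N P) (tW m) (pH N P n (tV p))).
Proof.
move=> m h n; rewrite (twR (cst_tw M)) [LHS](pt_bal (balP M (TB N P))).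
by rewrite TBL tWK.
Qed.
Definition as_fun (y : TB M N) (p : P) : TB M (TB N P) :=
  sh y (fun m n => pH M (TB N P) (tW m) (pH N P n (tV p))).
Lemma as_bilin : bilin as_fun.
Proof. have ? := balP M N; have ? := as_bal1; rewrite /as_fun; mlin. Qed.
Lemma as_funE m n p : as_fun (pH M N m n) p = pH M (TB N P) (tW m) (pH N P n (tV p)).
Proof. apply: (sh_pt (balP M N)); [mlin | exact: as_bal1]. Qed.
Lemma as_bal2 : bal (cst (TB M N)) (cst P) as_fun.
Proof.
move=> y h p. have ? := as_bilin. move: y; apply: pH_ext; [mlin|mlin|move=> m n].
rewrite TBR !as_funE; congr (pH _ _ _ _).
rewrite [LHS](pt_bal (balP N P)); congr (pH _ _ _ _).
by apply: (can_inj (@tWK _ _)); rewrite (twL (cst_tw P)) !tVK.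
Qed.
Lemma as_lin : lin (fun x : TB (TB M N) P => sh x as_fun).
Proof. have ? := balP (TB M N) P; have ? := as_bal2; have ? := as_bilin; mlin. Qed.
Definition as_l := locked (Lmap as_lin).
Lemma as_lE m n p : as_l (pH (TB M N) P (pH M N m n) p) = pH M (TB N P) (tW m) (pH N P n (tV p)).
Proof.
rewrite /as_l -lock; apply: etrans (as_funE _ _ _).
by apply: (sh_pt (balP (TB M N) P)); [exact: as_bilin | exact: as_bal2].
Qed.
End Assoc.

Lemma pH_ext3 (M N P : bicov H) (X : lmodType k) (f g : TB (TB M N) P -> X) : lin f -> lin g ->
  (forall m n p, f (pH (TB M N) P (pH M N m n) p) = g (pH (TB M N) P (pH M N m n) p)) ->
  forall t, f t = g t.
Proof.
move=> fL gL fg; apply: pH_ext => // y p; move: y; apply: pH_ext => [||m n]; [mlin|mlin|exact: fg].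
Qed.
Lemma pH_ext3' (M N P : bicov H) (X : lmodType k) (f g : TB M (TB N P) -> X) : lin f -> lin g ->
  (forall m n p, f (pH M (TB N P) m (pH N P n p)) = g (pH M (TB N P) m (pH N P n p))) ->
  forall t, f t = g t.
Proof.
move=> fL gL fg; apply: pH_ext => // m y; move: y; apply: pH_ext => [||n p]; [mlin|mlin|exact: fg].
Qed.

Lemma twLV (M : bicov H) h m : tV (bL (cst M) h m) = bL (cst M) (tV h) (tV m).
Proof. by apply: (can_inj (@tWK _ _)); rewrite (twL (cst_tw M)) !tVK. Qed.
Lemma twRV (M : bicov H) h m : tV (bR (cst M) m h) = bR (cst M) (tV m) (tV h).
Proof. by apply: (can_inj (@tWK _ _)); rewrite (twR (cst_tw M)) !tVK. Qed.

Section AssocHom.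
Variables M N P : bicov H.
Local Notation as_l := (as_l M N P).
Lemma as_tW t : as_l (tW t) = tW (as_l t).
Proof.
move: t; apply: pH_ext3; [mlin|mlin|move=> m n p].
by rewrite !tW_TB !as_lE !tW_TB tWK tVK.
Qed.
Lemma as_hom : bcv_hom (cst (TB (TB M N) P)) (cst (TB M (TB N P))) as_l.
Proof.
split=> [h t|t h|t|t]; move: t; (apply: pH_ext3; [mlin|mlin|move=> m n p]).
- by rewrite !TBL !as_lE TBL (twL (cst_tw M)) tVK.
- by rewrite TBR !as_lE TBR TBR twRV.
- rewrite as_lE !TBl; nrm. rewrite (twl (cst_tw M)) (twlV (cst_tw P)); nrm. symmetry; nrm.
  inn rewrite as_lE. fin; congr (_ ⊠ _). by rewrite !mul1_tW tVK mul1A.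
- rewrite as_lE !TBr; nrm. rewrite (twr (cst_tw M)) (twrV (cst_tw P)); nrm. symmetry; nrm.
  inn rewrite as_lE. fin; congr (_ ⊠ _). by rewrite !mul1_tW tVK mul1A.
Qed.
Definition as_bh : bicov_hom (TB (TB M N) P) (TB M (TB N P)) := mkbh as_tW as_hom.

Lemma av_bal1 m : bal (cst N) (cst P) (fun n p => pH (TB M N) P (pH M N (tV m) n) (tW p)).
Proof.
move=> n h p; rewrite (twL (cst_tw P)) -[RHS](pt_bal (balP (TB M N) P)).
by rewrite TBR tWK.
Qed.
Definition av_fun (m : M) (y : TB N P) : TB (TB M N) P :=
  sh y (fun n p => pH (TB M N) P (pH M N (tV m) n) (tW p)).
Lemma av_bilin : bilin av_fun.
Proof. have ? := balP N P; have ? := av_bal1; rewrite /av_fun; mlin. Qed.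
Lemma av_funE m n p : av_fun m (pH N P n p) = pH (TB M N) P (pH M N (tV m) n) (tW p).
Proof. apply: (sh_pt (balP N P)); [mlin | exact: av_bal1]. Qed.
Lemma av_bal2 : bal (cst M) (cst (TB N P)) av_fun.
Proof.
move=> m h y. have ? := av_bilin. move: y; apply: pH_ext; [mlin|mlin|move=> n p].
rewrite TBL !av_funE; congr (pH _ _ _ _).
by rewrite twRV [LHS](pt_bal (balP M N)).
Qed.
Lemma av_lin : lin (fun x : TB M (TB N P) => sh x av_fun).
Proof. have ? := balP M (TB N P); have ? := av_bal2; have ? := av_bilin; mlin. Qed.
Definition av_l := locked (Lmap av_lin).
Lemma av_lE m n p : av_l (pH M (TB N P) m (pH N P n p)) = pH (TB M N) P (pH M N (tV m) n) (tW p).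
Proof.
rewrite /av_l -lock; apply: etrans (av_funE _ _ _).
by apply: (sh_pt (balP M (TB N P))); [exact: av_bilin | exact: av_bal2].
Qed.
Lemma as_lK : cancel as_l av_l.
Proof.
by move=> t; move: t; apply: pH_ext3; [mlin|mlin|move=> m n p]; rewrite as_lE av_lE tWK tVK.
Qed.
Lemma av_lK : cancel av_l as_l.
Proof.
by move=> t; move: t; apply: pH_ext3'; [mlin|mlin|move=> m n p]; rewrite av_lE as_lE tWK tVK.
Qed.
Definition av_bh : bicov_hom (TB M (TB N P)) (TB (TB M N) P) := bh_inv (f := as_bh) as_lK av_lK.
End AssocHom.

Section UnitHom.
Variable M : bicov H.
Lemma lu_bal : bal (cst (IB H)) (cst M) (fun h m => tW (bL (cst M) h m)).
Proof. by rewrite cst_IB => h g m; rewrite bLA. Qed.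
Lemma lu_lin : lin (fun x : TB (IB H) M => sh x (fun h m => tW (bL (cst M) h m))).
Proof. have ? := balP (IB H) M; have ? := lu_bal; mlin. Qed.
Definition lu_l := locked (Lmap lu_lin).
Lemma lu_lE h m : lu_l (pH (IB H) M h m) = tW (bL (cst M) h m).
Proof. rewrite /lu_l -lock; apply: (sh_pt (balP (IB H) M)); [mlin | exact: lu_bal]. Qed.
Lemma lu_tW t : lu_l (tW t) = tW (lu_l t).
Proof.
move: t; apply: pH_ext; [mlin|mlin|move=> h m].
by rewrite tW_TB !lu_lE; congr (tW _); rewrite (twL (cst_tw M)).
Qed.
Lemma lu_hom : bcv_hom (cst (TB (IB H) M)) (cst M) lu_l.
Proof.
split=> [g t|t g|t|t]; move: t; (apply: pH_ext; [mlin|mlin|move=> h m]).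
- by rewrite TBL !lu_lE cst_IB (twL (cst_tw M)) [in RHS](twL (cst_tw M)) bLA [in LHS]mul1_tW tVK.
- by rewrite TBR !lu_lE !(twL (cst_tw M)) bLR (twR (cst_tw M)) tVK.
- rewrite lu_lE (twl (cst_tw M)) blL; nrm. symmetry. rewrite TBl; nrm. inn rewrite lu_lE.
  rewrite cst_IB; nrm. fin.
- rewrite lu_lE (twr (cst_tw M)) brL; nrm. symmetry. rewrite TBr; nrm. inn rewrite lu_lE.
  rewrite cst_IB; nrm. fin.
Qed.
Definition lu_bh : bicov_hom (TB (IB H) M) M := mkbh lu_tW lu_hom.
Lemma luV_lin : lin (fun m => pH (IB H) M (hone H) (tV m)). Proof. mlin. Qed.
Definition luV := locked (Lmap luV_lin).
Lemma luVE m : luV m = pH (IB H) M (hone H) (tV m). Proof. by rewrite /luV -lock. Qed.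
Lemma lu_lK : cancel lu_l luV.
Proof.
move=> t; move: t; apply: pH_ext; [mlin|mlin|move=> h m].
rewrite lu_lE luVE tWK -[LHS](pt_bal (balP (IB H) M)) cst_IB; congr (pH _ _ _ _).
exact: mul1r_1.
Qed.
Lemma luVK : cancel luV lu_l.
Proof. by move=> m; rewrite luVE lu_lE bL1 tVK. Qed.

Lemma ru_bal : bal (cst M) (cst (IB H)) (fun m h => tW (bR (cst M) m h)).
Proof. by rewrite cst_IB => m g h; rewrite bRA. Qed.
Lemma ru_lin : lin (fun x : TB M (IB H) => sh x (fun m h => tW (bR (cst M) m h))).
Proof. have ? := balP M (IB H); have ? := ru_bal; mlin. Qed.
Definition ru_l := locked (Lmap ru_lin).
Lemma ru_lE m h : ru_l (pH M (IB H) m h) = tW (bR (cst M) m h).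
Proof. rewrite /ru_l -lock; apply: (sh_pt (balP M (IB H))); [mlin | exact: ru_bal]. Qed.
Lemma ru_tW t : ru_l (tW t) = tW (ru_l t).
Proof.
move: t; apply: pH_ext; [mlin|mlin|move=> m h].
by rewrite tW_TB !ru_lE; congr (tW _); rewrite (twR (cst_tw M)).
Qed.
Lemma ru_hom : bcv_hom (cst (TB M (IB H))) (cst M) ru_l.
Proof.
split=> [g t|t g|t|t]; move: t; (apply: pH_ext; [mlin|mlin|move=> m h]).
- by rewrite TBL !ru_lE !(twR (cst_tw M)) -bLR (twL (cst_tw M)) tVK.
- by rewrite TBR !ru_lE cst_IB (twR (cst_tw M)) [in RHS](twR (cst_tw M)) bRA [in LHS]mul1_tW tVK.
- rewrite ru_lE (twl (cst_tw M)) blR; nrm. symmetry. rewrite TBl; nrm. inn rewrite ru_lE.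
  rewrite cst_IB; nrm. fin.
- rewrite ru_lE (twr (cst_tw M)) brR; nrm. symmetry. rewrite TBr; nrm. inn rewrite ru_lE.
  rewrite cst_IB; nrm. fin.
Qed.
Definition ru_bh : bicov_hom (TB M (IB H)) M := mkbh ru_tW ru_hom.
Lemma ruV_lin : lin (fun m => pH M (IB H) (tV m) (hone H)). Proof. mlin. Qed.
Definition ruV := locked (Lmap ruV_lin).
Lemma ruVE m : ruV m = pH M (IB H) (tV m) (hone H). Proof. by rewrite /ruV -lock. Qed.
Lemma ru_lK : cancel ru_l ruV.
Proof.
move=> t; move: t; apply: pH_ext; [mlin|mlin|move=> m h].
rewrite ru_lE ruVE tWK [LHS](pt_bal (balP M (IB H))) cst_IB; congr (pH _ _ _ _).
exact: mulr1_1.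
Qed.
Lemma ruVK : cancel ruV ru_l.
Proof. by move=> m; rewrite ruVE ru_lE bR1 tVK. Qed.
End UnitHom.

Section BraidHom.
Variables M N : bicov H.
Definition br_l : lmap (TB M N) (TB N M) :=
  brd (balanced (M := N) (N := M)) (balP M N).
Lemma br_lE m n : br_l (pH M N m n) = do (h, y <- bl (cst M) m) do (z, g <- br (cst N) n)
  pH N M (bL (cst N) h z) (pl (cst M) (bR (cst M) y g)).
Proof. exact: brdE. Qed.
Lemma ant_tW h : ant HH (tW h) = tW (ant HH h).
Proof. by rewrite -[LHS]/(S0 H _) -[ant HH h]/(S0 H h) !S0E !tWE antipode_tw. Qed.
Lemma pl_tW (P : bicov H) m : tW (pl (cst P) m) = pl (cst P) (tW m).
Proof.
rewrite !plE (twl (cst_tw P)); nrm. inn rewrite (twL (cst_tw P)). symmetry; nrm.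
inn rewrite ant_tW. fin.
Qed.
Lemma pl_tV (P : bicov H) m : tV (pl (cst P) m) = pl (cst P) (tV m).
Proof. by apply: (can_inj (@tWK _ _)); rewrite pl_tW !tVK. Qed.
Lemma br_tW t : br_l (tW t) = tW (br_l t).
Proof.
move: t; apply: pH_ext; [mlin|mlin|move=> m n].
rewrite tW_TB !br_lE (twl (cst_tw M)) (twr (cst_tw N)); nrm. symmetry; nrm.
inn rewrite tW_TB. inn rewrite (twL (cst_tw N)). inn rewrite pl_tW. inn rewrite (twR (cst_tw M)).
fin.
Qed.
Lemma br_hom : bcv_hom (cst (TB M N)) (cst (TB N M)) br_l.
Proof. by rewrite !cst_TB; apply: transport_bcv_hom; [exact: br_tW | exact: brd_hom]. Qed.
Definition br_bh : bicov_hom (TB M N) (TB N M) := mkbh br_tW br_hom.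
(** The inverse twist in the Hom-coaction cancels the twist in the Hom-action, because S commutes
    with the twist; so the Hom-projection is the ordinary one. *)
Lemma PLE (P : bicov H) (m : P) : PL m = pl (cst P) m.
Proof.
rewrite /PL -sgF lcE (twlV (cst_tw P)). inn rewrite laE. inn rewrite -S0E. nrm.
inn rewrite (twL (cst_tw P)). rewrite plE; inn rewrite tVK. inn rewrite -[tW _]ant_tW.
inn rewrite tVK. fin.
Qed.
Lemma pr_lin (P : bicov H) : lin (fun m : P => do (x, h <- br (cst P) m) bR (cst P) x (ant HH h)).
Proof. mlin. Qed.
Definition pr (P : bicov H) := locked (Lmap (@pr_lin P)).
Lemma prE (P : bicov H) (m : P) : pr P m = do (x, h <- br (cst P) m) bR (cst P) x (ant HH h).
Proof. by rewrite /pr -lock. Qed.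
Lemma pr_tW (P : bicov H) m : tW (pr P m) = pr P (tW m).
Proof.
rewrite !prE (twr (cst_tw P)); nrm. inn rewrite (twR (cst_tw P)). symmetry; nrm.
inn rewrite ant_tW. fin.
Qed.
Lemma PRE (P : bicov H) (m : P) : PR m = pr P m.
Proof.
rewrite prE.
rewrite /PR -sgF rcE (twrV (cst_tw P)). inn rewrite raE. inn rewrite -S0E. nrm.
inn rewrite (twR (cst_tw P)). inn rewrite tVK. inn rewrite -[tW _]ant_tW. inn rewrite tVK. fin.
Qed.
Lemma br_spec m n : br_l (m ⊗_H n) =
  \sw_(m1, m0 <- lc m) \sw_(n0, n1 <- rc n) (la m1 (PR n0) ⊗_H ra (PL m0) n1).
Proof.
rewrite -pHE br_lE -!sgF. symmetry. rewrite lcE rcE (twlV (cst_tw M)) (twrV (cst_tw N)).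
inn rewrite PRE. inn rewrite PLE. inn rewrite laE. inn rewrite raE. inn rewrite -pHE. nrm.
inn rewrite (twL (cst_tw N)). inn rewrite (twR (cst_tw M)). inn rewrite pr_tW. inn rewrite pl_tW.
inn rewrite tVK. inn rewrite tVK. inn rewrite tVK. inn rewrite tVK. inn rewrite prE; nrm.
inn rewrite (braid_formula (balP N M)). fin.
Qed.
End BraidHom.

Lemma mulr1H a : a ∙ one HH = a. Proof. exact: mulr1_1. Qed.
Lemma mul1rH a : one HH ∙ a = a. Proof. exact: mul1r_1. Qed.

Lemma bRA1 (M : bicov H) m g h : bR (cst M) (bR (cst M) m g) h = bR (cst M) m (g ∙ h).
Proof. exact: bRA. Qed.
Lemma bLA1 (M : bicov H) m g h : bL (cst M) g (bL (cst M) h m) = bL (cst M) (g ∙ h) m.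
Proof. exact: bLA. Qed.
Definition idb (M : bicov H) : bicov_hom M M := BicovHom (bicov_id_ax M).

Section BraidAxioms.
Variables A B D : bicov H.
(** Write n = n_(-1) P_L(n_(0)) and move n_(-1) across the balanced tensor product. The remaining
    right factor is coinvariant, so the left coaction of the product sees only m n_(-1). *)
Lemma pl_TB (m : A) (n : B) : pl (cst (TB A B)) (pH A B m n) =
  do (c, x <- bl (cst B) n) pH A B (pl (cst A) (bR (cst A) m c)) (pl (cst B) x).
Proof.
rewrite -{1}(recon (cst B) n); nrm. inn rewrite -(pt_bal (balP A B)).
apply: eq_sg => c x. rewrite plE TBl pl_coinv; nrm. inn rewrite ant_tW.
inn rewrite TBL. inn rewrite tWK. inn rewrite mulr1H.
ctr (fun (h : H) (a : A) => bL (cst A) (ant HH h) a). by rewrite -plE.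
Qed.

Lemma tmap_brl m d : tmap_l (br_bh A B) (idb D) (pH (TB A B) D m d) = pH (TB B A) D (br_l A B m) d.
Proof. exact: tmap_lE. Qed.
Lemma tmap_brr b m : tmap_l (idb B) (br_bh A D) (pH B (TB A D) b m) = pH B (TB D A) b (br_l A D m).
Proof. exact: tmap_lE. Qed.

(** After the first braiding the A-factor lies in the image of P_L. Its left coaction in the second
    braiding is therefore trivial, and [pl_R] removes the inner projection. *)
Lemma hexagon1_l t : as_l B D A (br_l A (TB B D) (as_l A B D t)) =
  tmap_l (idb B) (br_bh A D) (as_l B A D (tmap_l (br_bh A B) (idb D) t)).
Proof.
move: t; apply: pH_ext3; [mlin|mlin|move=> a b d].
rewrite as_lE br_lE (twl (cst_tw A)) TBr (twrV (cst_tw D)); nrm.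
inn rewrite TBL. inn rewrite as_lE. inn rewrite (twL (cst_tw B)). inn rewrite tVK.
inn rewrite pl_tV. inn rewrite twRV. inn rewrite tWK. inn rewrite tWK. inn rewrite -bRA1.
symmetry. rewrite tmap_brl br_lE; nrm. inn rewrite as_lE. inn rewrite tmap_brr.
inn rewrite br_lE; nrm. inn rewrite pl_coinv; nrm. inn rewrite (twrV (cst_tw D)); nrm.
inn rewrite bL1. inn rewrite pl_R. inn rewrite (twL (cst_tw B)). fin.
Qed.
End BraidAxioms.

Section SecondHexagon.
Variables A B D : bicov H.
Lemma tmap_brl' b m : tmap_l (br_bh A D) (idb B) (pH (TB A D) B m b) = pH (TB D A) B (br_l A D m) b.
Proof. exact: tmap_lE. Qed.
Lemma tmap_brr' a m : tmap_l (idb A) (br_bh B D) (pH A (TB B D) a m) = pH A (TB D B) a (br_l B D m).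
Proof. exact: tmap_lE. Qed.
(** Here P_L is taken on the product of A and B; [pl_TB] splits it into the two projections that the
    successive braidings produce. *)
Lemma hexagon2_l t : av_l D A B (br_l (TB A B) D (av_l A B D t)) =
  tmap_l (br_bh A D) (idb B) (av_l A D B (tmap_l (idb A) (br_bh B D) t)).
Proof.
move: t; apply: pH_ext3'; [mlin|mlin|move=> a b d].
rewrite av_lE br_lE TBl (twlV (cst_tw A)) (twr (cst_tw D)); nrm.
inn rewrite TBR. inn rewrite tWK. inn rewrite pl_TB; nrm. inn rewrite blR; nrm. inn rewrite av_lE.
swp 2%N. inn rewrite -bl_coassoc. inn rewrite br_coassoc.
symmetry. rewrite tmap_brr' br_lE; nrm. inn rewrite av_lE. inn rewrite tmap_brl'.
inn rewrite br_lE; nrm. inn rewrite brL; nrm. inn rewrite (twlV (cst_tw A)); nrm.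
fin.
by rewrite [in RHS]twLV !tWK bLA1.
Qed.
End SecondHexagon.

Lemma hom_pl (M N : bicov H) (f : bicov_hom M N) m : bhl f (pl (cst M) m) = pl (cst N) (bhl f m).
Proof.
rewrite !plE (hl (bhl_hom f)); nrm. inn rewrite (hL (bhl_hom f)). symmetry; nrm. fin.
Qed.
Lemma braid_nat_l (M M' N N' : bicov H) (f : bicov_hom M M') (g : bicov_hom N N') t :
  br_l M' N' (tmap_l f g t) = tmap_l g f (br_l M N t).
Proof.
move: t; apply: pH_ext; [mlin|mlin|move=> m n].
rewrite tmap_lE -[f m]/(bhl f m) -[g n]/(bhl g n) !br_lE (hl (bhl_hom f)) (hr (bhl_hom g)); nrm.
symmetry; nrm. inn rewrite tmap_lE.
inn rewrite -[f _]/(bhl f _). inn rewrite -[g _]/(bhl g _).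
inn rewrite (hL (bhl_hom g)). inn rewrite hom_pl. inn rewrite (hR (bhl_hom f)). fin.
Qed.

Lemma bhl_tV (M N : bicov H) (f : bicov_hom M N) m : bhl f (tV m) = tV (bhl f m).
Proof. by apply: (can_inj (@tWK _ _)); rewrite -bhl_tW !tVK. Qed.
Lemma assoc_nat_l (A A' B B' D D' : bicov H) (f : bicov_hom A A') (g : bicov_hom B B')
    (h : bicov_hom D D') t :
  as_l A' B' D' (tmap_l (tmap_bh f g) h t) = tmap_l f (tmap_bh g h) (as_l A B D t).
Proof.
move: t; apply: pH_ext3; [mlin|mlin|move=> a b d].
rewrite as_lE tmap_lE [LHS](_ : _ = as_l A' B' D' (pH (TB A' B') D' (pH A' B' (f a) (g b)) (h d))).
  by rewrite as_lE tmap_lE [tmap_bh g h _]tmap_lE -[f (tW a)]/(bhl f _) -[h (tV d)]/(bhl h _) bhl_tW bhl_tV.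
by congr (as_l _ _ _ (pH _ _ _ _)); exact: tmap_lE.
Qed.
Lemma pentagon_l (A B D E : bicov H) t : as_l A B (TB D E) (as_l (TB A B) D E t) =
    tmap_l (idb A) (as_bh B D E) (as_l A (TB B D) E (tmap_l (as_bh A B D) (idb E) t)).
Proof.
move: t; apply: pH_ext => [||x e]; [mlin|mlin|]; move: x; apply: pH_ext3; [mlin|mlin|move=> a b d].
rewrite as_lE tmap_lE !tW_TB as_lE tV_TB.
have -> : as_bh A B D (pH (TB A B) D (pH A B a b) d) = pH A (TB B D) (tW a) (pH B D b (tV d)).
  exact: as_lE.
rewrite as_lE tmap_lE; congr (pH _ _ _ _).
by apply: esym; apply: etrans (as_lE _ _ _) _.
Qed.
Lemma triangle_l (A B : bicov H) t :
  tmap_l (idb A) (lu_bh B) (as_l A (IB H) B t) = tmap_l (ru_bh A) (idb B) t.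
Proof.
move: t; apply: pH_ext3; [mlin|mlin|move=> a h b].
rewrite as_lE !tmap_lE.
have -> : lu_bh B (pH (IB H) B h (tV b)) = tW (bL (cst B) h (tV b)) by exact: lu_lE.
have -> : ru_bh A (pH A (IB H) a h) = tW (bR (cst A) a h) by exact: ru_lE.
by rewrite (twL (cst_tw B)) tVK (twR (cst_tw A)) [RHS](pt_bal (balP A B)).
Qed.

(** Kept transparent: the axioms of the functor below are proved on the underlying maps and apply to
    these components by conversion. *)
Definition bicov_str_prebraided : @prebraided_on (bicov_cat H)
    (fun M N => Bicov (tens_str M N)) (Bicov (unit_str H)).
Proof.
refine (@PrebraidedOn (bicov_cat H) (fun M N => Bicov (tens_str M N)) (Bicov (unit_str H))
  (fun M M' N N' f g => tmap_bh f g) as_bh av_bh lu_bh ru_bh br_bh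
  _ _ _ _ _ _ _ _ _ _ _ _ _ _).
- move=> M N; apply: bicov_hom_eq => t; rewrite -[LHS]/(tmap_l (idb M) (idb N) t) /=.
  by move: t; apply: pH_ext; [mlin|exact: lin_id|move=> m n]; rewrite tmap_lE.
- move=> A A' A'' B B' B'' f f' g g'; apply: bicov_hom_eq => t.
  change (tmap_l (BicovHom (bicov_comp_ax f f')) (BicovHom (bicov_comp_ax g g')) t =
          tmap_l f g (tmap_l f' g' t)).
  by move: t; apply: pH_ext; [mlin|mlin|move=> m n]; rewrite !tmap_lE.
- by move=> A B D; apply: bicov_hom_eq => t; exact: as_lK.
- by move=> A B D; apply: bicov_hom_eq => t; exact: av_lK.
- by move=> A A' B B' D D' f g h; apply: bicov_hom_eq => t; exact: assoc_nat_l.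
- by move=> A; exact: (bh_iso (f := lu_bh A) (@lu_lK A) (@luVK A)).
- move=> A A' f; apply: bicov_hom_eq => t.
  change (lu_l A' (tmap_l (idb (IB H)) f t) = bhl f (lu_l A t)).
  move: t; apply: pH_ext; [mlin|mlin|move=> h a].
  by rewrite tmap_lE !lu_lE bhl_tW (hL (bhl_hom f)).
- by move=> A; exact: (bh_iso (f := ru_bh A) (@ru_lK A) (@ruVK A)).
- move=> A A' f; apply: bicov_hom_eq => t.
  change (ru_l A' (tmap_l f (idb (IB H)) t) = bhl f (ru_l A t)).
  move: t; apply: pH_ext; [mlin|mlin|move=> a h].
  by rewrite tmap_lE !ru_lE bhl_tW (hR (bhl_hom f)).
- by move=> A B D E; apply: bicov_hom_eq => t; exact: pentagon_l.
- by move=> A B; apply: bicov_hom_eq => t; exact: triangle_l.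
- by move=> A A' B B' f g; apply: bicov_hom_eq => t; exact: braid_nat_l.
- by move=> A B D; apply: bicov_hom_eq => t; exact: hexagon1_l.
- by move=> A B D; apply: bicov_hom_eq => t; exact: hexagon2_l.
Defined.

Definition bicov_pre : bicov_prebraided H.
Proof.
refine (@BicovPrebraided k H (@tens_str k H) _ _ _ _ (unit_str H) _ _ _ _ bicov_str_prebraided _ _ _ _ _).
- exact: tens_la.
- exact: tens_ra.
- exact: tens_lc.
- exact: tens_rc.
- exact: unit_la.
- exact: unit_ra.
- exact: unit_lc.
- exact: unit_rc.
- by move=> M M' N N' f g m n; rewrite -!pHE; exact: tmap_lE.
- by move=> M N P m n p; rewrite -!pHE -tWE -tVE; exact: as_lE.
- by move=> M h m; rewrite -!pHE laE; exact: lu_lE.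
- by move=> M h m; rewrite -!pHE raE; exact: ru_lE.
- by move=> M N m n; exact: br_spec.
Defined.
End BicovMorphisms.

(** * The prebraided category of Hom-Yetter-Drinfeld modules *)

Section UnitYdm.
Variables (k : comPzRingType) (A : lmodType k) (H : hopf_on A).
Lemma uA_bilin : bilin (fun (x : k^o) h => cou H h *: x). Proof. mlin. Qed.
Definition uA := locked (Bmap uA_bilin).
Lemma uAE x h : uA x h = cou H h *: x. Proof. by rewrite /uA -lock. Qed.
Lemma uC_lin : lin (fun x : k^o => x ⊠ one H). Proof. mlin. Qed.
Definition uC := locked (Lmap uC_lin).
Lemma uCE x : uC x = x ⊠ one H. Proof. by rewrite /uC -lock. Qed.
Definition unit_ydm : ydm_on H k^o.
Proof.
refine (@YdmOn _ _ _ _ uA uC _ _ _ _ _).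
- by move=> v g h; rewrite !uAE couM scalerA mulrC.
- by move=> v; rewrite uAE cou1 scale1r.
- move=> v; rewrite uCE; nrm. rewrite cop1. symmetry; nrm. by rewrite uCE; nrm.
- by move=> v; rewrite uCE; nrm; rewrite cou1 scale1r.
- move=> v h. inn rewrite uAE. inn rewrite uCE; nrm. inn rewrite mulr1'.
  inn rewrite counitr. rewrite uCE; symmetry; nrm. inn rewrite uAE; nrm. inn rewrite mul1r'.
  inn rewrite counitl. fin.
Defined.
End UnitYdm.

Section YdMorphisms.
Variables (k : comPzRingType) (H : homHopf k).
Local Notation HH := (core_hopf H).
Local Notation "x ∙ y" := (mul1 H x y) (at level 40, left associativity).

Section Tensor.
Variables V W : yd H.
Definition vH : bmap V W (htens V W) := tn.
Lemma vHE v w : vH v w = v ⊗ w. Proof. by []. Qed.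
Lemma vH_tW v w : tW (vH v w) = vH (tW v) (tW w).
Proof. by rewrite !tWE; exact: tens_mapE. Qed.
Lemma vH_tV v w : tV (vH v w) = vH (tV v) (tV w).
Proof. by apply: (can_inj (@tWK _ _)); rewrite vH_tW !tVK. Qed.
Definition Y0 : ydm_on HH (htens V W) := tensor_ydm (cyd V) (cyd W).
Lemma vH_ext (P : lmodType k) (f g : htens V W -> P) : lin f -> lin g ->
  (forall m n, f (vH m n) = g (vH m n)) -> forall t, f t = g t.
Proof. exact: TT_ext. Qed.
Lemma Y0A v w h : ya Y0 (vH v w) h = do (a, b <- D1 H h) vH (ya (cyd V) v a) (ya (cyd W) w b).
Proof. exact: tyAE. Qed.
Lemma Y0C v w : yc Y0 (vH v w) =
  do (x, g <- yc (cyd V) v) do (y, h <- yc (cyd W) w) vH x y ⊠ (g ∙ h).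
Proof. exact: tyCE. Qed.
Lemma Y0_tw : tw_ydm Y0.
Proof.
have [VA VC] := cyd_tw V; have [WA WC] := cyd_tw W.
split=> [t h|t]; move: t; (apply: vH_ext; [mlin|mlin|move=> v w]).
- rewrite vH_tW !Y0A D1_tW; nrm. symmetry; nrm. symmetry. inn rewrite vH_tW.
  inn rewrite VA. inn rewrite WA. fin.
- rewrite vH_tW !Y0C VC WC; nrm. symmetry; nrm. inn rewrite mul1_tW. inn rewrite vH_tW. fin.
Qed.
Definition yd_tens_str : yd_on H (htens V W) := mk_yd (transport_ydm_tw Y0_tw).
End Tensor.
Definition TV (V W : yd H) : yd H := YD (yd_tens_str V W).
Lemma cyd_TV (V W : yd H) : cyd (TV V W) = transport_ydm (@tWK k _) (@tVK k _) (Y0 V W).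
Proof. exact: core_mk_yd. Qed.

Lemma twAV (V : yd H) m h : tV (ya (cyd V) m h) = ya (cyd V) (tV m) (tV h).
Proof. by apply: (can_inj (@tWK _ _)); rewrite (twA (cyd_tw V)) !tVK. Qed.

Section TensorFormulas.
Variables V W : yd H.
Local Notation PV v w := (vH V W v w : TV V W).
Lemma tW_TV m n : tW (PV m n) = PV (tW m) (tW n). Proof. exact: vH_tW. Qed.
Lemma tV_TV m n : tV (PV m n) = PV (tV m) (tV n). Proof. exact: vH_tV. Qed.
Lemma TVA v w h : ya (cyd (TV V W)) (PV v w) h =
  do (a, b <- D1 H (tV h)) PV (ya (cyd V) v a) (ya (cyd W) w b).
Proof.
rewrite cyd_TV [LHS]trAE vH_tW Y0A; nrm. inn rewrite vH_tV. inn rewrite twAV. inn rewrite twAV.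
inn rewrite tWK. inn rewrite tWK. symmetry. rewrite D1_tV; nrm. fin.
Qed.
Lemma TVC v w : yc (cyd (TV V W)) (PV v w) =
  do (x, g <- yc (cyd V) v) do (y, h <- yc (cyd W) w) PV x y ⊠ tW (g ∙ h).
Proof.
rewrite cyd_TV [LHS]trCE vH_tW Y0C (twC (cyd_tw V)) (twC (cyd_tw W)); nrm.
inn rewrite vH_tV. inn rewrite -mul1_tW. inn rewrite tWK. inn rewrite tWK. reflexivity.
Qed.
Lemma tens_ya (v : V) (w : W) h : yact (yd_tens_str V W) (v ⊗ w) h =
  \sw_(h1, h2 <- hcomul h) (Defs.ya v h1 ⊗ Defs.ya w h2).
Proof.
rewrite -[LHS]/(Defs.ya (V := TV V W) (PV v w) h) yaE TVA; nrm. inn rewrite tW_TV.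
rewrite -D0E1. inn rewrite -yaE. inn rewrite -yaE. by rewrite !sgF D0E.
Qed.
Lemma tens_yc (v : V) (w : W) : yco (yd_tens_str V W) (v ⊗ w) =
    \sw_(v0, v1 <- Defs.yc v) \sw_(w0, w1 <- Defs.yc w) ((v0 ⊗ w0) ⊗ hmul v1 w1).
Proof.
rewrite -[LHS]/(Defs.yc (V := TV V W) (PV v w)) ycE tV_TV TVC -!ycE.
by inn rewrite -m0E'; inn rewrite m0E; rewrite !sgF.
Qed.
End TensorFormulas.

Lemma unit_ydm_tw : tw_ydm (X := hunit k) (unit_ydm HH).
Proof.
have uW (x : hunit k) : tW x = x by rewrite tWE.
split=> [x h|x].
- by rewrite !uW [ya _ _ _]uAE [ya _ _ _]uAE -[cou HH (tW h)]/(e0 H (tW h)) e0_tW.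
- by rewrite uW [yc _ _]uCE; symmetry; nrm; rewrite uW tWE hone_tw.
Qed.
Definition yd_unit_str : yd_on H (hunit k) := mk_yd unit_ydm_tw.
Definition IV : yd H := YD yd_unit_str.
Lemma cyd_IV : cyd IV = unit_ydm HH. Proof. exact: core_mk_yd. Qed.
Lemma tW_IV (x : IV) : tW x = x. Proof. by rewrite tWE. Qed.
Lemma tV_IV (x : IV) : tV x = x. Proof. by rewrite tVE. Qed.
Lemma yd_unit_ya x h : yact yd_unit_str x h = hcounit h * x.
Proof. by rewrite -[LHS]/(tW (uA HH x h : IV)) tW_IV uAE -[cou _ _]/(e0 H h) e0E. Qed.
Lemma yd_unit_yc x : yco yd_unit_str x = x ⊗ hone H.
Proof. by rewrite -[LHS]/(uC HH (tV (x : IV))) tV_IV uCE. Qed.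

Definition yhl (M N : yd H) (f : yd_hom M N) : lmap M N := Lmap (yh_linear (yh_ax f) : lin f).
Lemma yhl_tW (M N : yd H) (f : yd_hom M N) m : yhl f (tW m) = tW (yhl f m).
Proof. exact: (is_yd_homE (f := yhl f) (yh_ax f)).1. Qed.
Lemma yhl_tV (M N : yd H) (f : yd_hom M N) m : yhl f (tV m) = tV (yhl f m).
Proof. by apply: (can_inj (@tWK _ _)); rewrite -yhl_tW !tVK. Qed.
Lemma yhl_hom (M N : yd H) (f : yd_hom M N) : ydm_hom (cyd M) (cyd N) (yhl f).
Proof. exact: (is_yd_homE (f := yhl f) (yh_ax f)).2. Qed.
Definition mkyh (M N : yd H) (f : lmap M N) (ft : forall m, f (tW m) = tW (f m))
  (fh : ydm_hom (cyd M) (cyd N) f) : yd_hom M N := YDHom (is_yd_homI ft fh).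
Definition idy (M : yd H) : yd_hom M M := YDHom (yd_id_ax M).

Section Inv.
Variables (M N : yd H) (f : yd_hom M N) (g : lmap N M).
Hypotheses (fK : cancel f g) (gK : cancel g f).
Lemma yinv_tW m : g (tW m) = tW (g m).
Proof. by apply: (can_inj fK); rewrite gK -[RHS]/(yhl f _) yhl_tW /= gK. Qed.
Definition yh_inv : yd_hom N M :=
  mkyh yinv_tW (ydm_hom_inv (f := yhl f) fK gK (yhl_hom f)).
Lemma yh_iso : is_iso (C := yd_cat H) f.
Proof. by exists yh_inv; split; apply: yd_hom_eq => x /=; rewrite ?fK ?gK. Qed.
End Inv.

Section Tmap.
Variables (V V' W W' : yd H) (f : yd_hom V V') (g : yd_hom W W').
Lemma ytm_lin : lin (fun t : TV V W => sg t (fun v w => vH V' W' (yhl f v) (yhl g w))).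
Proof. mlin. Qed.
Definition ytm_l : lmap (TV V W) (TV V' W') := locked (Lmap ytm_lin).
Lemma ytm_lE v w : ytm_l (vH V W v w) = vH V' W' (f v) (g w).
Proof. by rewrite /ytm_l -lock; apply: etrans (sg_tn _ _ _) _ => //; mlin. Qed.
Lemma ytm_tW t : ytm_l (tW t) = tW (ytm_l t).
Proof.
move: t; apply: vH_ext; [mlin|mlin|move=> v w].
by rewrite vH_tW !ytm_lE [RHS]vH_tW -[f (tW _)]/(yhl f _) -[g (tW _)]/(yhl g _) !yhl_tW.
Qed.
Lemma ytm_hom : ydm_hom (cyd (TV V W)) (cyd (TV V' W')) ytm_l.
Proof.
split=> [t h|t]; move: t; (apply: vH_ext; [mlin|mlin|move=> v w]).
- rewrite TVA ytm_lE TVA; nrm. inn rewrite ytm_lE. inn rewrite -[f _]/(yhl f _).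
  inn rewrite -[g _]/(yhl g _). inn rewrite (hya (yhl_hom f)). inn rewrite (hya (yhl_hom g)). fin.
- rewrite TVC ytm_lE TVC -[f _]/(yhl f _) -[g _]/(yhl g _) (hyc (yhl_hom f)) (hyc (yhl_hom g)); nrm.
  symmetry; nrm. inn rewrite ytm_lE. fin.
Qed.
Definition ytm_bh : yd_hom (TV V W) (TV V' W') := mkyh ytm_tW ytm_hom.
End Tmap.

Lemma vH_ext3 (M N P : yd H) (X : lmodType k) (f g : TV (TV M N) P -> X) : lin f -> lin g ->
  (forall m n p, f (vH (TV M N) P (vH M N m n) p) = g (vH (TV M N) P (vH M N m n) p)) ->
  forall t, f t = g t.
Proof.
move=> fL gL fg; apply: vH_ext => // y p; move: y; apply: vH_ext => [||m n]; [mlin|mlin|exact: fg].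
Qed.
Lemma vH_ext3' (M N P : yd H) (X : lmodType k) (f g : TV M (TV N P) -> X) : lin f -> lin g ->
  (forall m n p, f (vH M (TV N P) m (vH N P n p)) = g (vH M (TV N P) m (vH N P n p))) ->
  forall t, f t = g t.
Proof.
move=> fL gL fg; apply: vH_ext => // m y; move: y; apply: vH_ext => [||n p]; [mlin|mlin|exact: fg].
Qed.

Lemma D1_coassoc (X : lmodType k) (F : H -> H -> H -> X) c : trilin F ->
  (do (a, b <- D1 H c) do (x, y <- D1 H a) F x y b) =
  do (a, b <- D1 H c) do (x, y <- D1 H b) F a x y.
Proof. exact: (@coassoc _ _ HH). Qed.
Lemma twCV1 (V : yd H) m : yc (cyd V) (tV m) = do (x, h <- yc (cyd V) m) tV x ⊠ tV h.
Proof. exact: (twCV (cyd_tw V)). Qed.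

Section Assoc.
Variables U V W : yd H.
Lemma yas_lin : lin (fun t : TV (TV U V) W =>
  sg t (fun y w => sg y (fun u v => vH U (TV V W) (tW u) (vH V W v (tV w))))).
Proof. mlin. Qed.
Definition yas_l : lmap (TV (TV U V) W) (TV U (TV V W)) := locked (Lmap yas_lin).
Lemma yas_lE u v w : yas_l (vH (TV U V) W (vH U V u v) w) = vH U (TV V W) (tW u) (vH V W v (tV w)).
Proof.
rewrite /yas_l -lock; apply: etrans (sg_tn _ _ _) _; first by mlin.
by apply: etrans (sg_tn _ _ _) _ => //; mlin.
Qed.
Lemma yav_lin : lin (fun t : TV U (TV V W) =>
  sg t (fun u y => sg y (fun v w => vH (TV U V) W (vH U V (tV u) v) (tW w)))).
Proof. mlin. Qed.
Definition yav_l : lmap (TV U (TV V W)) (TV (TV U V) W) := locked (Lmap yav_lin).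
Lemma yav_lE u v w : yav_l (vH U (TV V W) u (vH V W v w)) = vH (TV U V) W (vH U V (tV u) v) (tW w).
Proof.
rewrite /yav_l -lock; apply: etrans (sg_tn _ _ _) _; first by mlin.
by apply: etrans (sg_tn _ _ _) _ => //; mlin.
Qed.
Lemma yas_tW t : yas_l (tW t) = tW (yas_l t).
Proof.
move: t; apply: vH_ext3; [mlin|mlin|move=> m n p].
by rewrite !tW_TV !yas_lE !tW_TV tWK tVK.
Qed.
Lemma yas_hom : ydm_hom (cyd (TV (TV U V) W)) (cyd (TV U (TV V W))) yas_l.
Proof.
split=> [t h|t]; move: t; (apply: vH_ext3; [mlin|mlin|move=> u v w]).
- rewrite yas_lE !TVA; nrm. symmetry. inn rewrite TVA; nrm with (rewrite D1_tV).
  symmetry. inn rewrite TVA; nrm with (rewrite D1_tV). inn rewrite D1_coassoc.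
  inn rewrite yas_lE. inn rewrite (twA (cyd_tw U)). inn rewrite twAV. inn rewrite tVK. fin.
- rewrite yas_lE !TVC; nrm. rewrite (twC (cyd_tw U)) twCV1; nrm. symmetry; nrm.
  inn rewrite yas_lE. fin; congr (_ ⊠ _). by rewrite !mul1_tW tVK mul1A.
Qed.
Definition yas_bh : yd_hom (TV (TV U V) W) (TV U (TV V W)) := mkyh yas_tW yas_hom.
Lemma yas_lK : cancel yas_l yav_l.
Proof.
by move=> t; move: t; apply: vH_ext3; [mlin|mlin|move=> m n p]; rewrite yas_lE yav_lE tWK tVK.
Qed.
Lemma yav_lK : cancel yav_l yas_l.
Proof.
by move=> t; move: t; apply: vH_ext3'; [mlin|mlin|move=> m n p]; rewrite yav_lE yas_lE tWK tVK.
Qed.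
Definition yav_bh : yd_hom (TV U (TV V W)) (TV (TV U V) W) := yh_inv (f := yas_bh) yas_lK yav_lK.
End Assoc.

Lemma D1_counitl (X : lmodType k) (F : H -> X) c : lin F ->
  (do (a, b <- D1 H c) cou HH a *: F b) = F c.
Proof. exact: (@counitl _ _ HH). Qed.
Lemma D1_counitr (X : lmodType k) (F : H -> X) c : lin F ->
  (do (a, b <- D1 H c) cou HH b *: F a) = F c.
Proof. exact: (@counitr _ _ HH). Qed.
Lemma unitA x h : ya (unit_ydm HH) x h = cou HH h *: x. Proof. exact: uAE. Qed.
Lemma unitC x : yc (unit_ydm HH) x = x ⊠ hone H. Proof. exact: uCE. Qed.

Section UnitHom.
Variable V : yd H.
Lemma ylu_lin : lin (fun t : TV IV V => sg t (fun x v => (x : k^o) *: tW v)). Proof. mlin. Qed.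
Definition ylu_l : lmap (TV IV V) V := locked (Lmap ylu_lin).
Lemma ylu_lE x v : ylu_l (vH IV V x v) = (x : k^o) *: tW v.
Proof. by rewrite /ylu_l -lock; apply: etrans (sg_tn _ _ _) _ => //; mlin. Qed.
Lemma yluV_lin : lin (fun v => vH IV V (1 : k^o) (tV v)). Proof. mlin. Qed.
Definition yluV : lmap V (TV IV V) := locked (Lmap yluV_lin).
Lemma yluVE v : yluV v = vH IV V (1 : k^o) (tV v). Proof. by rewrite /yluV -lock. Qed.
Lemma vH_swap (x : IV) (v : V) : vH IV V (1 : k^o) ((x : k^o) *: v) = vH IV V x v.
Proof. by rewrite bZr -bZl; congr (vH _ _ _ _); exact: mulr1. Qed.
Lemma ylu_tW t : ylu_l (tW t) = tW (ylu_l t).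
Proof.
move: t; apply: vH_ext; [mlin|mlin|move=> x v].
by rewrite tW_TV !ylu_lE lmZ tW_IV.
Qed.
Lemma ylu_hom : ydm_hom (cyd (TV IV V)) (cyd V) ylu_l.
Proof.
split=> [t h|t]; move: t; (apply: vH_ext; [mlin|mlin|move=> x v]).
- rewrite TVA ylu_lE bZl; nrm. inn rewrite ylu_lE. rewrite cyd_IV.
  inn rewrite unitA. inn rewrite -scalerA. inn rewrite D1_counitl.
  by rewrite (twA (cyd_tw V)) tVK.
- rewrite TVC ylu_lE lmZ (twC (cyd_tw V)) cyd_IV unitC; nrm. symmetry; nrm.
  inn rewrite ylu_lE. inn rewrite mul1r_1. inn rewrite bZl; nrm. fin.
Qed.
Definition ylu_bh : yd_hom (TV IV V) V := mkyh ylu_tW ylu_hom.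
Lemma ylu_lK : cancel ylu_l yluV.
Proof.
move=> t; move: t; apply: vH_ext; [mlin|mlin|move=> x v].
by rewrite ylu_lE yluVE lmZ tWK vH_swap.
Qed.
Lemma yluVK : cancel yluV ylu_l.
Proof. by move=> v; rewrite yluVE ylu_lE tVK scale1r. Qed.

Lemma yru_lin : lin (fun t : TV V IV => sg t (fun v x => (x : k^o) *: tW v)). Proof. mlin. Qed.
Definition yru_l : lmap (TV V IV) V := locked (Lmap yru_lin).
Lemma yru_lE x v : yru_l (vH V IV v x) = (x : k^o) *: tW v.
Proof. by rewrite /yru_l -lock; apply: etrans (sg_tn _ _ _) _ => //; mlin. Qed.
Lemma yruV_lin : lin (fun v => vH V IV (tV v) (1 : k^o)). Proof. mlin. Qed.
Definition yruV : lmap V (TV V IV) := locked (Lmap yruV_lin).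
Lemma yruVE v : yruV v = vH V IV (tV v) (1 : k^o). Proof. by rewrite /yruV -lock. Qed.
Lemma vH_swapr (x : IV) (v : V) : vH V IV ((x : k^o) *: v) (1 : k^o) = vH V IV v x.
Proof. by rewrite bZl -bZr; congr (vH _ _ _ _); exact: mulr1. Qed.
Lemma yru_tW t : yru_l (tW t) = tW (yru_l t).
Proof.
move: t; apply: vH_ext; [mlin|mlin|move=> v x].
by rewrite tW_TV !yru_lE lmZ tW_IV.
Qed.
Lemma yru_hom : ydm_hom (cyd (TV V IV)) (cyd V) yru_l.
Proof.
split=> [t h|t]; move: t; (apply: vH_ext; [mlin|mlin|move=> v x]).
- rewrite TVA yru_lE bZl; nrm. inn rewrite yru_lE. rewrite cyd_IV.
  inn rewrite unitA. inn rewrite -scalerA. inn rewrite D1_counitr.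
  by rewrite (twA (cyd_tw V)) tVK.
- rewrite TVC yru_lE lmZ (twC (cyd_tw V)) cyd_IV; nrm. symmetry; nrm. inn rewrite unitC; nrm.
  inn rewrite yru_lE. inn rewrite mulr1_1. inn rewrite bZl; nrm. fin.
Qed.
Definition yru_bh : yd_hom (TV V IV) V := mkyh yru_tW yru_hom.
Lemma yru_lK : cancel yru_l yruV.
Proof.
move=> t; move: t; apply: vH_ext; [mlin|mlin|move=> v x].
by rewrite yru_lE yruVE lmZ tWK vH_swapr.
Qed.
Lemma yruVK : cancel yruV yru_l.
Proof. by move=> v; rewrite yruVE yru_lE tVK scale1r. Qed.
End UnitHom.

Section Braid.
Variables V W : yd H.
Definition yb_l : lmap (TV V W) (TV W V) := yB (cyd V) (cyd W).
Lemma yb_lE v w : yb_l (vH V W v w) = do (y, g <- yc (cyd W) w) vH W V y (ya (cyd V) v g).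
Proof. exact: yBE. Qed.
Lemma yb_tW t : yb_l (tW t) = tW (yb_l t).
Proof.
move: t; apply: vH_ext; [mlin|mlin|move=> v w].
rewrite tW_TV !yb_lE (twC (cyd_tw W)); nrm. symmetry; nrm. inn rewrite tW_TV.
inn rewrite (twA (cyd_tw V)).
fin.
Qed.
Lemma yb_hom : ydm_hom (cyd (TV V W)) (cyd (TV W V)) yb_l.
Proof. by rewrite !cyd_TV; apply: transport_ydm_hom; [exact: yb_tW | exact: yB_hom]. Qed.
Definition yb_bh : yd_hom (TV V W) (TV W V) := mkyh yb_tW yb_hom.
Lemma yb_spec (v : V) (w : W) : yb_l (v ⊗ w) =
  \sw_(w0, w1 <- Defs.yc w) (tw w0 ⊗ Defs.ya (twV v) w1).
Proof.
rewrite -[v ⊗ w]/(vH V W v w) yb_lE -sgF ycE twCV1; symmetry; nrm.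
inn rewrite yaE. inn rewrite -vHE. rewrite -tVE. inn rewrite -tWE. nrm.
inn rewrite (twA (cyd_tw V)). inn rewrite tVK. inn rewrite tVK. inn rewrite tVK. fin.
Qed.
End Braid.

Lemma ybraid_nat_l (M M' N N' : yd H) (f : yd_hom M M') (g : yd_hom N N') t :
  yb_l M' N' (ytm_l f g t) = ytm_l g f (yb_l M N t).
Proof.
move: t; apply: vH_ext; [mlin|mlin|move=> m n].
rewrite ytm_lE -[f m]/(yhl f m) -[g n]/(yhl g n) !yb_lE (hyc (yhl_hom g)); nrm.
symmetry; nrm. inn rewrite ytm_lE.
inn rewrite -[f _]/(yhl f _). inn rewrite -[g _]/(yhl g _). inn rewrite (hya (yhl_hom f)). fin.
Qed.

Section BraidAxioms.
Variables A B D : yd H.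
Lemma ytmap_brl m d : ytm_l (yb_bh A B) (idy D) (vH (TV A B) D m d) = vH (TV B A) D (yb_l A B m) d.
Proof. exact: ytm_lE. Qed.
Lemma ytmap_brr b m : ytm_l (idy B) (yb_bh A D) (vH B (TV A D) b m) = vH B (TV D A) b (yb_l A D m).
Proof. exact: ytm_lE. Qed.
Lemma ytmap_brl' b m : ytm_l (yb_bh A D) (idy B) (vH (TV A D) B m b) = vH (TV D A) B (yb_l A D m) b.
Proof. exact: ytm_lE. Qed.
Lemma ytmap_brr' a m : ytm_l (idy A) (yb_bh B D) (vH A (TV B D) a m) = vH A (TV D B) a (yb_l B D m).
Proof. exact: ytm_lE. Qed.
Lemma yaA1 (M : yd H) m g h : ya (cyd M) (ya (cyd M) m g) h = ya (cyd M) m (g ∙ h).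
Proof. exact: yaA. Qed.

(** This hexagon comes from multiplicativity of the coaction on B ⊗ D and associativity of the
    action on A; the second one comes from the diagonal action on A ⊗ B and coassociativity of the
    coaction on D. *)
Lemma yhexagon1_l t : yas_l B D A (yb_l A (TV B D) (yas_l A B D t)) =
  ytm_l (idy B) (yb_bh A D) (yas_l B A D (ytm_l (yb_bh A B) (idy D) t)).
Proof.
move: t; apply: vH_ext3; [mlin|mlin|move=> a b d].
rewrite yas_lE yb_lE TVC twCV1; nrm. inn rewrite yas_lE. inn rewrite twAV. inn rewrite tWK.
inn rewrite tWK. inn rewrite -yaA1.
symmetry. rewrite ytmap_brl yb_lE; nrm. inn rewrite yas_lE. inn rewrite ytmap_brr.
inn rewrite yb_lE; nrm. inn rewrite twCV1; nrm. fin.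
Qed.
Lemma yhexagon2_l t : yav_l D A B (yb_l (TV A B) D (yav_l A B D t)) =
  ytm_l (yb_bh A D) (idy B) (yav_l A D B (ytm_l (idy A) (yb_bh B D) t)).
Proof.
move: t; apply: vH_ext3'; [mlin|mlin|move=> a b d].
rewrite yav_lE yb_lE (twC (cyd_tw D)); nrm. inn rewrite TVA; nrm. inn rewrite tWK.
inn rewrite yav_lE.
inn rewrite tWK.
symmetry. rewrite ytmap_brr' yb_lE; nrm. inn rewrite yav_lE. inn rewrite ytmap_brl'.
inn rewrite yb_lE; nrm. inn rewrite -yc_coassoc. fin.
Qed.
End BraidAxioms.

Lemma yassoc_nat_l (A A' B B' D D' : yd H) (f : yd_hom A A') (g : yd_hom B B')
    (h : yd_hom D D') t :
  yas_l A' B' D' (ytm_l (ytm_bh f g) h t) = ytm_l f (ytm_bh g h) (yas_l A B D t).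
Proof.
move: t; apply: vH_ext3; [mlin|mlin|move=> a b d].
rewrite yas_lE ytm_lE [LHS](_ : _ = yas_l A' B' D' (vH (TV A' B') D' (vH A' B' (f a) (g b)) (h d))).
  by rewrite yas_lE ytm_lE [ytm_bh g h _]ytm_lE -[f (tW a)]/(yhl f _) -[h (tV d)]/(yhl h _) yhl_tW yhl_tV.
by congr (yas_l _ _ _ (vH _ _ _ _)); exact: ytm_lE.
Qed.
Lemma ypentagon_l (A B D E : yd H) t : yas_l A B (TV D E) (yas_l (TV A B) D E t) =
    ytm_l (idy A) (yas_bh B D E) (yas_l A (TV B D) E (ytm_l (yas_bh A B D) (idy E) t)).
Proof.
move: t; apply: vH_ext => [||x e]; [mlin|mlin|]; move: x; apply: vH_ext3; [mlin|mlin|move=> a b d].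
rewrite yas_lE ytm_lE !tW_TV yas_lE tV_TV.
have -> : yas_bh A B D (vH (TV A B) D (vH A B a b) d) = vH A (TV B D) (tW a) (vH B D b (tV d)).
  exact: yas_lE.
rewrite yas_lE ytm_lE; congr (vH _ _ _ _).
by apply: esym; apply: etrans (yas_lE _ _ _) _.
Qed.
Lemma ytriangle_l (A B : yd H) t :
  ytm_l (idy A) (ylu_bh B) (yas_l A IV B t) = ytm_l (yru_bh A) (idy B) t.
Proof.
move: t; apply: vH_ext3; [mlin|mlin|move=> a h b].
rewrite yas_lE !ytm_lE.
have -> : ylu_bh B (vH IV B h (tV b)) = (h : k^o) *: tW (tV b) by exact: ylu_lE.
have -> : yru_bh A (vH A IV a h) = (h : k^o) *: tW a by exact: yru_lE.
by rewrite tVK bZl bZr.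
Qed.

Definition yd_str_prebraided : @prebraided_on (yd_cat H)
    (fun V W => YD (yd_tens_str V W)) (YD yd_unit_str).
Proof.
refine (@PrebraidedOn (yd_cat H) (fun V W => YD (yd_tens_str V W)) (YD yd_unit_str)
  (fun M M' N N' f g => ytm_bh f g) yas_bh yav_bh ylu_bh yru_bh yb_bh
  _ _ _ _ _ _ _ _ _ _ _ _ _ _).
- move=> M N; apply: yd_hom_eq => t; rewrite -[LHS]/(ytm_l (idy M) (idy N) t) /=.
  by move: t; apply: vH_ext; [mlin|exact: lin_id|move=> m n]; rewrite ytm_lE.
- move=> A A' A'' B B' B'' f f' g g'; apply: yd_hom_eq => t.
  change (ytm_l (YDHom (yd_comp_ax f f')) (YDHom (yd_comp_ax g g')) t =
          ytm_l f g (ytm_l f' g' t)).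
  by move: t; apply: vH_ext; [mlin|mlin|move=> m n]; rewrite !ytm_lE.
- by move=> A B D; apply: yd_hom_eq => t; exact: yas_lK.
- by move=> A B D; apply: yd_hom_eq => t; exact: yav_lK.
- by move=> A A' B B' D D' f g h; apply: yd_hom_eq => t; exact: yassoc_nat_l.
- by move=> A; exact: (yh_iso (f := ylu_bh A) (@ylu_lK A) (@yluVK A)).
- move=> A A' f; apply: yd_hom_eq => t.
  change (ylu_l A' (ytm_l (idy IV) f t) = yhl f (ylu_l A t)).
  move: t; apply: vH_ext; [mlin|mlin|move=> h a].
  by rewrite ytm_lE !ylu_lE lmZ yhl_tW.
- by move=> A; exact: (yh_iso (f := yru_bh A) (@yru_lK A) (@yruVK A)).
- move=> A A' f; apply: yd_hom_eq => t.
  change (yru_l A' (ytm_l f (idy IV) t) = yhl f (yru_l A t)).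
  move: t; apply: vH_ext; [mlin|mlin|move=> a h].
  by rewrite ytm_lE !yru_lE lmZ yhl_tW.
- by move=> A B D E; apply: yd_hom_eq => t; exact: ypentagon_l.
- by move=> A B; apply: yd_hom_eq => t; exact: ytriangle_l.
- by move=> A A' B B' f g; apply: yd_hom_eq => t; exact: ybraid_nat_l.
- by move=> A B D; apply: yd_hom_eq => t; exact: yhexagon1_l.
- by move=> A B D; apply: yd_hom_eq => t; exact: yhexagon2_l.
Defined.

Definition yd_pre : yd_prebraided H.
Proof.
refine (@YDPrebraided k H yd_tens_str _ _ yd_unit_str _ _ yd_str_prebraided _ _ _ _ _).
- exact: tens_ya.
- exact: tens_yc.
- exact: yd_unit_ya.
- exact: yd_unit_yc.
- by move=> V V' W W' f g v w; exact: ytm_lE.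
- by move=> U V W u v w; rewrite -tWE -tVE; exact: yas_lE.
- by move=> V x v; rewrite -tWE; exact: ylu_lE.
- by move=> V x v; rewrite -tWE; exact: yru_lE.
- by move=> V W v w; exact: yb_spec.
Defined.
End YdMorphisms.

(** * The equivalence *)

(* The image of [e], realised as a quotient module. *)
Section SplitIdempotent.
Variables (k : comPzRingType) (M : lmodType k) (e : lmap M M).
Hypothesis eK : forall m, e (e m) = e m.
(** For idempotent [e] the elements m - e(m) form the kernel of [e], so the quotient by them is
    identified with the image: [e] itself descends to the inclusion [spliti]. *)
Definition splitR (r : M) : Prop := exists m, r = m - e m.
Definition split : lmodType k := qmod splitR.
Lemma split_R r : splitR r -> mklin (lmapP e : linear e) r = 0.
Proof. by move=> [m ->]; rewrite linearB /= eK subrr. Qed.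
Lemma splitp_lin : lin (fun m => qpi splitR m : split).
Proof. exact: qpi_linear. Qed.
Definition splitp : lmap M split := locked (Lmap splitp_lin).
Lemma spliti_lin : lin (qlift (R := splitR) e : split -> M).
Proof. exact: (qlift_linear split_R). Qed.
Definition spliti : lmap split M := locked (Lmap spliti_lin).
Lemma split_ip m : spliti (splitp m) = e m.
Proof. by rewrite /spliti /splitp -!lock; exact: (qliftE m split_R). Qed.
Lemma split_pi v : splitp (spliti v) = v.
Proof.
have [m ->] : exists m, v = splitp m.
  by exists (repr v); rewrite /splitp -lock; exact/esym/reprK.
rewrite split_ip /splitp -lock; apply/eq_qmodP; rewrite -opprB.
by apply/lspanN/lspan_gen; exists m.
Qed.
End SplitIdempotent.

Section Functor.
Variables (k : comPzRingType) (H : homHopf k).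
Local Notation HH := (core_hopf H).
Local Notation "x ∙ y" := (mul1 H x y) (at level 40, left associativity).

Section Coinv.
Variable M : bicov H.
Local Notation e := (pl (cst M)).
Definition cV : lmodType k := split e.
Definition cp : lmap M cV := splitp e.
Definition ci : lmap cV M := spliti (pl_pl (cst M)).
Lemma cipE m : ci (cp m) = e m. Proof. exact: split_ip. Qed.
Lemma cpiK v : cp (ci v) = v. Proof. exact: split_pi. Qed.
(** The twist of M restricted to the coinvariants; it is invertible there because P_L commutes with
    the twist and its inverse. *)
Definition ctw (v : cV) : cV := cp (tW (ci v)).
Definition ctwV (v : cV) : cV := cp (tV (ci v)).
Lemma ctw_lin : linear ctw. Proof. by have : lin ctw by rewrite /ctw; mlin. Qed.
Lemma ctwV_lin : linear ctwV. Proof. by have : lin ctwV by rewrite /ctwV; mlin. Qed.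
Lemma ctwK : cancel (mklin ctw_lin) (mklin ctwV_lin).
Proof. by move=> v; rewrite /= /ctw /ctwV cipE pl_tV tWK (p_pl cipE cpiK) cpiK. Qed.
Lemma ctwVK : cancel (mklin ctwV_lin) (mklin ctw_lin).
Proof. by move=> v; rewrite /= /ctw /ctwV cipE pl_tW tVK (p_pl cipE cpiK) cpiK. Qed.
Definition cohobj : hobj k := HObj ctwK ctwVK.
Local Notation p := (cp : lmap M cohobj).
Local Notation i := (ci : lmap cohobj M).
Lemma cp_tW m : p (tW m) = tW (p m).
Proof. by rewrite [RHS]tWE [RHS]/= /ctw cipE pl_tW (p_pl cipE cpiK). Qed.
Lemma ci_tW (v : cohobj) : i (tW v) = tW (i v).
Proof. by rewrite -{2}[v]cpiK cipE pl_tW -cipE (cp_tW (i v)) cpiK. Qed.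
Lemma ci_tV (v : cohobj) : i (tV v) = tV (i v).
Proof. by apply: (can_inj (@tWK _ _)); rewrite -ci_tW !tVK. Qed.
Definition cydm : ydm_on HH cohobj := coinv_ydm (i := i) (p := p) cipE cpiK.
Lemma cydmA v h : ya cydm v h = p (bR (cst M) (i v) h). Proof. exact: ciAE. Qed.
Lemma cydmC v : yc cydm v = do (x, g <- br (cst M) (i v)) p x ⊠ g. Proof. exact: ciCE. Qed.
Lemma cydm_tw : tw_ydm cydm.
Proof.
split=> [v h|v].
- by rewrite !cydmA -cp_tW (twR (cst_tw M)) ci_tW.
- rewrite !cydmC ci_tW (twr (cst_tw M)); nrm. symmetry; nrm. inn rewrite -cp_tW. fin.
Qed.
Definition F_obj : yd H := YD (mk_yd cydm_tw).
Lemma cyd_F : cyd F_obj = cydm. Proof. exact: core_mk_yd. Qed.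
End Coinv.

Notation p M := (cp M : lmap M (F_obj M)).
Notation i M := (ci M : lmap (F_obj M) M).
Lemma pi_tW (M : bicov H) m : p M (tW m) = tW (p M m). Proof. exact: cp_tW. Qed.
Lemma i_tW (M : bicov H) v : i M (tW v) = tW (i M v). Proof. exact: ci_tW. Qed.
Lemma i_tV (M : bicov H) v : i M (tV v) = tV (i M v). Proof. exact: ci_tV. Qed.
Lemma FA (M : bicov H) v h : ya (cyd (F_obj M)) v h = p M (bR (cst M) (i M v) h).
Proof. by rewrite cyd_F cydmA. Qed.
Lemma FC (M : bicov H) v : yc (cyd (F_obj M)) v = do (x, g <- br (cst M) (i M v)) p M x ⊠ g.
Proof. by rewrite cyd_F cydmC. Qed.
Lemma ip (M : bicov H) m : i M (p M m) = pl (cst M) m. Proof. exact: cipE. Qed.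
Lemma pi (M : bicov H) v : p M (i M v) = v. Proof. exact: cpiK. Qed.
Lemma ppl (M : bicov H) m : p M (pl (cst M) m) = p M m. Proof. by rewrite -ip pi. Qed.
Lemma pli (M : bicov H) v : pl (cst M) (i M v) = i M v. Proof. by rewrite -ip pi. Qed.
Lemma bl_i (M : bicov H) v : bl (cst M) (i M v) = one HH ⊠ i M v.
Proof. by rewrite -pli pl_coinv. Qed.
Lemma br_ip (M : bicov H) (X : lmodType k) (F : M -> H -> X) v : bilin F ->
  (do (x, g <- br (cst M) (i M v)) F (i M (p M x)) g) = do (x, g <- br (cst M) (i M v)) F x g.
Proof. exact: (br_i (@cipE M) (@cpiK M)). Qed.

Section Fmap.
Variables (M N : bicov H) (f : bicov_hom M N).
Lemma Fl_lin : lin (fun v => p N (bhl f (i M v))). Proof. mlin. Qed.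
Definition Fl : lmap (F_obj M) (F_obj N) := locked (Lmap Fl_lin).
Lemma FlE v : Fl v = p N (bhl f (i M v)). Proof. by rewrite /Fl -lock. Qed.
Lemma i_Fl v : i N (Fl v) = bhl f (i M v).
Proof. by rewrite FlE ip -hom_pl pli. Qed.
Lemma Fl_p m : Fl (p M m) = p N (bhl f m).
Proof. by rewrite FlE ip hom_pl ppl. Qed.
Lemma Fl_tW v : Fl (tW v) = tW (Fl v).
Proof. by rewrite !FlE i_tW bhl_tW pi_tW. Qed.
Lemma Fl_hom : ydm_hom (cyd (F_obj M)) (cyd (F_obj N)) Fl.
Proof.
split=> [v h|v].
- by rewrite !FA i_Fl Fl_p (hR (bhl_hom f)).
- rewrite !FC i_Fl (hr (bhl_hom f)); nrm. symmetry; nrm. inn rewrite Fl_p. fin.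
Qed.
Definition F_map : yd_hom (F_obj M) (F_obj N) := mkyh Fl_tW Fl_hom.
End Fmap.

Definition F_functor : functor (bicov_cat H) (yd_cat H).
Proof.
refine (@Functor (bicov_cat H) (yd_cat H) F_obj F_map _ _).
- move=> M; apply: yd_hom_eq => v; change (Fl (idb M) v = v).
  by rewrite FlE [bhl _ _]/= pi.
- move=> A B E f g; apply: yd_hom_eq => v.
  change (Fl (BicovHom (bicov_comp_ax f g) : bicov_hom A E) v = Fl f (Fl g v)).
  by rewrite [Fl g v]FlE Fl_p FlE.
Defined.

Section Free.
Variable V : yd H.
Lemma htens_tW (h : H) (v : V) : tW (h ⊠ v : htens H V) = (tW h ⊠ tW v : htens H V).
Proof. by rewrite !tWE; exact: tens_mapE. Qed.
Definition gH : bmap H V (htens H V) := tn.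
Definition G0 : bcv_on HH (htens H V) := free_bcv (cyd V).
Lemma gH_ext (P : lmodType k) (f g : htens H V -> P) : lin f -> lin g ->
  (forall m n, f (gH m n) = g (gH m n)) -> forall t, f t = g t.
Proof. exact: TT_ext. Qed.
Lemma gH_tW h v : tW (gH h v) = gH (tW h) (tW v). Proof. exact: htens_tW. Qed.
Lemma G0L g h v : bL G0 g (gH h v) = gH (g ∙ h) v. Proof. exact: fLE. Qed.
Lemma G0R g h v : bR G0 (gH h v) g = do (a, b <- D1 H g) gH (h ∙ a) (ya (cyd V) v b).
Proof. exact: fRE. Qed.
Lemma G0l h v : bl G0 (gH h v) = do (a, b <- D1 H h) a ⊠ gH b v. Proof. exact: flE. Qed.
Lemma G0r h v : br G0 (gH h v) = do (a, b <- D1 H h) do (x, g <- yc (cyd V) v) gH a x ⊠ (b ∙ g).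
Proof. exact: frE. Qed.
Lemma G0_tw : tw_bcv G0.
Proof.
have [VA VC] := cyd_tw V.
split=> [g t|t g|t|t]; move: t; (apply: gH_ext; [mlin|mlin|move=> h v]).
- by rewrite G0L !gH_tW G0L mul1_tW.
- rewrite gH_tW !G0R D1_tW; nrm. symmetry; nrm. symmetry. inn rewrite gH_tW. inn rewrite VA.
  inn rewrite mul1_tW. fin.
- rewrite gH_tW !G0l D1_tW; nrm. symmetry; nrm. inn rewrite gH_tW. fin.
- rewrite gH_tW !G0r D1_tW VC; nrm. symmetry; nrm. inn rewrite gH_tW. inn rewrite mul1_tW. fin.
Qed.
Definition G_obj : bicov H := Bicov (mk_bicov G0_tw).
Lemma cst_G : cst G_obj = G0. Proof. exact: core_mk. Qed.
End Free.

Section Gmap.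
Variables (V W : yd H) (f : yd_hom V W).
Lemma Gl_lin : lin (fun t : G_obj V => sg t (fun h v => gH W h (yhl f v))). Proof. mlin. Qed.
Definition Gl : lmap (G_obj V) (G_obj W) := locked (Lmap Gl_lin).
Lemma GlE h v : Gl (gH V h v) = gH W h (yhl f v).
Proof. by rewrite /Gl -lock; apply: etrans (sg_tn _ _ _) _ => //; mlin. Qed.
Lemma Gl_tW t : Gl (tW t) = tW (Gl t).
Proof.
move: t; apply: gH_ext; [mlin|mlin|move=> h v].
by rewrite gH_tW !GlE [RHS]gH_tW yhl_tW.
Qed.
Lemma Gl_hom : bcv_hom (cst (G_obj V)) (cst (G_obj W)) Gl.
Proof.
rewrite !cst_G; split=> [g t|t g|t|t]; move: t; (apply: gH_ext; [mlin|mlin|move=> h v]).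
- by rewrite G0L !GlE G0L.
- rewrite G0R GlE G0R; nrm. inn rewrite GlE. inn rewrite (hya (yhl_hom f)). fin.
- rewrite GlE !G0l; nrm. symmetry; nrm. inn rewrite GlE. fin.
- rewrite GlE !G0r (hyc (yhl_hom f)); nrm. symmetry; nrm. inn rewrite GlE. fin.
Qed.
Definition G_map : bicov_hom (G_obj V) (G_obj W) := mkbh Gl_tW Gl_hom.
End Gmap.

Definition G_functor : functor (yd_cat H) (bicov_cat H).
Proof.
refine (@Functor (yd_cat H) (bicov_cat H) G_obj G_map _ _).
- move=> V; apply: bicov_hom_eq => t; change (Gl (idy V) t = t).
  by move: t; apply: gH_ext; [mlin|exact: lin_id|move=> h v]; rewrite GlE.
- move=> A B E f g; apply: bicov_hom_eq => t.
  change (Gl (YDHom (yd_comp_ax f g) : yd_hom A E) t = Gl f (Gl g t)).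
  by move: t; apply: gH_ext; [mlin|mlin|move=> h v]; rewrite !GlE.
Defined.

Section UnitCounit.
Variable M : bicov H.
Definition eta_l : lmap M (G_obj (F_obj M)) := eta (cst M) (p M).
Definition theta_l : lmap (G_obj (F_obj M)) M := theta (cst M) (i M).
Lemma eta_lE m : eta_l m = do (h, x <- bl (cst M) m) gH (F_obj M) h (p M x).
Proof. exact: etaE. Qed.
Lemma eta_tW m : eta_l (tW m) = tW (eta_l m).
Proof.
rewrite !eta_lE (twl (cst_tw M)); nrm. symmetry; nrm. inn rewrite gH_tW. inn rewrite -pi_tW. fin.
Qed.
Lemma eta_bhom : bcv_hom (cst M) (cst (G_obj (F_obj M))) eta_l.
Proof. by rewrite cst_G /G0 cyd_F; exact: eta_hom. Qed.
Definition eta_bh : bicov_hom M (G_obj (F_obj M)) := mkbh eta_tW eta_bhom.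
Lemma eta_iso : is_iso (C := bicov_cat H) eta_bh.
Proof.
apply: (bh_iso (f := eta_bh) (g := theta_l)).
- exact: (etaK (@cipE M)).
- exact: (thetaK (@cipE M) (@cpiK M)).
Qed.
End UnitCounit.

Lemma eta_nat (M N : bicov H) (f : bicov_hom M N) m :
  eta_l N (bhl f m) = Gl (F_map f) (eta_l M m).
Proof.
rewrite !eta_lE (hl (bhl_hom f)); nrm. symmetry; nrm. inn rewrite GlE.
inn rewrite [yhl _ _]Fl_p. fin.
Qed.

Section CounitYd.
Variable V : yd H.
Lemma ip_G m : i (G_obj V) (p (G_obj V) m) = pl (free_bcv (cyd V)) m.
Proof. by rewrite ip cst_G. Qed.
Lemma pi_G v : p (G_obj V) (i (G_obj V) v) = v. Proof. exact: pi. Qed.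
Definition eps_l : lmap (F_obj (G_obj V)) V := eps (A := H) HH (i (G_obj V)).
Definition epsV_l : lmap V (F_obj (G_obj V)) := epsV HH (p (G_obj V)).
Lemma eps_lp h v : eps_l (p (G_obj V) (gH V h v)) = cou HH h *: v.
Proof. by rewrite [LHS](eps_p ip_G) [LHS]ewE. Qed.
Lemma eps_hom' : ydm_hom (cyd (F_obj (G_obj V))) (cyd V) eps_l.
Proof.
rewrite cyd_F; have [h1 h2] := eps_hom ip_G pi_G; split=> [v h|v].
- rewrite cydmA -h1 [ya (coinv_ydm _ _) _ _]ciAE. by rewrite cst_G.
- rewrite cydmC -[eps_l v]/(eps HH _ v) h2 [yc (coinv_ydm _ _) _]ciCE. by rewrite cst_G.
Qed.
Lemma eps_tW v : eps_l (tW v) = tW (eps_l v).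
Proof.
rewrite -[v]pi_G; move: (i (G_obj V) v) => t; rewrite -pi_tW.
move: t; apply: gH_ext; [mlin|mlin|move=> h w].
by rewrite gH_tW !eps_lp lmZ -[cou HH (tW h)]/(e0 H (tW h)) e0_tW.
Qed.
Definition eps_bh : yd_hom (F_obj (G_obj V)) V := mkyh eps_tW eps_hom'.
Lemma eps_iso : is_iso (C := yd_cat H) eps_bh.
Proof.
apply: (yh_iso (f := eps_bh) (g := epsV_l)).
- exact: (epsK ip_G pi_G).
- exact: (epsVK ip_G).
Qed.
End CounitYd.

Lemma eps_nat (V W : yd H) (g : yd_hom V W) v :
  eps_l W (Fl (G_map g) v) = yhl g (eps_l V v).
Proof.
rewrite -[v]pi_G; move: (i (G_obj V) v) => t; rewrite Fl_p.
move: t; apply: gH_ext; [mlin|mlin|move=> h w].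
by rewrite [bhl _ _]GlE !eps_lp lmZ.
Qed.

Lemma F_equivalence : is_equivalence F_functor.
Proof.
exists G_functor, eta_bh, eps_bh; split.
- exact: eta_iso.
- by move=> M N f; apply: bicov_hom_eq => m; exact: eta_nat.
- exact: eps_iso.
- by move=> V W g; apply: yd_hom_eq => v; exact: eps_nat.
Qed.

(** * Tensor and unit constraints of the coinvariants functor *)

Section TensorConstraint.
Variables M N : bicov H.
Notation FM := (F_obj M).
Notation FN := (F_obj N).
Lemma Q_lin : lin (fun t : TV FM FN => sg t (fun v w => p (TB M N) (pH M N (i M v) (i N w)))).
Proof. mlin. Qed.
Definition Q_l : lmap (TV FM FN) (F_obj (TB M N)) := locked (Lmap Q_lin).
Lemma Q_lE v w : Q_l (vH FM FN v w) = p (TB M N) (pH M N (i M v) (i N w)).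
Proof. by rewrite /Q_l -lock; apply: etrans (sg_tn _ _ _) _ => //; mlin. Qed.
(** A balanced tensor of two coinvariants is coinvariant: in [pl_TB] the leg n_(-1) becomes 1 and
    both projections act as the identity. *)
Lemma i_Q v w : i (TB M N) (Q_l (vH FM FN v w)) = pH M N (i M v) (i N w).
Proof.
by rewrite Q_lE ip pl_TB bl_i; nrm; rewrite !pli bR1 pli.
Qed.

(** For hn the projection of h_2 n_(0) leaves only the counit of h_2, so h remains in front of
    n_(-1), as it does for mh. *)
Lemma qv_bal : bal (cst M) (cst N) (fun m n =>
  do (c, y <- bl (cst N) n) vH FM FN (p M (bR (cst M) m c)) (p N y)).
Proof.
move=> m h n; symmetry; rewrite blL; nrm.
inn rewrite (p_L (@cipE N) (@cpiK N)); nrm. inn rewrite counitr. inn rewrite -bRA. fin.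
Qed.
Lemma qv_lin : lin (fun t : TB M N => sh t (fun m n =>
  do (c, y <- bl (cst N) n) vH FM FN (p M (bR (cst M) m c)) (p N y))).
Proof. have ? := balP M N; have ? := qv_bal; mlin. Qed.
Definition qv : lmap (TB M N) (TV FM FN) := locked (Lmap qv_lin).
Lemma qvE m n : qv (pH M N m n) =
  do (c, y <- bl (cst N) n) vH FM FN (p M (bR (cst M) m c)) (p N y).
Proof. rewrite /qv -lock; apply: (sh_pt (balP M N)); [mlin | exact: qv_bal]. Qed.
(** Read through the splitting, this is the formula [pl_TB] for P_L on a balanced product; it shows
    that [qv] induces the inverse of [Q_l]. *)
Lemma Q_qv t : Q_l (qv t) = p (TB M N) t.
Proof.
move: t; apply: pH_ext; [mlin|mlin|move=> m n].
rewrite qvE; nrm. inn rewrite Q_lE. inn rewrite !ip. rewrite -[in RHS]ppl pl_TB.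
symmetry; nrm. fin.
Qed.
Lemma QV_lin : lin (fun x => qv (i (TB M N) x)). Proof. mlin. Qed.
Definition QV : lmap (F_obj (TB M N)) (TV FM FN) := locked (Lmap QV_lin).
Lemma QVK : cancel QV Q_l.
Proof. by move=> x; rewrite /QV -lock [LHS]Q_qv pi. Qed.
Lemma QK : cancel Q_l QV.
Proof.
move=> t; rewrite /QV -lock; move: t; apply: vH_ext; [|exact: lin_id|move=> v w].
  by have : lin (fun t => qv (i (TB M N) (Q_l t))) by mlin.
rewrite -[LHS]/(qv (i (TB M N) (Q_l _))) i_Q qvE bl_i; nrm.
by rewrite bR1 !pi.
Qed.
Lemma Q_tW t : Q_l (tW t) = tW (Q_l t).
Proof.
move: t; apply: vH_ext; [mlin|mlin|move=> v w].
by rewrite tW_TV !Q_lE !i_tW -pi_tW tW_TB.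
Qed.
Lemma Q_hom : ydm_hom (cyd (TV FM FN)) (cyd (F_obj (TB M N))) Q_l.
Proof.
split=> [t h|t]; move: t; (apply: vH_ext; [mlin|mlin|move=> v w]).
- rewrite TVA FA i_Q TBR -Q_qv qvE blR bl_i; nrm. symmetry; nrm. inn rewrite mul1rH.
  symmetry. inn rewrite FA. inn rewrite FA. reflexivity.
- rewrite FC i_Q TBr TVC; nrm. symmetry. rewrite !FC; nrm. inn rewrite Q_lE.
  symmetry. inn rewrite -br_ip. inat 1%N: rewrite -br_ip. fin.
Qed.
Definition Q_bh : yd_hom (TV FM FN) (F_obj (TB M N)) := mkyh Q_tW Q_hom.
Lemma Q_iso : is_iso (C := yd_cat H) Q_bh.
Proof. exact: (yh_iso (f := Q_bh) QK QVK). Qed.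
End TensorConstraint.

Lemma Q_nat (M M' N N' : bicov H) (f : bicov_hom M M') (g : bicov_hom N N') t :
  Q_l M' N' (ytm_l (F_map f) (F_map g) t) = Fl (tmap_bh f g) (Q_l M N t).
Proof.
move: t; apply: vH_ext; [mlin|mlin|move=> v w].
by rewrite ytm_lE !Q_lE Fl_p [bhl _ _]tmap_lE -[F_map f v]/(Fl f v) -[F_map g w]/(Fl g w) !i_Fl.
Qed.

Section UnitConstraint.
Notation IBH := (IB H).
Lemma U_lin : lin (fun x : IV H => p IBH ((x : k^o) *: hone H)). Proof. mlin. Qed.
Definition U_l : lmap (IV H) (F_obj IBH) := locked (Lmap U_lin).
Lemma U_lE x : U_l x = p IBH ((x : k^o) *: hone H). Proof. by rewrite /U_l -lock. Qed.
Lemma pl_one : pl (cst IBH) (hone H) = hone H.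
Proof.
rewrite plE cst_IB [bl _ _]cop1; nrm. rewrite [bL _ _ _]mulr1' ant1. by [].
Qed.
Lemma i_U x : i IBH (U_l x) = (x : k^o) *: hone H.
Proof. by rewrite U_lE ip lmZ pl_one. Qed.
Lemma UV_lin : lin (fun v => cou HH (i IBH v) : IV H). Proof. mlin. Qed.
Definition UV : lmap (F_obj IBH) (IV H) := locked (Lmap UV_lin).
Lemma UK : cancel U_l UV.
Proof.
move=> x; rewrite /UV -lock -[LHS]/(cou HH (i IBH (U_l x))) i_U lmZ.
by rewrite -[cou HH _]/(e0 H (hone H)) e0_1; exact: mulr1.
Qed.
Lemma UVK : cancel UV U_l.
Proof.
move=> v; rewrite /UV -lock -[LHS]/(U_l (cou HH (i IBH v))) U_lE -[RHS]pi; congr (p IBH _).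
have E : cop HH (i IBH v) = one HH ⊠ i IBH v by have := bl_i v; rewrite cst_IB.
by rewrite -[RHS](cou_r HH) E; symmetry; nrm.
Qed.
Lemma U_tW x : U_l (tW x) = tW (U_l x).
Proof.
rewrite tW_IV !U_lE -pi_tW [in RHS]lmZ; have -> // : tW (hone H : IBH) = hone H by exact: tW_1.
Qed.
Lemma U_hom : ydm_hom (cyd (IV H)) (cyd (F_obj IBH)) U_l.
Proof.
rewrite cyd_IV; split=> [x h|x].
- rewrite FA i_U unitA lmZ U_lE !lmZ bZl lmZ.
  (* In the regular bimodule 1·h = h·1, so left invariance of the projection computes the right
     action on the coinvariant 1 as multiplication by eps(h). *)
  have -> : bR (cst IBH) (hone H) h = bL (cst IBH) h (hone H).
    by rewrite cst_IB [LHS]mul1r' [RHS]mulr1'.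
  by rewrite (p_L (@cipE IBH) (@cpiK IBH)) !scalerA mulrC.
- rewrite FC i_U unitC; nrm. rewrite cst_IB [br _ _]cop1; nrm. symmetry; nrm.
  by rewrite U_lE lmZ bZl.
Qed.
Definition U_bh : yd_hom (IV H) (F_obj IBH) := mkyh U_tW U_hom.
Lemma U_iso : is_iso (C := yd_cat H) U_bh.
Proof. exact: (yh_iso (f := U_bh) UK UVK). Qed.
End UnitConstraint.

Lemma F_assoc (A B E : bicov H) t :
  Fl (as_bh A B E) (Q_l (TB A B) E (ytm_l (Q_bh A B) (idy (F_obj E)) t)) =
  Q_l A (TB B E) (ytm_l (idy (F_obj A)) (Q_bh B E) (yas_l (F_obj A) (F_obj B) (F_obj E) t)).
Proof.
move: t; apply: vH_ext3; [mlin|mlin|move=> u v w].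
rewrite yas_lE !ytm_lE !Q_lE Fl_p
  [bhl _ _](_ : _ = as_l A B E (pH (TB A B) E (pH A B (i A u) (i B v)) (i E w))).
  have E2 : i (TB B E) (Q_bh B E (vH (F_obj B) (F_obj E) v (tV w))) = pH B E (i B v) (i E (tV w)).
    exact: i_Q.
  by rewrite as_lE i_tW [i (TB B E) _]E2 i_tV.
by congr (as_l A B E (pH (TB A B) E _ (i E w))); exact: i_Q.
Qed.
Lemma F_lunit (A : bicov H) t :
  Fl (lu_bh A) (Q_l (IB H) A (ytm_l U_bh (idy (F_obj A)) t)) = ylu_l (F_obj A) t.
Proof.
move: t; apply: vH_ext; [mlin|mlin|move=> x v].
rewrite ytm_lE Q_lE Fl_p ylu_lE [bhl _ _]lu_lE [i _ _]i_U bZl lmZ bL1.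
by rewrite lmZ -i_tW pi.
Qed.
Lemma F_runit (A : bicov H) t :
  Fl (ru_bh A) (Q_l A (IB H) (ytm_l (idy (F_obj A)) U_bh t)) = yru_l (F_obj A) t.
Proof.
move: t; apply: vH_ext; [mlin|mlin|move=> v x].
rewrite ytm_lE Q_lE Fl_p yru_lE [bhl _ _]ru_lE [i (IB H) _]i_U bZr lmZ bR1.
by rewrite lmZ -i_tW pi.
Qed.
(** For coinvariant v the leg m_(-1) is 1, and the braiding of bicovariant bimodules becomes w_[0] ⊗
    P_L(v w_[1]); its second factor is the action v ◁ w_[1]. *)
Lemma F_braid (A B : bicov H) t :
  Fl (br_bh A B) (Q_l A B t) = Q_l B A (yb_l (F_obj A) (F_obj B) t).
Proof.
move: t; apply: vH_ext; [mlin|mlin|move=> v w].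
rewrite Q_lE Fl_p [bhl _ _]br_lE bl_i yb_lE; nrm. inn rewrite bL1.
symmetry. rewrite FC; nrm. inn rewrite Q_lE. inn rewrite FA. inn rewrite (@ip A).
symmetry. inn rewrite -br_ip. fin.
Qed.

Definition F_prebraided : prebraided_functor (bicov_pre H) (yd_pre H).
Proof.
refine (@PrebraidedFunctor (bicov_cat H) (yd_cat H) _ _ (bicov_pre H) _ _ (yd_pre H)
  F_functor Q_bh U_bh _ _ _ _ _ _ _).
- exact: Q_iso.
- exact: U_iso.
- by move=> A A' B B' f g; apply: yd_hom_eq => t; exact: Q_nat.
- by move=> A B E; apply: yd_hom_eq => t; exact: F_assoc.
- by move=> A; apply: yd_hom_eq => t; exact: F_lunit.
- by move=> A; apply: yd_hom_eq => t; exact: F_runit.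
- by move=> A B; apply: yd_hom_eq => t; exact: F_braid.
Defined.
End Functor.

(** * Reflection of isomorphisms and invertibility of the braidings *)

Section Isomorphisms.
Variables C D : category.
Lemma iso_comp (X Y Z : C) (f : Defs.hom Y Z) (g : Defs.hom X Y) :
  is_iso f -> is_iso g -> is_iso (f ∘ g).
Proof.
move=> [f' [f'f ff']] [g' [g'g gg']]; exists (g' ∘ f'); split.
- by rewrite ccompA -(ccompA g') f'f ccomp1 g'g.
- by rewrite ccompA -(ccompA f) gg' ccomp1 ff'.
Qed.
Lemma iso_cancelr (X Y Z : C) (f : Defs.hom Y Z) (g : Defs.hom X Y) :
  is_iso (f ∘ g) -> is_iso g -> is_iso f.
Proof.
move=> fg [g' [g'g gg']].
have -> : f = f ∘ g ∘ g' by rewrite -ccompA gg' ccomp1.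
by apply: iso_comp => //; exists g.
Qed.
(** Naturality of the unit exhibits [f] as the composite of G(F(f)) with a unit component and the
    inverse of another, all of them invertible. *)
Lemma equivalence_reflects_iso (F : functor C D) : is_equivalence F ->
  forall (X Y : C) (f : Defs.hom X Y), is_iso (fmap F f) -> is_iso f.
Proof.
move=> [G [eta [_ [etaI etaN _ _]]]] X Y f [h [hf fh]].
have [e [eE Ee]] := etaI Y.
have -> : f = e ∘ (fmap G (fmap F f) ∘ eta X) by rewrite -etaN ccompA eE c1comp.
apply: iso_comp; first by exists (eta Y).
apply: iso_comp => //; exists (fmap G h).
by rewrite -!fmap_comp hf fh !fmap1.
Qed.
End Isomorphisms.

Section Braided.
Variables (k : comPzRingType) (H : homHopf k).
Hypothesis Sbij : bijective (@antipode k H).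

Lemma yd_braided : is_braided (yd_pre H).
Proof.
move=> V W; have [T ST TS] := Sbij.
have TL : lin T.
  by move=> a x y; apply: (can_inj ST); rewrite linearP !TS.
pose Tl := Lmap TL.
have STK : cancel Tl (ant (core_hopf H)) by move=> x; rewrite -[LHS]/(S0 H (T x)) S0E TS.
have TSK : cancel (ant (core_hopf H)) Tl.
  by move=> x; rewrite -[LHS]/(T (S0 H x)) S0E ST.
pose g : lmap (TV W V) (TV V W) := yBV (cyd V) (cyd W) Tl.
apply: (yh_iso (f := yb_bh V W) (g := g)) => t.
- exact: (yBK (cyd V) (cyd W) STK TSK t).
- exact: (yBVK (cyd V) (cyd W) STK TSK t).
Qed.

Lemma bicov_braided : is_braided (bicov_pre H).
Proof.
move=> M N; apply: (equivalence_reflects_iso (F_equivalence H)).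
(* By [pf_braid] the image of the braiding composed with the tensor constraint is the constraint
   composed with the Yetter-Drinfeld braiding; the constraints being invertible, one braiding is
   traded for the other. *)
apply: (iso_cancelr _ (Q_iso M N)).
rewrite [_ ∘ _](pf_braid (F_prebraided H) M N); apply: iso_comp; first exact: Q_iso.
exact: yd_braided.
Qed.
End Braided.

Theorem corollary7p8 (k : comPzRingType) (H : homHopf k) :
  exists (B : bicov_prebraided H) (Y : yd_prebraided H)
         (F : prebraided_functor B Y),
    is_equivalence F /\
    (bijective (@antipode k H) -> is_braided B /\ is_braided Y).
Proof.
exists (bicov_pre H), (yd_pre H), (F_prebraided H); split.
- exact: F_equivalence.
- by move=> Sbij; split; [exact: bicov_braided | exact: yd_braided].
Qed.
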